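(* Let $d\ge 1$. For arbitrary radially symmetric initial data $({\bf V}_0,{\bf E}_0)=(F_0(r)x,\,G_0(r)x)$ (from the class described in the context) there exists $\nu>2$ such that the solution $({\bf V},{\bf E})$ of the Cauchy problem $$\frac{\partial {\bf V}}{\partial t}+({\bf V}\cdot\nabla){\bf V}=-{\bf E}-\nu{\bf V},\qquad \frac{\partial {\bf E}}{\partial t}+{\bf V}\,\mathrm{div}\,{\bf E}={\bf V},\qquad ({\bf V},{\bf E})|_{t=0}=({\bf V}_0,{\bf E}_0)$$ keeps $C^1$-smoothness for all $t>0$, and the asymptotic property $$\|{\bf V},{\bf E}\|_{C^1(\overline{\mathbb R}_+)}\le \mathrm{const}\; e^{-\frac{\nu-\sqrt{\nu^2-4}}{2}\,t}\to 0,\qquad t\to\infty,$$ holds, where the constant does not depend on $t$.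
   Context: Here $x=(x_1,\dots,x_d)\in\mathbb R^d$, $r=|x|=\sqrt{x_1^2+\dots+x_d^2}$, $t\ge 0$, and ${\bf V}(t,x),{\bf E}(t,x)\in\mathbb R^d$; $\nu>0$ is a constant (friction coefficient). Solutions are sought in the radially symmetric form ${\bf V}=F(t,r)x$, ${\bf E}=G(t,r)x$. The initial data are ${\bf V}_0=F_0(r)x$, ${\bf E}_0=G_0(r)x$ with $F_0,G_0\in C^2(\overline{\mathbb R}_+)$, and ${\bf V}_0,{\bf E}_0$ are bounded together with their derivatives uniformly in $r\in\overline{\mathbb R}_+=[0,\infty)$. The density is $n=1-\mathrm{div}\,{\bf E}$, and it is assumed that initially $n>0$, i.e. $\mathrm{div}\,{\bf E}_0<1$ (so $G_0<1/d$). Norm: $\|f\|_{C^1(\overline{\mathbb R}_+)}=\sum_{i=0}^1\sup_{r\in\overline{\mathbb R}_+}|f^{(i)}(r)|$. For radially symmetric fields, $\|{\bf V},{\bf E}\|_{C^1(\overline{\mathbb R}_+)}$ is this norm of the vector function $r\mapsto (rF(r),rG(r))$ of radial components (with the Euclidean norm in place of the absolute value), taken at fixed time $t$. ''Keeps $C^1$-smoothness for all $t>0$'' means that a classical ($C^1$) solution exists for all $t>0$.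
   Formalization: The assumption that initially n>0 (div E_0<1) is taken uniformly, n ≥ n_0 > 0 on all of R^d; with mere pointwise positivity the decay claim is false (d=1, V_0=0, E_0'=s cos s/(1+s) gives sup E_x ≥ 1 for all t). *)

(* Defs.v *)
From HB Require Import structures.
From mathcomp Require Import all_boot all_order all_algebra.
From mathcomp Require Import all_classical all_reals all_analysis.

Set Implicit Arguments.
Unset Strict Implicit.
Unset Printing Implicit Defensive.

Import Order.TTheory GRing.Theory Num.Theory.
Import numFieldNormedType.Exports.

Local Open Scope classical_set_scope.
Local Open Scope ring_scope.

(* Functions of a half-line variable (the time t or the radius r) are total
   functions on R of which only the restriction to [0, +oo[ matters:
   [half_derive] only uses increments h with 0 <= t + h, so it is the usual
   derivative for t > 0 and the right derivative at t = 0. *)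
Section HalfLine.
Context {R : realType} {W : normedModType R}.

Definition half_nbhs (t : R) : set_system R :=
  within [set h : R | 0 <= t + h] (0 : R)^'.

Definition half_quotient (f : R -> W) (t h : R) : W :=
  h^-1 *: (f (t + h) - f t).

Definition half_derivable (f : R -> W) (t : R) : Prop :=
  cvg (half_quotient f t h @[h --> half_nbhs t]).

Definition half_derive (f : R -> W) (t : R) : W :=
  lim (half_quotient f t h @[h --> half_nbhs t]).

Definition half_C1 (f : R -> W) : Prop :=
  (forall t, 0 <= t -> half_derivable f t) /\
  {within `[0, +oo[, continuous (half_derive f)}.

Definition half_C2 (f : R -> W) : Prop :=
  half_C1 f /\ half_C1 (half_derive f).

End HalfLine.

(* The C^1([0, +oo[) norm of r |-> (a r, b r) in R^2; it is +oo when
   one of the two suprema is infinite. *)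
Definition C1_norm (R : realType) (a b : R -> R) : \bar R :=
  (ereal_sup [set (Num.sqrt (a r ^+ 2 + b r ^+ 2))%:E | r in `[0%R, +oo[] +
   ereal_sup [set (Num.sqrt (half_derive a r ^+ 2 +
                             half_derive b r ^+ 2))%:E | r in `[0%R, +oo[])%E.

(* Radial components of the fields F(r) x and G(r) x. *)
Definition radial_C1_norm (R : realType) (F G : R -> R) : \bar R :=
  C1_norm (fun r => r * F r) (fun r => r * G r).

Section Fields.
Context {R : realType} {d : nat}.
Local Notation vec := 'rV[R]_d.

(* The norm `|x| of the library is the sup norm on 'rV[R]_d. *)
Definition eucl (x : vec) : R := Num.sqrt (\sum_i x 0 i ^+ 2).

Definition radial (f : R -> R) (x : vec) : vec := f (eucl x) *: x.

Definition partial (j : 'I_d) (f : vec -> vec) (x : vec) : vec :=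
  derive f x (delta_mx 0 j).

Definition div (E : vec -> vec) (x : vec) : R := \sum_i partial i E x 0 i.

Definition advect (V W : vec -> vec) (x : vec) : vec :=
  \sum_j V x 0 j *: partial j W x.

Definition density (E : vec -> vec) (x : vec) : R := 1 - div E x.

Definition spacetime : set (R * vec) := [set p | 0 <= p.1].

(* C^1 up to the boundary t = 0 on [0, +oo[ x R^d. *)
Definition spacetime_C1 (U : R -> vec -> vec) : Prop :=
  [/\ {within spacetime, continuous (fun p => U p.1 p.2)},
      forall t x, 0 <= t -> half_derivable (U ^~ x) t,
      {within spacetime,
        continuous (fun p => half_derive (U ^~ p.2) p.1)},
      forall j t x, 0 <= t -> derivable (U t) x (delta_mx 0 j) &
      forall j, {within spacetime,
        continuous (fun p => partial j (U p.1) p.2)}].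

Definition classical_solution (nu : R) (V0 E0 : vec -> vec)
    (V E : R -> vec -> vec) : Prop :=
  [/\ spacetime_C1 V,
      spacetime_C1 E,
      forall t x, 0 <= t ->
        half_derive (V ^~ x) t + advect (V t) (V t) x
          = - E t x - nu *: V t x,
      forall t x, 0 <= t ->
        half_derive (E ^~ x) t + div (E t) x *: V t x = V t x &
      forall x, V 0 x = V0 x /\ E 0 x = E0 x].

Definition radial_solution (nu : R) (F0 G0 : R -> R) (F G : R -> R -> R) :=
  classical_solution nu (radial F0) (radial G0)
    (fun t => radial (F t)) (fun t => radial (G t)).

End Fields.
Arguments radial_solution {R} d nu F0 G0 F G.

(* Main.v *)
Require Import Defs.
From HB Require Import structures.
From mathcomp Require Import all_boot all_order all_algebra.
From mathcomp Require Import all_classical all_reals all_analysis.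
From mathcomp Require Import ring lra.
Import Order.TTheory GRing.Theory Num.Theory.
Import numFieldNormedType.Exports.
Local Open Scope classical_set_scope.
Local Open Scope ring_scope.

(** Put y = G / (1 - d G) and f = F / (1 - d G) along a characteristic
    r = Q(a, t), dQ/dt = F Q, with label a. The system becomes the oscillator
      y' = f,   f' = - nu f - y + (d - 1) f^2 / (1 + d y),
    whose initial values do not depend on nu. Write nu = mu + 1 / mu, so that mu is
    the slow rate of the linear part and the rate in the theorem. For mu small, a
    Lyapunov function in (y, f + mu y) keeps 1 + d y away from 0 and forces
    exponential decay; the nonlinear term is then an integrable perturbation of the
    linear equation, so that y, f and their label derivatives decay exactly like
    exp (- mu t).
    Characteristics do not cross because the reciprocal X of the density solves
      X'' + (nu - 2 (d - 1) F) X' + (1 + (d - 1) d F^2) X = 1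
    along them, and for nu large this equation preserves the cone
    X >= b, X' + alpha (X - b) >= 0. Inverting the label map yields F and G, with
    decay of r F_r and r G_r.
    Any other solution, evaluated along these characteristics, satisfies a linear
    differential system together with the constructed one, so Gronwall's lemma shows
    that they agree; the characteristics cover all r > 0. *)

(** * Calculus on the half-line *)

(** Division by [1 - d G] removes the products from the first equation, turns [1 / (1 - d G)] into
    the affine expression [1 + d y], and leaves one nonlinear term, quadratic in [f] and nonnegative
    as long as [1 + d y > 0]. This sign bounds [1 + d y] from below for data of any size. The rate
    to be proved is exactly that of the slow linear mode, so a bound with a slightly worse rate does
    not suffice. Such a bound (rate [3 mu / 4]) is proved first; it makes the perturbation
    integrable in time, after which the full rate [mu] costs only a constant factor. All thresholds
    for [mu] are computed from the initial values of [y], [f] and of their label derivatives, in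
    which [nu] does not occur; hence the choice of [nu] is not circular. The delicate point is the
    origin: the profiles are only shown to be continuous at [r = 0], and a field [F(r) x] does not
    determine [F(0)]. Therefore [r F_r] and [r G_r] are carried along instead of [F_r] and [G_r],
    and label derivatives are measured against a rate that is singular like [1 / a]. *)

Section Rules.
Context {R : realType}.
Implicit Types (f g : R -> R) (t a b c : R).

Lemma derC c t : is_derive t 1 (fun=> c) 0.
Proof. exact: is_derive_cst. Qed.

Lemma derI t : is_derive t 1 (fun s => s) 1.
Proof. exact: is_derive_id. Qed.

Lemma derN f t a : is_derive t 1 f a -> is_derive t 1 (fun s => - f s) (- a).
Proof. exact: is_deriveN. Qed.

Lemma derD f g t a b : is_derive t 1 f a -> is_derive t 1 g b ->
  is_derive t 1 (fun s => f s + g s) (a + b).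
Proof. exact: is_deriveD. Qed.

Lemma derM f g t a b : is_derive t 1 f a -> is_derive t 1 g b ->
  is_derive t 1 (fun s => f s * g s) (f t * b + g t * a).
Proof. exact: is_deriveM. Qed.

Lemma derV f t a : f t != 0 -> is_derive t 1 f a ->
  is_derive t 1 (fun s => (f s)^-1) (- (f t) ^- 2 * a).
Proof. exact: is_deriveV. Qed.

Lemma der_comp f g t a b : is_derive (g t) 1 f a -> is_derive t 1 g b ->
  is_derive t 1 (fun s => f (g s)) (a * b).
Proof. exact: is_derive1_comp. Qed.

Lemma derX f n t a : is_derive t 1 f a ->
  is_derive t 1 (fun s => f s ^+ n.+1) (n.+1%:R * f t ^+ n * a).
Proof.
move=> df; apply: (@der_comp (fun x => x ^+ n.+1) f) => //.
apply: DeriveDef; first exact: exprn_derivable.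
by rewrite exp_derive scaler1.
Qed.

Lemma der_exp g t b : is_derive t 1 g b ->
  is_derive t 1 (fun s => expR (g s)) (expR (g t) * b).
Proof. by apply: der_comp; exact: is_derive_expR. Qed.

Lemma der_ln g t b : 0 < g t -> is_derive t 1 g b ->
  is_derive t 1 (fun s => ln (g s)) ((g t)^-1 * b).
Proof. by move=> g0; apply: der_comp; exact: is_derive1_ln. Qed.

Lemma der_eq f t a b : is_derive t 1 f a -> a = b -> is_derive t 1 f b.
Proof. by move=> ? <-. Qed.

Lemma der_continuous f t a : is_derive t 1 f a -> {for t, continuous f}.
Proof. by move=> [+ _] => /derivable1_diffP/differentiable_continuous. Qed.

End Rules.

(** Hypotheses take precedence over the rules, so opaque functions with a known derivative act as
    atoms. [der] computes a derivative by structure and leaves its equality with the wanted one,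
    usually for [ring] or [field]. *)
Ltac der1 := first [ eassumption | eapply derC | eapply derI
  | eapply derX | eapply derM | eapply derN | eapply derD | eapply der_exp ].
Ltac der := eapply der_eq; [ repeat der1 | lazy beta ].

Section Tools.
Context {R : realType}.
Implicit Types (f g e : R -> R).

Lemma ray_nondecreasing f f' : (forall t : R, 0 <= t -> is_derive t 1 f (f' t)) ->
  (forall t : R, 0 <= t -> 0 <= f' t) -> forall s t : R, 0 <= s -> s <= t -> f s <= f t.
Proof.
move=> df f'0 s t s0 st.
apply: (@ger0_derive1_ndecry _ f 0) => //.
- by move=> x; rewrite in_itv/= andbT => /ltW x0; case: (df x x0).
- by move=> x; rewrite in_itv/= andbT => /ltW x0; rewrite derive1E;
    have [_ ->] := df x x0; exact: f'0.
apply: continuous_in_subspaceT => x.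
by rewrite inE/= in_itv/= andbT => x0; apply: der_continuous (df x x0).
Qed.

Lemma ray_nonincreasing f f' : (forall t : R, 0 <= t -> is_derive t 1 f (f' t)) ->
  (forall t : R, 0 <= t -> f' t <= 0) -> forall s t : R, 0 <= s -> s <= t -> f t <= f s.
Proof.
move=> df f'0 s t s0 st; rewrite -lerN2.
apply: (ray_nondecreasing (fun s => - f s) (fun s => - f' s)) => // u u0.
- by apply: derN; exact: df.
- by rewrite oppr_ge0 f'0.
Qed.

Lemma comparison f f' g g' : (forall t : R, 0 <= t -> is_derive t 1 f (f' t)) ->
  (forall t : R, 0 <= t -> is_derive t 1 g (g' t)) ->
  (forall t : R, 0 <= t -> `|f' t| <= g' t) ->
  forall t : R, 0 <= t -> `|f t - f 0| <= g t - g 0.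
Proof.
move=> df dg fg t t0.
have h1 : g 0 + f 0 <= g t + f t.
  apply: (ray_nondecreasing (fun s => g s + f s) (fun s => g' s + f' s)) => // u u0.
    by apply: derD; [exact: dg|exact: df].
  by have := fg u u0; rewrite ler_norml => /andP[]; lra.
have h2 : g 0 - f 0 <= g t - f t.
  apply: (ray_nondecreasing (fun s => g s - f s) (fun s => g' s - f' s)) => // u u0.
    by apply: derD; [exact: dg|apply: derN; exact: df].
  by have := fg u u0; rewrite ler_norml => /andP[]; lra.
by rewrite ler_norml; apply/andP; split; lra.
Qed.

(** The function [e t * expR (- (C * t)) - D * t] is nonincreasing on [[0, T]]. The linear term
    [D * t], coarser than the exact integral, avoids a division by [C]. *)
Lemma gronwall e e' (C D : R) (T : R) : 0 <= C -> 0 <= D ->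
  (forall t : R, 0 <= t -> is_derive t 1 e (e' t)) ->
  (forall t : R, 0 <= t -> t <= T -> e' t <= C * e t + D) ->
  forall t : R, 0 <= t -> t <= T -> e t <= (e 0 + D * t) * expR (C * t).
Proof.
move=> C0 D0 de ee t t0 tT.
have h (s : R) : 0 <= s -> s <= t -> e s * expR (- (C * s)) - D * s <= e 0.
  move=> s0 st.
  pose h s := e s * expR (- (C * s)) - D * s.
  have dh (u : R) : 0 <= u ->
      is_derive u 1 h (expR (- (C * u)) * (e' u - C * e u) - D).
    by move=> u0; have deu := de u u0; rewrite /h; der; ring.
  have -> : e 0 = h 0 by rewrite /h; rewrite !mulr0 oppr0 expR0; ring.
  rewrite -/(h s) -lerN2.
  apply: (@ger0_derive1_ndecr _ (fun s => - h s) 0 t) => //.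
  - move=> x; rewrite in_itv/= => /andP[/ltW x0 _].
    by have := derN _ _ _ (dh x x0); case.
  - move=> x; rewrite in_itv/= => /andP[/ltW x0 /ltW xt].
    rewrite derive1E; have [_ ->] := derN _ _ _ (dh x x0).
    have := ee x x0 (le_trans xt tT) => eex.
    have E1 : expR (- (C * x)) <= 1 by rewrite -expR0 ler_expR oppr_le0 mulr_ge0.
    have E0 := expR_ge0 (- (C * x)).
    have : expR (- (C * x)) * (e' x - C * e x) <= expR (- (C * x)) * D.
      by apply: ler_wpM2l => //; lra.
    nra.
  - apply: continuous_in_subspaceT => x.
    rewrite inE/= in_itv/= => /andP[x0 _].
    exact: der_continuous (derN _ _ _ (dh x x0)).
have := h t t0 (lexx t); rewrite expRN lerBlDr.
by rewrite ler_pdivrMr ?expR_gt0.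
Qed.

Lemma antiderivative g : continuous g -> exists2 G : R -> R, G 0 = 0 &
  forall t : R, 0 <= t -> is_derive t 1 G (g t).
Proof.
move=> cg.
(* Starting the integral at [-1] makes [0] an interior point, so the derivative at [t = 0] is
   two-sided. *)
pose H x := (\int[lebesgue_measure]_(s in `[(- 1 : R), x]) g s)%R.
have dH (t : R) : 0 <= t -> is_derive t 1 H (g t).
  move=> t0.
  have [] := @continuous_FTC1_closed R g (-1) t (t + 1) _ _ _ (cg t).
  - by rewrite ltrDl.
  - apply: continuous_compact_integrable; first exact: segment_compact.
    by apply: continuous_subspaceT.
  - by rewrite (lt_le_trans _ t0)// ltrN10.
  - move=> dH Hg; apply: (@DeriveDef _ _ _ _ _ _ _ dH).
    by rewrite -derive1E; exact: Hg.
exists (fun x => H x - H 0); first by rewrite subrr.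
by move=> t t0; have := dH t t0 => dHt; der; ring.
Qed.

End Tools.

Section ContinuityRules.
Context {R : realType} {T : topologicalType}.
Implicit Types f g : T -> R.

Lemma continuous_add f g : continuous f -> continuous g ->
  continuous (fun x => f x + g x).
Proof. by move=> cf cg x; apply: (@continuousD _ _ _ f g); [exact: cf|exact: cg]. Qed.

Lemma continuous_sub f g : continuous f -> continuous g ->
  continuous (fun x => f x - g x).
Proof. by move=> cf cg x; apply: (@continuousB _ _ _ f g); [exact: cf|exact: cg]. Qed.

Lemma continuous_mul f g : continuous f -> continuous g ->
  continuous (fun x => f x * g x).
Proof. by move=> cf cg x; apply: (@continuousM _ _ f g); [exact: cf|exact: cg]. Qed.

Lemma continuous_inv f : (forall x, f x != 0) -> continuous f ->
  continuous (fun x => (f x)^-1).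
Proof. by move=> f0 cf x; apply: continuousV; [exact: f0|exact: cf]. Qed.

Lemma continuous_const (k : R) : continuous (fun _ : T => k).
Proof. by move=> x; exact: cst_continuous. Qed.

End ContinuityRules.

Section Near.
Context {R : realType} {T : topologicalType}.

Lemma continuous_near (f : T -> R) t : {for t, continuous f} ->
  forall e : R, 0 < e -> \forall s \near t, `|f t - f s| <= e.
Proof. by move=> cf e e0; move: e e0; apply/cvgrPdist_le. Qed.

Lemma near_continuous (f : T -> R) t :
  (forall e : R, 0 < e -> \forall s \near t, `|f t - f s| <= e) ->
  {for t, continuous f}.
Proof. by move=> h; apply/cvgrPdist_le. Qed.

End Near.

(** * A Picard theorem for second-order equations *)

Section Picard.
Context {R : realType}.
Implicit Types (y f g : R -> R).

Lemma half_expn (k : nat) : (2 : R) ^- k.+1 = 2^-1 * 2 ^- k.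
Proof. by rewrite exprS invfM. Qed.

Lemma geometric_small (a e : R) : 0 < e -> exists k, a / 2 ^+ k <= e.
Proof.
move=> e0; have [k hk] : exists k : nat, a / e <= k%:R.
  by exists (Num.bound `|a / e|); apply: (le_trans (ler_norm _)); apply: ltW; exact: archi_boundP.
exists k; rewrite ler_pdivrMr ?exprn_gt0// mulrC -ler_pdivrMr//.
apply: (le_trans hk); rewrite -natrX ler_nat.
exact: (ltnW (ltn_expl _ _)).
Qed.

Lemma le0_of_geometric (x a : R) : (forall k, x <= a / 2 ^+ k) -> x <= 0.
Proof.
move=> h; apply/ler_addgt0Pr => e e0; rewrite add0r.
by have [k hk] := geometric_small a e e0; exact: le_trans hk.
Qed.

(** The numbers [u k - 2 a / 2 ^ k] increase, the numbers [u k + 2 a / 2 ^ k] decrease, and the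
    former stay below the latter. The supremum of the lower ends is the limit, with an explicit
    error at every [k]. *)
Lemma geometric_limit (u : nat -> R) (a : R) :
  (forall k, `|u k.+1 - u k| <= a / 2 ^+ k) ->
  exists l, forall k, `|u k - l| <= 2 * (a / 2 ^+ k).
Proof.
move=> ua.
pose v k := u k - 2 * (a / 2 ^+ k).
pose w k := u k + 2 * (a / 2 ^+ k).
have a0 k : 0 <= a / 2 ^+ k by apply: le_trans (ua k).
have hE k : a / 2 ^+ k.+1 = (a / 2 ^+ k) / 2 by rewrite half_expn; lra.
have vS j k : (j <= k)%N -> v j <= v k.
  elim: k => [|k IH]; first by rewrite leqn0 => /eqP ->.
  rewrite leq_eqVlt => /predU1P[->//|/IH/le_trans]; apply.
  by rewrite /v hE; have := ua k; rewrite ler_norml => /andP[]; lra.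
have wS j k : (j <= k)%N -> w k <= w j.
  elim: k => [|k IH]; first by rewrite leqn0 => /eqP ->.
  rewrite leq_eqVlt => /predU1P[->//|/IH]; apply: le_trans.
  by rewrite /w hE; have := ua k; rewrite ler_norml => /andP[]; lra.
have vw j k : v j <= w k.
  apply: (le_trans (vS _ _ (leq_maxl j k))).
  apply: (le_trans _ (wS _ _ (leq_maxr j k))).
  by rewrite /v /w; have := a0 (maxn j k); lra.
have vsup : has_sup (range v).
  by split; [exists (v 0%N); exists 0%N|exists (w 0%N) => _ [j _ <-]].
exists (sup (range v)) => k; rewrite ler_norml; apply/andP; split.
- have : sup (range v) <= w k by apply: ge_sup => [|_ [j _ <-]//]; case: vsup.
  by rewrite /w; lra.
- have : v k <= sup (range v) by apply: ub_le_sup; [case: vsup|exists k].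
  by rewrite /v; lra.
Qed.

(* Freezes a function of [t >= 0] at its value at [0], so that continuity on
   [0, +oo[ becomes continuity on the whole line. *)
Definition pos_time (t : R) := Order.max t 0.

Lemma pos_time_ge0 t : 0 <= pos_time t. Proof. by rewrite /pos_time le_max lexx orbT. Qed.
Lemma pos_time_id t : 0 <= t -> pos_time t = t. Proof. by move=> t0; rewrite /pos_time max_l. Qed.
Lemma pos_time_continuous : continuous pos_time.
Proof.
move=> t; apply: (@continuous_max R R id (fun=> 0)); first exact: cvg_id.
exact: cvg_cst.
Qed.

Lemma continuous_pos_time (f : R -> R) : (forall t : R, 0 <= t -> {for t, continuous f}) ->
  continuous (fun t => f (pos_time t)).
Proof.
move=> cf t; apply: (@continuous_comp _ _ _ pos_time f); first exact: pos_time_continuous.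
exact/cf/pos_time_ge0.
Qed.

Lemma pos_time_leD (s t : R) : `|s - t| < 1 -> pos_time s <= pos_time t + 1.
Proof.
rewrite ltr_norml => /andP[_ st]; rewrite /pos_time ge_max; apply/andP; split.
  by have t1 : t <= Num.max t 0; [rewrite le_max lexx|lra].
by have := pos_time_ge0 t; rewrite /pos_time; lra.
Qed.

Lemma lipschitz_comp_continuous (h : R -> R -> R -> R) (L : R) y f :
  (forall a b, continuous (fun t => h t a b)) ->
  (forall t a b a' b',
    `|h t a b - h t a' b'| <= L * (`|a - a'| + `|b - b'|)) ->
  continuous y -> continuous f -> continuous (fun t => h t (y t) (f t)).
Proof.
move=> ch hL cy cf t; apply: near_continuous => e e0.
pose b := e / (4 * (`|L| + 1)).
have L0 := normr_ge0 L.
have b0 : 0 < b by rewrite /b divr_gt0//; lra.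
have bE : b * (4 * (`|L| + 1)) = e by rewrite /b divfK//; apply: lt0r_neq0; lra.
near=> s.
have h1 : `|y t - y s| <= b by near: s; exact: (continuous_near _ _ (cy t) _ b0).
have h2 : `|f t - f s| <= b by near: s; exact: (continuous_near _ _ (cf t) _ b0).
have h3 : `|h t (y t) (f t) - h s (y t) (f t)| <= e / 2.
  by near: s; apply: (continuous_near _ _ (ch (y t) (f t) t)); lra.
have := hL s (y t) (f t) (y s) (f s) => h4.
apply: (le_trans (ler_distD (h s (y t) (f t)) _ _)).
have := ler_norm L => LL.
have := normr_ge0 (y t - y s); have := normr_ge0 (f t - f s).
have : L * (`|y t - y s| + `|f t - f s|) <= `|L| * (b + b).
  by apply: (@le_trans _ _ (`|L| * (`|y t - y s| + `|f t - f s|)));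
    [apply: ler_wpM2r; rewrite ?addr_ge0|apply: ler_wpM2l => //; lra].
nra.
Unshelve. all: by end_near. Qed.

Lemma locally_uniform_limit (fk : nat -> R -> R) f (C Lam : R) :
  0 <= C -> 0 <= Lam ->
  (forall k (t : R), 0 <= t -> {for t, continuous (fk k)}) ->
  (forall k (t : R), 0 <= t ->
     `|fk k t - f t| <= 2 * (C * expR (Lam * t) / 2 ^+ k)) ->
  continuous (fun t => f (pos_time t)).
Proof.
move=> C0 L0 cfk fkf t; apply: near_continuous => e e0.
have [k hk] := geometric_small (C * expR (Lam * (pos_time t + 1))) (e / 6) ltac:(lra).
have ck := continuous_pos_time _ (cfk k) t.
near=> s.
have h1 : `|fk k (pos_time t) - fk k (pos_time s)| <= e / 3.
  by near: s; apply: (continuous_near _ _ ck); lra.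
have st : pos_time s <= pos_time t + 1.
  apply: pos_time_leD; rewrite distrC.
  by near: s; exact: nbhsx_ballx.
have bd u : 0 <= u -> u <= pos_time t + 1 -> `|fk k u - f u| <= e / 3.
  move=> u0 ut; apply: (le_trans (fkf k u u0)).
  have : C * expR (Lam * u) / 2 ^+ k <= C * expR (Lam * (pos_time t + 1)) / 2 ^+ k.
    rewrite ler_pM2r ?invr_gt0 ?exprn_gt0//.
    by apply: ler_wpM2l => //; rewrite ler_expR ler_wpM2l.
  by lra.
have := bd (pos_time t) (pos_time_ge0 t) ltac:(lra).
have := bd (pos_time s) (pos_time_ge0 s) st.
move: h1; rewrite !ler_norml => /andP[? ?] /andP[? ?] /andP[? ?].
by apply/andP; split; lra.
Unshelve. all: by end_near. Qed.

End Picard.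

Section PicardTheorem.
Context {R : realType}.
Variables (h : R -> R -> R -> R) (L : R).
Hypothesis ch : forall a b, continuous (fun t => h t a b).
Hypothesis hL : forall t a b a' b',
    `|h t a b - h t a' b'| <= L * (`|a - a'| + `|b - b'|).
Hypothesis h0 : forall t, h t 0 0 = 0.
Variables (y0 f0 : R).

Let step (A : (R -> R) -> R -> R) (p : (R -> R) * (R -> R)) :=
  (fun t => y0 + A (fun s => p.2 (pos_time s)) t,
   fun t => f0 + A (fun s => h (pos_time s) (p.1 (pos_time s)) (p.2 (pos_time s))) t).

(** In the sup norm weighted by [expR (- Lam * t)] on the whole half-line the Picard map contracts
    by [1 / 2]. The global solution is thus obtained at once, without continuing local ones. *)
Lemma picard : exists y f : R -> R, [/\ y 0 = y0, f 0 = f0,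
  forall t : R, 0 <= t -> is_derive t 1 y (f t) &
  forall t : R, 0 <= t -> is_derive t 1 f (h t (y t) (f t))].
Proof.
have /choice[A hA] : forall g : R -> R, exists G : R -> R, continuous g ->
    G 0 = 0 /\ forall t : R, 0 <= t -> is_derive t 1 G (g t).
  move=> g; have [cg|ncg] := pselect (continuous g).
    by have [G G0 dG] := antiderivative g cg; exists G.
  by exists (fun=> 0).
have L0 : 0 <= L.
  have := hL 0 1 0 0 0; rewrite !subrr subr0 normr1 normr0 addr0 mulr1.
  exact: le_trans.
pose good (p : (R -> R) * (R -> R)) := forall t : R, 0 <= t ->
  {for t, continuous p.1} /\ {for t, continuous p.2}.
have ch' p : good p ->
    continuous (fun s => h (pos_time s) (p.1 (pos_time s)) (p.2 (pos_time s))).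
  move=> gp; apply: (lipschitz_comp_continuous (fun s => h (pos_time s)) L) => //.
  - by move=> a b t; apply: (@continuous_comp _ _ _ pos_time (fun s => h s a b));
      [exact: pos_time_continuous|exact: ch].
  - by apply: continuous_pos_time => t /gp[].
  - by apply: continuous_pos_time => t /gp[].
have c2 p : good p -> continuous (fun s => p.2 (pos_time s)).
  by move=> gp; apply: continuous_pos_time => t /gp[].
have dstep p : good p -> [/\ (step A p).1 0 = y0, (step A p).2 0 = f0,
    forall t : R, 0 <= t -> is_derive t 1 (step A p).1 (p.2 t) &
    forall t : R, 0 <= t -> is_derive t 1 (step A p).2 (h t (p.1 t) (p.2 t))].
  move=> gp; have [a1 a2] := hA _ (c2 p gp); have [b1 b2] := hA _ (ch' p gp).
  split=> [||t t0|t t0]; rewrite /step /= ?a1 ?b1 ?addr0//.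
    by have := a2 t t0; rewrite pos_time_id// => d; der; ring.
  by have := b2 t t0; rewrite pos_time_id// => d; der; ring.
have gstep p : good p -> good (step A p).
  move=> /dstep[_ _ d1 d2] t t0.
  by split; [exact: der_continuous (d1 t t0)|exact: der_continuous (d2 t t0)].
(* Integrating [expR (Lam * s)] gains a factor [1 / Lam]. A contraction by [1 / 2] needs [Lam >= 2]
   for the first component and [Lam >= 4 * L] for the second, whose integrand is bounded by [L]
   times the sum of two differences. *)
pose Lam := 4 * L + 2; pose e (t : R) := expR (Lam * t).
have Lam0 : 0 <= Lam by rewrite /Lam; lra.
have e1 t : 0 <= t -> 1 <= e t.
  by move=> t0; rewrite /e -expR0 ler_expR mulr_ge0.
pose close (K : R) (p q : (R -> R) * (R -> R)) := forall t : R, 0 <= t ->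
  `|p.1 t - q.1 t| <= K * e t /\ `|p.2 t - q.2 t| <= K * e t.
have contr K p q : good p -> good q -> close K p q ->
    close (K / 2) (step A p) (step A q).
  move=> gp gq pq t t0.
  have [p1 p2 p3 p4] := dstep _ gp; have [q1 q2 q3 q4] := dstep _ gq.
  have K0 : 0 <= K.
    have [+ _] := pq 0 (lexx 0); rewrite /e mulr0 expR0 mulr1.
    exact: le_trans.
  have de (u : R) : 0 <= u ->
      is_derive u 1 (fun s => K / 2 * e s) (K / 2 * Lam * e u).
    by move=> _; rewrite /e; der; ring.
  split.
  - have := @comparison _ (fun s => (step A p).1 s - (step A q).1 s)
      (fun s => p.2 s - q.2 s) (fun s => K / 2 * e s)
      (fun s => K / 2 * Lam * e s) _ de _ t t0.
    rewrite p1 q1 subrr subr0 => H; apply: le_trans (H _ _) _.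
    + by move=> u u0; have d1 := p3 u u0; have d2 := q3 u u0; der.
    + move=> u u0; have [_ pqu] := pq u u0.
      have := mulr_ge0 (mulr_ge0 K0 L0) (expR_ge0 (Lam * u)).
      by rewrite -/(e u) /Lam; lra.
    + by have := e1 0 (lexx 0); nra.
  - have := @comparison _ (fun s => (step A p).2 s - (step A q).2 s)
      (fun s => h s (p.1 s) (p.2 s) - h s (q.1 s) (q.2 s))
      (fun s => K / 2 * e s) (fun s => K / 2 * Lam * e s) _ de _ t t0.
    rewrite p2 q2 subrr subr0 => H; apply: le_trans (H _ _) _.
    + by move=> u u0; have d1 := p4 u u0; have d2 := q4 u u0; der.
    + move=> u u0; have [pqu1 pqu2] := pq u u0.
      apply: le_trans (hL _ _ _ _ _) _.
      have := mulr_ge0 K0 (expR_ge0 (Lam * u)); rewrite -/(e u) => Ke.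
      apply: (@le_trans _ _ (L * (K * e u + K * e u))).
        by apply: ler_wpM2l => //; exact: lerD.
      by rewrite /Lam; lra.
    + by have := e1 0 (lexx 0); nra.
(* Since [h t 0 0 = 0], one step from the zero pair gives the constant pair [(y0, f0)], so the first
   increment is bounded by [C] at all times. *)
pose x k := iter k (step A) (fun=> 0, fun=> 0).
have gx k : good (x k).
  elim: k => [t _|k IH]; last exact: gstep.
  by split; exact: cst_continuous.
pose C := `|y0| + `|f0|.
have C0 : 0 <= C by rewrite addr_ge0.
have base : close C (x 1%N) (x 0%N).
  have [a1 a2 a3 a4] := dstep _ (gx 0%N).
  have zero (t : R) : 0 <= t -> is_derive t 1 (fun=> 0 : R) 0.
    by move=> _; exact: derC.
  move=> t t0; rewrite -[(x 0%N).1 t]/(0 : R) -[(x 0%N).2 t]/(0 : R) !subr0.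
  have -> : (x 1%N).1 t = y0.
    rewrite -a1; apply/eqP; rewrite -subr_eq0 -normr_le0.
    have := @comparison _ _ _ (fun=> 0) (fun=> 0) a3 zero _ t t0.
    by rewrite subrr; apply => u u0; rewrite /= normr0.
  have -> : (x 1%N).2 t = f0.
    rewrite -a2; apply/eqP; rewrite -subr_eq0 -normr_le0.
    have := @comparison _ _ _ (fun=> 0) (fun=> 0) a4 zero _ t t0.
    by rewrite subrr; apply => u u0; rewrite /= h0 normr0.
  have := e1 t t0; have := normr_ge0 y0; have := normr_ge0 f0.
  by rewrite /C; split; nra.
have diff k : close (C / 2 ^+ k) (x k.+1) (x k).
  elim: k => [|k IH]; first by rewrite expr0 divr1.
  rewrite half_expn (_ : C * _ = C / 2 ^+ k / 2); last by ring.
  exact: (contr _ _ _ (gx k.+1) (gx k) IH).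
have /choice[l hl] : forall t : R, exists l : R * R, 0 <= t -> forall k,
    `|(x k).1 t - l.1| <= 2 * (C * e t / 2 ^+ k) /\
    `|(x k).2 t - l.2| <= 2 * (C * e t / 2 ^+ k).
  move=> t; have [t0|t0] := leP 0 t; last by exists (0, 0).
  have [l1 hl1] := @geometric_limit _ (fun k => (x k).1 t) (C * e t)
    ltac:(by move=> k; have [+ _] := diff k t t0; rewrite mulrAC).
  have [l2 hl2] := @geometric_limit _ (fun k => (x k).2 t) (C * e t)
    ltac:(by move=> k; have [_ +] := diff k t t0; rewrite mulrAC).
  by exists (l1, l2).
pose q := (fun t => (l (pos_time t)).1, fun t => (l (pos_time t)).2).
have gq : good q.
  move=> t t0; split.
  - apply: (@locally_uniform_limit _ (fun k => (x k).1) (fun t => (l t).1) C Lam)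
      => // [k u u0|k u u0]; first by have [] := gx k u u0.
    by have [] := hl u u0 k.
  - apply: (@locally_uniform_limit _ (fun k => (x k).2) (fun t => (l t).2) C Lam)
      => // [k u u0|k u u0]; first by have [] := gx k u u0.
    by have [] := hl u u0 k.
have xq k : close (2 * C / 2 ^+ k) (x k) q.
  move=> t t0; have := hl t t0 k; rewrite /q/= pos_time_id//.
  by rewrite (_ : 2 * (_ / _) = 2 * C / 2 ^+ k * e t)//; ring.
have fix_ (t : R) : 0 <= t -> (step A q).1 t = q.1 t /\ (step A q).2 t = q.2 t.
  move=> t0.
  have h1 k := contr _ _ _ (gx k) gq (xq k) t t0.
  have h2 k := xq k.+1 t t0.
  have small (a b : R) (u : nat -> R) :
     (forall k, `|u k - a| <= 2 * C / 2 ^+ k / 2 * e t) ->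
     (forall k, `|u k - b| <= 2 * C / 2 ^+ k.+1 * e t) -> a = b.
    move=> ua ub; apply/eqP; rewrite -subr_eq0 -normr_le0.
    apply: (@le0_of_geometric _ _ (2 * C * e t)) => k.
    have := ua k; have := ub k; rewrite half_expn.
    rewrite (_ : 2 * C * (2^-1 * 2 ^- k) * e t = 2 * C * e t / 2 ^+ k / 2);
      last by ring.
    rewrite (_ : 2 * C / 2 ^+ k / 2 * e t = 2 * C * e t / 2 ^+ k / 2);
      last by ring.
    move: (2 * C * e t / 2 ^+ k) => K.
    rewrite !ler_norml => /andP[? ?] /andP[? ?].
    by apply/andP; split; lra.
  split; first exact: (small _ _ (fun k => (x k.+1).1 t)
    (fun k => (h1 k).1) (fun k => (h2 k).1)).
  exact: (small _ _ (fun k => (x k.+1).2 t)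
    (fun k => (h1 k).2) (fun k => (h2 k).2)).
have [b1 b2 b3 b4] := dstep _ gq.
(* The limit [q] is frozen for [t < 0] and need not have a two-sided derivative at [0]. Its image
   under the step agrees with it for [t >= 0] and has one. *)
exists (step A q).1, (step A q).2; split => // t t0; have [E1 E2] := fix_ t t0.
  by rewrite E2; exact: b3.
by rewrite E1 E2; exact: b4.
Qed.

End PicardTheorem.

(** * Decay under strong friction *)

Section Decay.
Context {R : realType}.
Variables (mu : R).
Hypothesis mu0 : 0 < mu.
Hypothesis mu8 : mu <= 1 / 8.
Let i := mu^-1.
Let mui : mu * i = 1. Proof. by rewrite /i mulfV// gt_eqF. Qed.
Let i0 : 0 < i. Proof. by rewrite invr_gt0. Qed.
Let i8 : 8 <= i. Proof. by have := mui; have := i0; have := mu8; nra. Qed.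
Variables (y f N : R -> R).
Hypothesis dy : forall t : R, 0 <= t -> is_derive t 1 y (f t).
Hypothesis df : forall t : R, 0 <= t ->
  is_derive t 1 f (- (mu + mu^-1) * f t - y t + N t).
(* [z] spans the fast mode (rate [1 / mu]) and [w] below the slow one (rate [mu]). *)
Let z t := f t + mu * y t.
Let dz (t : R) : 0 <= t -> is_derive t 1 z (- i * z t + N t).
Proof.
move=> t0; have d1 := dy t t0; have d2 := df t t0; rewrite /z; der.
by rewrite -/i; have := mui => E; transitivity (- i * f t - (mu * i) * y t + N t);
  [rewrite E; ring|ring].
Qed.
Let c := mu / (1 - mu ^+ 2).
Let cE : c = mu + mu ^+ 2 * c.
Proof.
rewrite /c; have h : 1 - mu ^+ 2 != 0 by apply: lt0r_neq0; have := mu0; have := mu8; nra.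
by field.
Qed.
Let c0 : 0 <= c.
Proof. by rewrite /c divr_ge0 ?(ltW mu0)//; have := mu0; have := mu8; nra. Qed.
Let mu2 : mu ^+ 2 <= 1 / 64.
Proof. by have := mu0; have := mu8; nra. Qed.
Let c2 : c <= 2 * mu.
Proof.
have := cE; have := mu0; have : mu ^+ 2 * c <= 1 / 64 * c by rewrite ler_wpM2r.
lra.
Qed.
Let w t := y t + c * z t.
Let ciE : c * i = 1 + mu * c.
Proof.
have -> : c * i = (mu * i) * (1 + mu * c); last by rewrite mui mul1r.
by rewrite {1}cE; ring.
Qed.
Let dw (t : R) : 0 <= t -> is_derive t 1 w (- mu * w t + c * N t).
Proof.
move=> t0; have d1 := dy t t0; have d2 := dz t t0; rewrite /w; der.
have -> : f t = z t - mu * y t by rewrite /z; ring.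
transitivity (z t - mu * y t - c * i * z t + c * N t); first by ring.
by rewrite ciE; ring.
Qed.

(** Only [K] has to be small compared with the friction [1 / mu]; nothing is assumed about the size
    of [y] and [f]. Without coupling and perturbation the [y] part would decay at rate [2 mu];
    asking only for [3 / 2 * mu] leaves [mu / 2 * y ^+ 2] to absorb both. *)
Lemma lyapunov_decay (K : R) : 0 <= K -> mu * K <= 1 / 16 ->
  (forall t, 0 <= t -> `|N t| <= K * `|f t|) ->
  forall t, 0 <= t -> y t ^+ 2 + 4 * (f t + mu * y t) ^+ 2 <=
    (y 0 ^+ 2 + 4 * (f 0 + mu * y 0) ^+ 2) * expR (- (3 / 2 * mu * t)).
Proof.
move=> K0 muK hN t t0.
pose E (s : R) := (y s ^+ 2 + 4 * z s ^+ 2) * expR (3 / 2 * mu * s).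
have dE (s : R) : 0 <= s -> is_derive s 1 E
   ((2 * y s * f s + 8 * z s * (- i * z s + N s)
     + 3 / 2 * mu * (y s ^+ 2 + 4 * z s ^+ 2)) * expR (3 / 2 * mu * s)).
  move=> s0; have d1 := dy s s0; have d2 := dz s s0; rewrite /E; der; ring.
have neg (s : R) : 0 <= s -> (2 * y s * f s + 8 * z s * (- i * z s + N s)
     + 3 / 2 * mu * (y s ^+ 2 + 4 * z s ^+ 2)) <= 0.
  move=> s0; have := hN s s0.
  have fE : f s = z s - mu * y s by rewrite /z; ring.
  move: (y s) (z s) (N s) (f s) fE => Y Z n F fE hn.
  have hn2 : `|n| <= K * (`|Z| + mu * `|Y|).
    apply: (le_trans hn); apply: ler_wpM2l => //; rewrite fE.
    by apply: (le_trans (ler_normB _ _)); rewrite normrM (gtr0_norm mu0).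
  have zn : Z * n <= `|Z| * (K * (`|Z| + mu * `|Y|)).
    apply: (le_trans (ler_norm _)); rewrite normrM.
    exact: ler_wpM2l.
  (* The spare [mu / 2 * Y ^+ 2] is split in two. The square [s1] absorbs the coupling [2 * Y * Z],
     and [s2] absorbs the mixed part [8 * K * mu * |Y| * |Z|] of the perturbation. The resulting
     multiples of [Z ^+ 2] are paid by [8 * i * Z ^+ 2]. *)
  have s1 : 0 <= mu / 4 * (Y - 4 * i * Z) ^+ 2 by rewrite mulr_ge0 ?sqr_ge0//; have := mu0; lra.
  have s1E : mu / 4 * (Y - 4 * i * Z) ^+ 2 =
     mu / 4 * Y ^+ 2 - 2 * (mu * i) * (Y * Z) + 4 * (mu * i) * i * Z ^+ 2 by field.
  have s2 : 0 <= mu / 4 * (`|Y| - 16 * K * `|Z|) ^+ 2 by rewrite mulr_ge0 ?sqr_ge0//; have := mu0; lra.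
  have s2E : mu / 4 * (`|Y| - 16 * K * `|Z|) ^+ 2 =
     mu / 4 * Y ^+ 2 - 8 * K * mu * (`|Y| * `|Z|) + 64 * K * (mu * K) * Z ^+ 2.
    rewrite -(real_normK (num_real Y)) -(real_normK (num_real Z)).
    by move: `|Y| `|Z| => a b; field.
  have Ki : K <= i / 16.
    have : mu * i * K <= i / 16 by have := i0; nra.
    by rewrite mui mul1r.
  have s3 : 64 * K * (mu * K) * Z ^+ 2 <= 4 * K * Z ^+ 2.
    by apply: ler_wpM2r; [exact: sqr_ge0|nra].
  have s4 : K * Z ^+ 2 <= i / 16 * Z ^+ 2.
    by apply: ler_wpM2r; [exact: sqr_ge0|].
  have s5 : 6 * mu * Z ^+ 2 <= i / 8 * Z ^+ 2.
    by apply: ler_wpM2r; [exact: sqr_ge0|have := mu8; have := i8; lra].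
  have s6 : 0 <= i * Z ^+ 2 by rewrite mulr_ge0 ?sqr_ge0// ltW.
  have znE : `|Z| * (K * (`|Z| + mu * `|Y|)) = K * Z ^+ 2 + K * mu * (`|Y| * `|Z|).
    by rewrite -(real_normK (num_real Z)); move: `|Y| `|Z| => a b; ring.
  rewrite fE; rewrite mui in s1E; rewrite s1E in s1; rewrite s2E in s2.
  rewrite znE in zn.
  have s7 := sqr_ge0 Z.
  apply: (@le_trans _ _ (- (1 / 2) * mu * Y ^+ 2 + 2 * (Y * Z)
      - 8 * (i * Z ^+ 2) + 8 * (Z * n) + 6 * mu * Z ^+ 2)).
    by rewrite le_eqVlt; apply/orP; left; apply/eqP; field.
  lra.
have := ray_nonincreasing E _ dE _ 0 t (lexx 0) t0.
rewrite {1 2}/E mulr0 expR0 mulr1 => H.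
rewrite expRN ler_pdivlMr ?expR_gt0//; apply: H => s s0.
by apply: mulr_le0_ge0; rewrite ?expR_ge0// neg.
Qed.

(** The slow mode [w] is decoupled from [z]: [w' = - mu * w + c * N] with [c] and [N] nonnegative,
    so [w t * expR (mu * t)] is nondecreasing. For [y] itself the coupling with [z] would spoil the
    sign. *)
Lemma slow_lower_bound : (forall t, 0 <= t -> 0 <= N t) ->
  forall t, 0 <= t -> Num.min 0 (w 0) <= w t.
Proof.
move=> hN t t0.
pose E (s : R) := w s * expR (mu * s).
have dE (s : R) : 0 <= s -> is_derive s 1 E (c * N s * expR (mu * s)).
  by move=> s0; have d1 := dw s s0; rewrite /E; der; ring.
have := ray_nondecreasing E _ dE _ 0 t (lexx 0) t0.
rewrite {1 2}/E mulr0 expR0 mulr1 => H.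
have : w 0 <= w t * expR (mu * t).
  apply: H => s s0; apply: mulr_ge0; last exact: expR_ge0.
  by apply: mulr_ge0; [exact: c0|exact: hN].
have e1 : 1 <= expR (mu * t) by rewrite -expR0 ler_expR mulr_ge0// ltW.
rewrite ge_min; have [//|wt] := leP 0 (w t).
by move=> h; apply/orP; right; nra.
Qed.

(** In the decoupled modes [w] and [z] the free decay is at least [mu], and a perturbation with an
    integrable coefficient changes only the constant. [N] is arbitrary, so the lemma serves both the
    nonlinear oscillator and its linearization. The factor [24 = 3 * 8] pays for passing from
    [(y, f)] to [(w, z)] and back. *)
Lemma exact_decay (e0 g : R) : 0 <= e0 -> 0 < g ->
  (forall t, 0 <= t -> `|N t| <= e0 * expR (- (g * t)) * (`|y t| + `|f t|)) ->
  forall t, 0 <= t -> y t ^+ 2 + f t ^+ 2 <=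
    24 * expR (8 * e0 / g) * (y 0 ^+ 2 + f 0 ^+ 2) * expR (- (2 * mu * t)).
Proof.
move=> e00 g0 hN t t0.
have yf s : `|y s| + `|f s| <= 2 * (`|w s| + `|z s|).
  have yE : y s = w s - c * z s by rewrite /w; ring.
  have fE : f s = z s - mu * y s by rewrite /z; ring.
  have h1 : `|y s| <= `|w s| + c * `|z s|.
    by rewrite yE; apply: (le_trans (ler_normB _ _)); rewrite normrM (ger0_norm c0).
  have h2 : `|f s| <= `|z s| + mu * `|y s|.
    rewrite {1}fE; apply: (le_trans (ler_normB _ _)).
    by rewrite normrM (gtr0_norm mu0).
  have h3 : c * `|z s| <= 1 / 4 * `|z s|.
    by apply: ler_wpM2r => //; have := c2; have := mu8; lra.
  have h4 : mu * `|y s| <= 1 / 8 * `|y s| by apply: ler_wpM2r.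
  by have := normr_ge0 (w s); have := normr_ge0 (z s); lra.
pose e s := w s ^+ 2 + z s ^+ 2.
(* The second exponent has derivative [- 8 * e0 * expR (- (g * s))], which cancels the worst growth
   caused by [N]. It stays between [0] and [8 * e0 / g], so it does not affect the rate. *)
pose E (s : R) := e s * expR (2 * mu * s + 8 * e0 / g * expR (- (g * s))).
have dE (s : R) : 0 <= s -> is_derive s 1 E
   ((2 * w s * (- mu * w s + c * N s) + 2 * z s * (- i * z s + N s)
     + (2 * mu - 8 * e0 * expR (- (g * s))) * e s) *
   expR (2 * mu * s + 8 * e0 / g * expR (- (g * s)))).
  move=> s0; have d1 := dw s s0; have d2 := dz s s0; rewrite /E /e; der.
  by field; rewrite gt_eqF.
have sq (a b : R) : (`|a| + `|b|) ^+ 2 <= 2 * (a ^+ 2 + b ^+ 2).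
  rewrite -(real_normK (num_real a)) -(real_normK (num_real b)).
  by have := sqr_ge0 (`|a| - `|b|); nra.
have neg (s : R) : 0 <= s ->
   (2 * w s * (- mu * w s + c * N s) + 2 * z s * (- i * z s + N s)
     + (2 * mu - 8 * e0 * expR (- (g * s))) * e s) <= 0.
  move=> s0; have hn := hN s s0; have hyf := yf s; have hsq := sq (w s) (z s).
  have := expR_ge0 (- (g * s)); rewrite /e.
  move: (expR _) hn hyf hsq => eps hn hyf hsq eps0.
  set P := `|w s| + `|z s| in hyf hsq.
  have P0 : 0 <= P by rewrite addr_ge0.
  have hn2 : `|N s| <= e0 * eps * (2 * P).
    by apply: (le_trans hn); apply: ler_wpM2l => //; rewrite mulr_ge0.
  have k1 : w s * (c * N s) + z s * N s <= P * `|N s|.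
    rewrite (_ : _ + _ = (c * w s + z s) * N s); last by ring.
    apply: (le_trans (ler_norm _)); rewrite normrM.
    apply: ler_wpM2r => //; apply: (le_trans (ler_normD _ _)).
    rewrite normrM (ger0_norm c0) /P lerD2r.
    by rewrite ler_piMl//; have := c2; have := mu8; lra.
  have k2 : P * `|N s| <= 2 * e0 * eps * P ^+ 2.
    rewrite (_ : 2 * e0 * eps * P ^+ 2 = P * (e0 * eps * (2 * P))); last by ring.
    exact: ler_wpM2l.
  have k3 : 2 * e0 * eps * P ^+ 2 <= 2 * e0 * eps * (2 * (w s ^+ 2 + z s ^+ 2)).
    by apply: ler_wpM2l => //; rewrite !mulr_ge0.
  have k4 : mu * z s ^+ 2 <= i * z s ^+ 2.
    by apply: ler_wpM2r; [exact: sqr_ge0|have := i8; have := mu8; lra].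
  move: k1 k2 k3 k4; move: (P ^+ 2) (P * _) => P2 PN; lra.
have H : E t <= E 0.
  apply: (ray_nonincreasing E _ dE _ 0 t (lexx 0) t0) => s s0.
  by apply: mulr_le0_ge0; rewrite ?expR_ge0// neg.
move: H; rewrite /E mulr0 add0r mulr0 oppr0 expR0 mulr1 expRD => H.
have e1 : 1 <= expR (8 * e0 / g * expR (- (g * t))).
  by rewrite -expR0 ler_expR !mulr_ge0 ?expR_ge0// invr_ge0 ltW.
have eg0 s : 0 <= e s by rewrite addr_ge0 ?sqr_ge0.
have H2 : e t * expR (2 * mu * t) <= e 0 * expR (8 * e0 / g).
  apply: le_trans H; rewrite mulrA ler_peMr//.
  by rewrite mulr_ge0 ?expR_ge0.
have e3 : e 0 <= 3 * (y 0 ^+ 2 + f 0 ^+ 2).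
  rewrite /e /w; set Z := z 0; set Y := y 0; set F := f 0.
  have ZE : Z = F + mu * Y by [].
  have z2 : Z ^+ 2 <= 2 * F ^+ 2 + Y ^+ 2 / 32.
    have h1 : mu ^+ 2 * Y ^+ 2 <= 1 / 64 * Y ^+ 2 by rewrite ler_wpM2r ?sqr_ge0.
    by rewrite ZE; have := sqr_ge0 (F - mu * Y); lra.
  have w2 : (Y + c * Z) ^+ 2 <= 2 * Y ^+ 2 + Z ^+ 2 / 8.
    have h1 : c ^+ 2 <= 1 / 16.
      have c4 : c <= 1 / 4 by have := c2; have := mu8; lra.
      by have := c0; nra.
    have h2 : c ^+ 2 * Z ^+ 2 <= 1 / 16 * Z ^+ 2 by rewrite ler_wpM2r ?sqr_ge0.
    by have := sqr_ge0 (Y - c * Z); lra.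
  by have := sqr_ge0 F; have := sqr_ge0 Y; lra.
have e4 : y t ^+ 2 + f t ^+ 2 <= 8 * e t.
  have h1 : y t ^+ 2 + f t ^+ 2 <= (`|y t| + `|f t|) ^+ 2.
    rewrite -(real_normK (num_real (y t))) -(real_normK (num_real (f t))).
    by have := normr_ge0 (y t); have := normr_ge0 (f t); nra.
  have h2 : (`|y t| + `|f t|) ^+ 2 <= (2 * (`|w t| + `|z t|)) ^+ 2.
    by rewrite ler_sqr ?nnegrE ?mulr_ge0 ?addr_ge0.
  have := sq (w t) (z t); rewrite /e; rewrite exprMn in h2; lra.
rewrite expRN ler_pdivlMr ?expR_gt0//.
have E1 := expR_ge0 (2 * mu * t); have E2 := expR_ge0 (8 * e0 / g).
apply: (@le_trans _ _ (8 * (e t * expR (2 * mu * t)))).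
  by rewrite mulrA ler_wpM2r.
apply: (@le_trans _ _ (8 * (e 0 * expR (8 * e0 / g)))); first by lra.
have : e 0 * expR (8 * e0 / g) <= 3 * (y 0 ^+ 2 + f 0 ^+ 2) * expR (8 * e0 / g).
  by rewrite ler_wpM2r.
lra.
Qed.

End Decay.

(** * The truncated nonlinear oscillator and its a priori bounds *)

Section Clamp.
Context {R : realType}.
Variables (A : R).
Hypothesis A0 : 0 <= A.
Definition clamp (x : R) := Num.max (- A) (Num.min x A).

Lemma clampP x : [\/ clamp x = x /\ `|x| <= A, clamp x = A /\ A <= x |
  clamp x = - A /\ x <= - A].
Proof.
rewrite /clamp; have [xA|Ax] := leP x A; have [h|h] := leP (- A) _.
- by constructor 1; rewrite ler_norml h.
- by constructor 3; split=> //; exact: ltW.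
- by constructor 2; split=> //; exact: ltW.
- by exfalso; move: A0; lra.
Qed.

Lemma clamp_le x : `|clamp x| <= A /\ `|clamp x| <= `|x|.
Proof.
have := A0; case: (clampP x) => -[-> h] a0.
- by [].
- by rewrite ger0_norm//; split=> //; exact: le_trans (ler_norm _).
- rewrite normrN ger0_norm//; split=> //.
  by rewrite -normrN; apply: le_trans (ler_norm _); lra.
Qed.

Lemma clamp_lip x x' : `|clamp x - clamp x'| <= `|x - x'|.
Proof.
have := A0 => a0.
wlog xx : x x' / x' <= x.
  move=> H; have [|/ltW] := leP x' x; first exact: H.
  by rewrite distrC (distrC x); exact: H.
rewrite (ger0_norm (x := x - x')) ?subr_ge0//.
case: (clampP x) => -[-> h1]; case: (clampP x') => -[-> h2];
  move: h1 h2; rewrite ?ler_norml => h1 h2; try (case/andP: h1 => ? ?);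
  try (case/andP: h2 => ? ?); apply/andP; split; lra.
Qed.

Lemma clamp_id x : `|x| <= A -> clamp x = x.
Proof.
have := A0 => a0.
case: (clampP x) => -[-> // h]; rewrite ler_norml => /andP[? ?]; lra.
Qed.

Lemma max_lip (b x x' : R) : `|Num.max x b - Num.max x' b| <= `|x - x'|.
Proof.
wlog xx : x x' / x' <= x.
  move=> H; have [|/ltW] := leP x' x; first exact: H.
  by rewrite distrC (distrC x); exact: H.
rewrite (ger0_norm (x := x - x')) ?subr_ge0//.
have [h1|h1] := leP x b; have [h2|h2] := leP x' b; rewrite ler_norml;
  apply/andP; split; lra.
Qed.

End Clamp.

Section Nonlinear.
Context {R : realType}.
Variables (D kap B c1 mu : R).
Hypothesis D0 : 0 < D.
Hypothesis kap0 : 0 <= kap.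
Hypothesis B0 : 0 < B.
Hypothesis c10 : 0 < c1.
Hypothesis c11 : c1 <= 1.
Hypothesis mu0 : 0 < mu.
Hypothesis mu8 : mu <= 1 / 8.
Hypothesis muK : mu * (kap * (5 * B) / (c1 / 2)) <= 1 / 16.
Hypothesis muB : 9 * D * B * mu <= c1 / 2.

Let b := c1 / 2.
Let b0 : 0 < b. Proof. by rewrite /b divr_gt0. Qed.
Let A := 5 * B.
Let A0 : 0 <= A. Proof. by rewrite /A; have := B0; lra. Qed.

Let psi (y : R) := (Num.max (1 + D * y) b)^-1.
Let psi_ge0 y : 0 <= psi y.
Proof. by rewrite invr_ge0 le_max (ltW b0) orbT. Qed.
Let psi_le y : psi y <= b^-1.
Proof. by rewrite lef_pV2 ?posrE// ?lt_max ?b0 ?orbT// le_max lexx orbT. Qed.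
Let psi_lip y y' : `|psi y - psi y'| <= D / b ^+ 2 * `|y - y'|.
Proof.
have m0 x : Num.max x b != 0 by apply: lt0r_neq0; rewrite lt_max b0 orbT.
have -> : psi y - psi y' = psi y * psi y' *
    (Num.max (1 + D * y') b - Num.max (1 + D * y) b).
  by rewrite /psi; field; rewrite !m0.
rewrite normrM distrC.
have h1 : `|psi y * psi y'| <= b ^- 2.
  rewrite ger0_norm ?mulr_ge0// (_ : b ^- 2 = b^-1 * b^-1); last by rewrite -exprVn.
  by rewrite ler_pM.
have h2 := max_lip b (1 + D * y) (1 + D * y').
rewrite (_ : 1 + D * y - (1 + D * y') = D * (y - y')) in h2; last by ring.
rewrite normrM (gtr0_norm D0) in h2.
rewrite (_ : D / b ^+ 2 * `|y - y'| = b ^- 2 * (D * `|y - y'|)); last by ring.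
by rewrite ler_pM.
Qed.

Let nu := mu + mu^-1.
(* The truncations make [h] globally Lipschitz; the a priori bounds below show that
   they are never active along the solution. *)
Let h (t y f : R) := - nu * f - y + kap * clamp A f ^+ 2 * psi y.

(** The truncated nonlinear term satisfies [0 <= N <= K * |f|] with [K = kap * A / b] for every [y]
    and [f]. Both decay and lower bound therefore hold for the global truncated solution directly,
    and no continuation argument is needed. *)
Lemma nonlinear_solution (y0 f0 : R) :
  `|y0| <= B -> `|f0| <= B -> c1 <= 1 + D * y0 ->
  exists y f : R -> R, [/\ y 0 = y0, f 0 = f0,
    forall t : R, 0 <= t -> is_derive t 1 y (f t),
    forall t : R, 0 <= t -> is_derive t 1 f
      (- (mu + mu^-1) * f t - y t + kap * f t ^+ 2 / (1 + D * y t)) &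
    forall t : R, 0 <= t -> [/\ c1 / 2 <= 1 + D * y t,
      `|y t| <= 5 * B * expR (- (3 / 4 * mu * t)) &
      `|f t| <= 5 * B * expR (- (3 / 4 * mu * t))]].
Proof.
move=> y0B f0B c1y0.
have nu0 : 0 < nu by rewrite addr_gt0 ?invr_gt0.
pose L := nu + 1 + kap * (2 * A / b) + kap * (A ^+ 2 * (D / b ^+ 2)).
have hL t y f y' f' : `|h t y f - h t y' f'| <= L * (`|y - y'| + `|f - f'|).
  have -> : h t y f - h t y' f' = - nu * (f - f') - (y - y')
     + kap * ((clamp A f ^+ 2 - clamp A f' ^+ 2) * psi y)
     + kap * (clamp A f' ^+ 2 * (psi y - psi y')) by rewrite /h; ring.
  have n1 : `|- nu * (f - f')| = nu * `|f - f'| by rewrite normrM normrN (gtr0_norm nu0).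
  have [ca _] := clamp_le A A0 f; have [ca' _] := clamp_le A A0 f'.
  have n2 : `|(clamp A f ^+ 2 - clamp A f' ^+ 2) * psi y| <= 2 * A / b * `|f - f'|.
    rewrite subr_sqr !normrM (ger0_norm (psi_ge0 y)).
    rewrite (_ : 2 * A / b * `|f - f'| = `|f - f'| * (2 * A) * b^-1); last by ring.
    apply: ler_pM; rewrite ?mulr_ge0 ?psi_le//.
    apply: ler_pM => //; first exact: clamp_lip.
    by apply: (le_trans (ler_normD _ _)); lra.
  have n3 : `|clamp A f' ^+ 2 * (psi y - psi y')| <= A ^+ 2 * (D / b ^+ 2) * `|y - y'|.
    rewrite normrM -mulrA; apply: ler_pM => //.
    by rewrite normrX ler_sqr ?nnegrE.
  apply: (le_trans (ler_normD _ _)).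
  have : `|- nu * (f - f') - (y - y') + kap * ((clamp A f ^+ 2 - clamp A f' ^+ 2) * psi y)|
    <= nu * `|f - f'| + `|y - y'| + kap * (2 * A / b * `|f - f'|).
    apply: (le_trans (ler_normD _ _)); apply: lerD.
      by apply: (le_trans (ler_normB _ _)); rewrite n1.
    by rewrite normrM (ger0_norm kap0); apply: ler_wpM2l.
  have : `|kap * (clamp A f' ^+ 2 * (psi y - psi y'))|
     <= kap * (A ^+ 2 * (D / b ^+ 2) * `|y - y'|).
    by rewrite normrM (ger0_norm kap0); apply: ler_wpM2l.
  have p1 : 0 <= kap * (2 * A / b) by rewrite mulr_ge0// divr_ge0 ?mulr_ge0// ltW.
  have p2 : 0 <= kap * (A ^+ 2 * (D / b ^+ 2)).
    by rewrite mulr_ge0// mulr_ge0 ?sqr_ge0// divr_ge0 ?sqr_ge0// ltW.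
  have := normr_ge0 (f - f'); have := normr_ge0 (y - y').
  rewrite /L; move: p1 p2; move: (2 * A / b) (A ^+ 2 * _) => a1 a2 p1 p2.
  move: `|y - y'| `|f - f'| => U V U0 V0.
  have := mulr_ge0 p1 U0; have := mulr_ge0 p2 V0; have := mulr_ge0 (ltW nu0) U0.
  lra.
have h0 t : h t 0 0 = 0.
  by rewrite /h clamp_id ?normr0// expr0n/= !(mulr0, mul0r) subr0 addr0.
have ch u v : continuous (fun t => h t u v) by move=> t; exact: cst_continuous.
have [y [f [yI fI dy df]]] := picard h L ch hL h0 y0 f0.
exists y, f.
pose N t := kap * clamp A (f t) ^+ 2 * psi (y t).
have N0 t : 0 <= N t by rewrite /N mulr_ge0// mulr_ge0// sqr_ge0.
have df' (t : R) : 0 <= t -> is_derive t 1 f (- (mu + mu^-1) * f t - y t + N t).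
  exact: df.
have NK t : 0 <= t -> `|N t| <= kap * A / b * `|f t|.
  move=> _; rewrite ger0_norm// /N.
  have [k1 k2] := clamp_le A A0 (f t).
  have k3 : clamp A (f t) ^+ 2 <= A * `|f t|.
    by rewrite -(real_normK (num_real (clamp A _))) expr2 ler_pM.
  rewrite (_ : kap * A / b * `|f t| = kap * (A * `|f t|) * b^-1); last by ring.
  by apply: ler_pM => //; [rewrite mulr_ge0 ?sqr_ge0|rewrite ler_wpM2l].
have K0 : 0 <= kap * A / b by rewrite divr_ge0 ?mulr_ge0// ltW.
have lyap := lyapunov_decay mu mu0 mu8 y f N dy df' _ K0 muK NK.
have hmu := mu0; have hmu8 := mu8; have hB := B0.
have y0' : y 0 ^+ 2 <= B ^+ 2.
  by rewrite yI -(real_normK (num_real y0)) ler_sqr ?nnegrE// ltW.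
have z0' : `|f 0 + mu * y 0| <= 9 / 8 * B.
  apply: (le_trans (ler_normD _ _)); rewrite normrM (gtr0_norm mu0) fI yI.
  have : mu * `|y0| <= 1 / 8 * B by apply: ler_pM => //; exact: ltW.
  lra.
have z0'' : (f 0 + mu * y 0) ^+ 2 <= (9 / 8 * B) ^+ 2.
  by rewrite -(real_normK (num_real (_ + _))) ler_sqr ?nnegrE//; lra.
have bnd t : 0 <= t -> [/\ `|y t| <= 5 / 2 * B * expR (- (3 / 4 * mu * t)),
    `|f t + mu * y t| <= 5 / 2 * B * expR (- (3 / 4 * mu * t)) &
    `|y t| <= 5 / 2 * B * expR (- (3 / 4 * mu * t)) /\
    `|f t| <= 5 * B * expR (- (3 / 4 * mu * t))].
  move=> t0; have := lyap t t0.
  rewrite (_ : - (3 / 2 * mu * t) = - (3 / 4 * mu * t) + - (3 / 4 * mu * t));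
    last by field.
  rewrite expRD; set E := expR _.
  have E0 : 0 <= E by exact: expR_ge0.
  move=> ly.
  (* Initially the Lyapunov function is at most [(1 + 4 * (9 / 8) ^+ 2) * B ^+ 2 = 97 / 16 * B ^+
     2], which is below [(5 / 2 * B) ^+ 2]. *)
  have ly2 : y t ^+ 2 + 4 * (f t + mu * y t) ^+ 2 <= (5 / 2 * B * E) ^+ 2.
    apply: (le_trans ly).
    rewrite (_ : (5 / 2 * B * E) ^+ 2 = (25 / 4 * B ^+ 2) * (E * E)); last by field.
    by apply: ler_wpM2r; [exact: mulr_ge0|have := sqr_ge0 B; lra].
  have BE0 : 0 <= 5 / 2 * B * E by rewrite mulr_ge0//; lra.
  have s1 := sqr_ge0 (y t); have s2 := sqr_ge0 (f t + mu * y t).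
  have yb : `|y t| <= 5 / 2 * B * E.
    by rewrite -ler_sqr ?nnegrE// real_normK ?num_real//; lra.
  have zb : `|f t + mu * y t| <= 5 / 2 * B * E.
    by rewrite -ler_sqr ?nnegrE// real_normK ?num_real//; lra.
  split=> //; split=> //.
  rewrite (_ : f t = (f t + mu * y t) - mu * y t); last by ring.
  apply: (le_trans (ler_normB _ _)); rewrite normrM (gtr0_norm mu0).
  have : mu * `|y t| <= 1 / 8 * (5 / 2 * B * E) by apply: ler_pM => //; exact: ltW.
  lra.
(* Here [y = w - c * z] with [c] of order [mu]. Replacing [w] by [y] at time [0] and at time [t]
   costs at most [4 * B * mu] in all, so [y] falls below [min 0 y0] by at most that much, and [muB]
   keeps [D] times this loss under [c1 / 2]. *)
have Sb t : 0 <= t -> b <= 1 + D * y t.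
  move=> t0; have := slow_lower_bound mu mu0 mu8 y f N dy df' (fun t _ => N0 t) t t0.
  set c := mu / (1 - mu ^+ 2).
  have m2 : mu ^+ 2 <= 1 / 64 by nra.
  have hc : 0 <= c <= 64 / 63 * mu.
    rewrite /c divr_ge0 ?(ltW mu0)//=; last by lra.
    rewrite ler_pdivrMr; last by lra.
    by rewrite -mulrA; nra.
  case/andP: hc => hc0 hc1.
  have [_ zt _] := bnd t t0.
  have E1 : expR (- (3 / 4 * mu * t)) <= 1.
    by rewrite -expR0 ler_expR oppr_le0 !mulr_ge0// ltW.
  have zt' : `|f t + mu * y t| <= 5 / 2 * B.
    by apply: (le_trans zt); rewrite ler_piMr//; lra.
  have czt : c * `|f t + mu * y t| <= (64 / 63 * mu) * (5 / 2 * B) by apply: ler_pM.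
  have cz0 : c * `|f 0 + mu * y 0| <= (64 / 63 * mu) * (9 / 8 * B) by apply: ler_pM.
  have czt2 : c * (f t + mu * y t) <= c * `|f t + mu * y t|.
    by apply: ler_wpM2l => //; exact: ler_norm.
  have cz02 : - (c * `|f 0 + mu * y 0|) <= c * (f 0 + mu * y 0).
    by rewrite -mulrN; apply: ler_wpM2l => //; rewrite lerNl -normrN ler_norm.
  move=> W; rewrite yI in W cz02 cz0.
  have W2 : Num.min 0 y0 - 4 * B * mu <= y t.
    have := mulr_gt0 mu0 B0; move: W; have [?|?] := leP 0 (y0 + _); have [?|?] := leP 0 y0; lra.
  have W3 : D * (Num.min 0 y0 - 4 * B * mu) <= D * y t by rewrite ler_pM2l.
  have W4 : c1 <= 1 + D * Num.min 0 y0.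
    by have [?|?] := leP 0 y0; rewrite ?mulr0 ?addr0.
  have := mulr_gt0 (mulr_gt0 D0 B0) mu0.
  by rewrite /b; have := muB; lra.
split=> // t t0; last first.
  have [h1 _ [h2 h3]] := bnd t t0; split=> //; first exact: Sb.
  apply: (le_trans h1); have := mulr_ge0 (ltW B0) (expR_ge0 (- (3 / 4 * mu * t))).
  lra.
suff -> : kap * f t ^+ 2 / (1 + D * y t) = N t by exact: df'.
rewrite /N clamp_id//.
  by rewrite /psi max_l// Sb.
have [_ _ [_ h3]] := bnd t t0; apply: (le_trans h3).
have E1 : expR (- (3 / 4 * mu * t)) <= 1.
  by rewrite -expR0 ler_expR oppr_le0 !mulr_ge0// ltW.
by rewrite /A ler_piMr// mulr_ge0// ltW.
Qed.

End Nonlinear.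

(** * Linear second-order equations: existence and stability in the coefficients *)

Section Linear.
Context {R : realType}.
Variables (nu M : R).
Hypothesis nu0 : 0 <= nu.
Hypothesis M0 : 0 <= M.

Lemma linear_solution (p q : R -> R) (u0 v0 : R) :
  (forall t : R, 0 <= t -> {for t, continuous p}) ->
  (forall t : R, 0 <= t -> {for t, continuous q}) ->
  (forall t, 0 <= t -> `|p t| <= M) -> (forall t, 0 <= t -> `|q t| <= M) ->
  exists u v : R -> R, [/\ u 0 = u0, v 0 = v0,
  forall t : R, 0 <= t -> is_derive t 1 u (v t) &
  forall t : R, 0 <= t -> is_derive t 1 v
    (- nu * v t - u t + (p t * v t + q t * u t))].
Proof.
move=> cp cq pM qM.
pose h t (u v : R) := - nu * v - u + (p (pos_time t) * v + q (pos_time t) * u).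
have ch a b : continuous (fun t => h t a b).
  move=> t; apply: (@continuousD _ _ _ (fun=> - nu * b - a)
    (fun t => p (pos_time t) * b + q (pos_time t) * a)); first exact: cst_continuous.
  apply: (@continuousD _ _ _ (fun t => p (pos_time t) * b) (fun t => q (pos_time t) * a)).
    by apply: (@continuousM _ _ (fun t => p (pos_time t)) (fun=> b));
      [exact: continuous_pos_time|exact: cst_continuous].
  by apply: (@continuousM _ _ (fun t => q (pos_time t)) (fun=> a));
    [exact: continuous_pos_time|exact: cst_continuous].
have hL t a b a' b' : `|h t a b - h t a' b'| <=
    (nu + 1 + M) * (`|a - a'| + `|b - b'|).
  have -> : h t a b - h t a' b' = - nu * (b - b') - (a - a')
    + (p (pos_time t) * (b - b') + q (pos_time t) * (a - a')) by rewrite /h; ring.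
  have := pM _ (pos_time_ge0 t); have := qM _ (pos_time_ge0 t).
  move: (p _) (q _) (a - a') (b - b') => P Q X Y QM PM.
  apply: (le_trans (ler_normD _ _)).
  have h1 : `|- nu * Y - X| <= nu * `|Y| + `|X|.
    by apply: (le_trans (ler_normB _ _)); rewrite normrM normrN (ger0_norm nu0).
  have h2 : `|P * Y + Q * X| <= M * `|Y| + M * `|X|.
    by apply: (le_trans (ler_normD _ _)); rewrite !normrM lerD// ler_wpM2r.
  by have := mulr_ge0 nu0 (normr_ge0 X); have := normr_ge0 Y; lra.
have h0 t : h t 0 0 = 0 by rewrite /h !mulr0 subr0 !addr0.
have [u [v [u0' v0' du dv]]] := picard h _ ch hL h0 u0 v0.
exists u, v; split => // t t0; have := dv t t0.
by rewrite /h pos_time_id.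
Qed.

(** In the derivative of [u ^+ 2 + v ^+ 2] the terms [2 * u * v] from the oscillator cancel and the
    friction term is nonpositive. Hence the growth rate depends on [M] but not on [nu]. *)
Lemma linear_gronwall (p q g u v : R -> R) (e T : R) : 0 <= e ->
  (forall t : R, 0 <= t -> is_derive t 1 u (v t)) ->
  (forall t : R, 0 <= t -> is_derive t 1 v
    (- nu * v t - u t + (p t * v t + q t * u t) + g t)) ->
  (forall t, 0 <= t -> `|p t| <= M) -> (forall t, 0 <= t -> `|q t| <= M) ->
  (forall t, 0 <= t -> t <= T -> g t ^+ 2 <= e) ->
  forall t, 0 <= t -> t <= T ->
  u t ^+ 2 + v t ^+ 2 <=
    (u 0 ^+ 2 + v 0 ^+ 2 + e * T) * expR ((3 * M + 1) * T).
Proof.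
move=> e0 du dv pM qM ge t t0 tT.
have T0 : 0 <= T by exact: le_trans tT.
pose E s := u s ^+ 2 + v s ^+ 2.
have dE (s : R) : 0 <= s -> is_derive s 1 E (2 * (u s * v s) +
  2 * v s * (- nu * v s - u s + (p s * v s + q s * u s) + g s)).
  by move=> s0; have d1 := du s s0; have d2 := dv s s0; rewrite /E; der; ring.
have C0 : 0 <= 3 * M + 1 by have := M0; lra.
have := gronwall E _ (3 * M + 1) e T C0 e0 dE _ t t0 tT.
rewrite -/(E t) -/(E 0) => H.
have E0 : 0 <= E 0 by rewrite /E addr_ge0 ?sqr_ge0.
apply: le_trans (H _) _; last first.
  apply: ler_pM; rewrite ?expR_ge0//.
  - by rewrite addr_ge0// mulr_ge0.
  - by rewrite lerD2l; apply: ler_wpM2l.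
  - by rewrite ler_expR; apply: ler_wpM2l.
move=> s s0 sT; have := ge s s0 sT; have := pM s s0; have := qM s s0.
rewrite /E; move: (u s) (v s) (p s) (q s) (g s) => U V P Q G QM PM GE.
have h1 : P * V ^+ 2 <= M * V ^+ 2.
  by rewrite ler_wpM2r ?sqr_ge0//; apply: le_trans (ler_norm _) _.
have h2 : 2 * (Q * (U * V)) <= M * (U ^+ 2 + V ^+ 2).
  have k1 : Q * (U * V) <= `|Q| * (`|U| * `|V|).
    by apply: (le_trans (ler_norm _)); rewrite !normrM.
  have k2 : `|Q| * (`|U| * `|V|) <= M * (`|U| * `|V|) by rewrite ler_wpM2r ?mulr_ge0.
  have k3 : 2 * (`|U| * `|V|) <= U ^+ 2 + V ^+ 2.
    rewrite -(real_normK (num_real U)) -(real_normK (num_real V)).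
    by have := sqr_ge0 (`|U| - `|V|); lra.
  have k4 : M * (2 * (`|U| * `|V|)) <= M * (U ^+ 2 + V ^+ 2) by rewrite ler_wpM2l.
  lra.
have h3 : 2 * (G * V) <= G ^+ 2 + V ^+ 2 by have := sqr_ge0 (G - V); lra.
have h4 : 0 <= nu * V ^+ 2 by rewrite mulr_ge0 ?sqr_ge0.
have h5 := sqr_ge0 U; have h6 := mulr_ge0 M0 h5.
lra.
Qed.

(** The difference of the solutions solves the first equation with the forcing
    [(p - p') * v' + (q - q') * u'], whose square is at most [4 * V ^+ 2 * e]. Only the second
    solution has to be bounded, which matters when the first one is a difference quotient. *)
Lemma linear_compare (p q p' q' u v u' v' : R -> R) (e V T : R) :
  0 <= e -> 0 <= V ->
  (forall t : R, 0 <= t -> is_derive t 1 u (v t)) ->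
  (forall t : R, 0 <= t -> is_derive t 1 v
    (- nu * v t - u t + (p t * v t + q t * u t))) ->
  (forall t : R, 0 <= t -> is_derive t 1 u' (v' t)) ->
  (forall t : R, 0 <= t -> is_derive t 1 v'
    (- nu * v' t - u' t + (p' t * v' t + q' t * u' t))) ->
  (forall t, 0 <= t -> `|p t| <= M) -> (forall t, 0 <= t -> `|q t| <= M) ->
  (forall t, 0 <= t -> `|u' t| <= V /\ `|v' t| <= V) ->
  (forall t, 0 <= t -> t <= T ->
     (p t - p' t) ^+ 2 <= e /\ (q t - q' t) ^+ 2 <= e) ->
  forall t, 0 <= t -> t <= T ->
  (u t - u' t) ^+ 2 + (v t - v' t) ^+ 2 <=
    ((u 0 - u' 0) ^+ 2 + (v 0 - v' 0) ^+ 2 + 4 * V ^+ 2 * e * T)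
     * expR ((3 * M + 1) * T).
Proof.
move=> e0 V0 du dv du' dv' pM qM uV pq t t0 tT.
apply: (linear_gronwall p q
  (fun s => (p s - p' s) * v' s + (q s - q' s) * u' s)
  (fun s => u s - u' s) (fun s => v s - v' s)) => //.
- by rewrite mulr_ge0// mulr_ge0// sqr_ge0.
- by move=> s s0; have d1 := du s s0; have d2 := du' s s0; der.
- by move=> s s0; have d1 := dv s s0; have d2 := dv' s s0; der; ring.
move=> s s0 sT; have [] := uV s s0; have [] := pq s s0 sT.
move: (p s - p' s) (q s - q' s) (u' s) (v' s) => X Y U W Xe Ye UV WV.
have U2 : U ^+ 2 <= V ^+ 2 by rewrite -(real_normK (num_real U)) ler_sqr ?nnegrE.
have W2 : W ^+ 2 <= V ^+ 2 by rewrite -(real_normK (num_real W)) ler_sqr ?nnegrE.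
have h1 : (X * W) ^+ 2 <= V ^+ 2 * e.
  by rewrite exprMn mulrC; apply: ler_pM; rewrite ?sqr_ge0.
have h2 : (Y * U) ^+ 2 <= V ^+ 2 * e.
  by rewrite exprMn mulrC; apply: ler_pM; rewrite ?sqr_ge0.
by have := sqr_ge0 (X * W - Y * U); lra.
Qed.

End Linear.

Lemma joint_continuity {R : realType} (g : R -> R -> R) :
  (forall a (t : R), 0 <= t -> {for t, continuous (g a)}) ->
  (forall (a T e : R), 0 < e -> \forall a' \near a, forall t, 0 <= t -> t <= T ->
     `|g a t - g a' t| <= e) ->
  continuous (fun p : R * R => g p.2 (pos_time p.1)).
Proof.
move=> cg ug [t a]; apply: near_continuous => e e0 /=.
have e2 : 0 < e / 2 by lra.
have ct := continuous_pos_time _ (cg a) t.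
have h1 : \forall p \near (t, a), `|g a (pos_time t) - g a (pos_time p.1)| <= e / 2.
  have h : \forall s \near t, `|g a (pos_time t) - g a (pos_time s)| <= e / 2.
    exact: (continuous_near _ _ ct).
  by near=> p; near: p; exact: (@cvg_fst _ _ (nbhs t) (nbhs a) _ _ h).
have h2 : \forall p \near (t, a), forall u, 0 <= u -> u <= pos_time t + 1 ->
    `|g a u - g p.2 u| <= e / 2.
  have h := ug a (pos_time t + 1) (e / 2) e2.
  by near=> p; near: p; exact: (@cvg_snd _ _ (nbhs t) (nbhs a) _ _ h).
have h3 : \forall p \near (t, a), pos_time p.1 <= pos_time t + 1.
  have h : \forall s \near t, pos_time s <= pos_time t + 1.
    near=> s; apply: pos_time_leD; rewrite distrC.
    by near: s; exact: nbhsx_ballx.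
  by near=> p; near: p; exact: (@cvg_fst _ _ (nbhs t) (nbhs a) _ _ h).
near=> p.
have k1 : `|g a (pos_time t) - g a (pos_time p.1)| <= e / 2 by near: p.
have k3 : pos_time p.1 <= pos_time t + 1 by near: p.
have k2 : `|g a (pos_time p.1) - g p.2 (pos_time p.1)| <= e / 2.
  have h : forall u, 0 <= u -> u <= pos_time t + 1 -> `|g a u - g p.2 u| <= e / 2 by near: p.
  by apply: h => //; exact: pos_time_ge0.
apply: (le_trans (ler_distD (g a (pos_time p.1)) _ _)); lra.
Unshelve. all: by end_near. Qed.

Lemma is_derive_quotient {R : realType} (g : R -> R) (a l : R) :
  is_derive a 1 g l <-> h^-1 * (g (a + h) - g a) @[h --> 0^'] --> l.
Proof.
have E : (fun h : R => h^-1 *: (g (h *: 1 + a) - g a)) =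
         (fun h : R => h^-1 * (g (a + h) - g a)).
  by apply/funext => h; rewrite (_ : h *: 1 = h) ?[h + a]addrC//; exact: mulr1.
split=> [[dg <-]|H].
  by rewrite -E; exact: dg.
have dg : derivable g a 1 by rewrite /derivable E; apply/cvg_ex; exists l.
by apply: DeriveDef => //; rewrite /derive E; exact: cvg_lim.
Qed.

Section Coefficients.
Context {R : realType}.
Variables (D kap A b : R).
Hypothesis D0 : 0 < D.
Hypothesis kap0 : 0 <= kap.
Hypothesis A0 : 0 <= A.
Hypothesis b0 : 0 < b.
Let B := b^-1.
Let B0 : 0 <= B. Proof. by rewrite invr_ge0 ltW. Qed.

(* The coefficients bounded here are the divided differences of
   [kap * f ^+ 2 / (1 + D * y)]; on the diagonal they are its partial derivatives,
   i.e. the coefficients of the linearized equation. *)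
Definition coef_bound := kap * (2 * A * B) + kap * D * (A * B) ^+ 2.
Definition coef_lip := kap * (2 * B + 2 * A * (D * B ^+ 2)) +
  kap * D * (A ^+ 2 * B * (D * B ^+ 2) + 2 * A * B * (B + A * (D * B ^+ 2))).

Variables (y1 f1 y2 f2 : R).
Hypothesis S1 : b <= 1 + D * y1.
Hypothesis S2 : b <= 1 + D * y2.
Hypothesis F1 : `|f1| <= A.
Hypothesis F2 : `|f2| <= A.

Let i1 := (1 + D * y1)^-1.
Let i2 := (1 + D * y2)^-1.
Let i10 : 0 <= i1 <= B.
Proof.
by rewrite invr_ge0 (le_trans (ltW b0) S1)/= lef_pV2 ?posrE// (lt_le_trans b0 S1).
Qed.
Let i20 : 0 <= i2 <= B.
Proof.
by rewrite invr_ge0 (le_trans (ltW b0) S2)/= lef_pV2 ?posrE// (lt_le_trans b0 S2).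
Qed.
Let n1 : 1 + D * y1 != 0. Proof. by rewrite gt_eqF// (lt_le_trans b0 S1). Qed.
Let n2 : 1 + D * y2 != 0. Proof. by rewrite gt_eqF// (lt_le_trans b0 S2). Qed.
Let i12 : i2 - i1 = - (D * (y2 - y1) * (i1 * i2)).
Proof. by rewrite /i1 /i2; field; rewrite n1 n2. Qed.
Let i12le : `|i2 - i1| <= D * B ^+ 2 * `|y2 - y1|.
Proof.
have /andP[a1 a2] := i10; have /andP[a3 a4] := i20.
rewrite i12 normrN !normrM (gtr0_norm D0) (ger0_norm a1) (ger0_norm a3).
rewrite mulrAC.
by rewrite ler_wpM2r// ler_wpM2l ?(ltW D0)// expr2; apply: ler_pM.
Qed.

(** This exact identity, with no remainder, makes the difference of two solutions of the nonlinear
    equation a solution of a linear one. *)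
Lemma quadratic_difference : kap * f2 ^+ 2 / (1 + D * y2) - kap * f1 ^+ 2 / (1 + D * y1) =
  kap * ((f1 + f2) / (1 + D * y2)) * (f2 - f1)
  - kap * D * (f1 ^+ 2 / ((1 + D * y1) * (1 + D * y2))) * (y2 - y1).
Proof. by field; rewrite n1 n2. Qed.

Lemma coef_le : `|kap * ((f1 + f2) / (1 + D * y2))| <= coef_bound /\
  `|- (kap * D * (f1 ^+ 2 / ((1 + D * y1) * (1 + D * y2))))| <= coef_bound.
Proof.
have /andP[a1 a2] := i10; have /andP[a3 a4] := i20.
have k1 : 0 <= kap * (2 * A * B) by rewrite !mulr_ge0.
have k2 : 0 <= kap * D * (A * B) ^+ 2 by rewrite !mulr_ge0 ?sqr_ge0// ltW.
rewrite normrN !normrM !(ger0_norm kap0) (gtr0_norm D0) invfM -/i1 -/i2 !normrM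
  (ger0_norm a1) (ger0_norm a3); split.
- rewrite /coef_bound; apply: (@le_trans _ _ (kap * (2 * A * B))); last by lra.
  apply: ler_wpM2l => //; apply: ler_pM => //.
  by apply: (le_trans (ler_normD _ _)); have := F1; have := F2; lra.
- rewrite /coef_bound; apply: (@le_trans _ _ (kap * D * (A * B) ^+ 2)); last by lra.
  apply: ler_wpM2l => //; first by rewrite mulr_ge0// ltW.
  rewrite exprMn; apply: ler_pM; rewrite ?mulr_ge0//.
    by rewrite expr2 ler_pM.
  by rewrite expr2; apply: ler_pM.
Qed.

Let dl : R := `|y2 - y1| + `|f2 - f1|.

Lemma coef_lip_ge0 : 0 <= coef_lip.
Proof.
have hD := ltW D0; rewrite /coef_lip.
have h0 : 0 <= D * B ^+ 2 by rewrite mulr_ge0// sqr_ge0.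
apply: addr_ge0; first by rewrite mulr_ge0// addr_ge0// !mulr_ge0.
rewrite mulr_ge0 ?mulr_ge0// addr_ge0// mulr_ge0 ?mulr_ge0 ?sqr_ge0// addr_ge0//.
by rewrite mulr_ge0.
Qed.

Let weak (x c1 c2 : R) : 0 <= c1 -> 0 <= c2 -> c1 <= coef_lip -> c2 <= coef_lip ->
  `|x| <= c1 * `|f2 - f1| + c2 * `|y2 - y1| -> `|x| <= coef_lip * dl.
Proof.
move=> c10 c20 h1 h2 /le_trans; apply; rewrite /dl mulrDr addrC.
by apply: lerD; apply: ler_wpM2r.
Qed.

(** The first two estimates compare divided differences with the linearized coefficients at the
    first point and serve to differentiate in the label. The last two compare linearized
    coefficients at two points and give continuity of the label derivatives. *)
Lemma coef_lipschitz :
 [/\ `|kap * ((f1 + f2) / (1 + D * y2)) - kap * ((f1 + f1) / (1 + D * y1))|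
       <= coef_lip * dl,
     `|- (kap * D * (f1 ^+ 2 / ((1 + D * y1) * (1 + D * y2)))) -
       - (kap * D * (f1 ^+ 2 / ((1 + D * y1) * (1 + D * y1))))| <= coef_lip * dl,
     `|kap * ((f2 + f2) / (1 + D * y2)) - kap * ((f1 + f1) / (1 + D * y1))|
       <= coef_lip * dl &
     `|- (kap * D * (f2 ^+ 2 / ((1 + D * y2) * (1 + D * y2)))) -
       - (kap * D * (f1 ^+ 2 / ((1 + D * y1) * (1 + D * y1))))| <= coef_lip * dl].
Proof.
have /andP[a1 a2] := i10; have /andP[a3 a4] := i20.
have hD := ltW D0.
rewrite !invfM -/i1 -/i2.
set G := D * B ^+ 2; have G0 : 0 <= G by rewrite mulr_ge0// sqr_ge0.
have il : `|i2 - i1| <= G * `|y2 - y1| by exact: i12le.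
have x1 : 0 <= kap * B by rewrite mulr_ge0.
have x2 : 0 <= kap * (A * G) by rewrite !mulr_ge0.
have x3 : 0 <= kap * D * (A ^+ 2 * B * G) by rewrite !mulr_ge0 ?sqr_ge0.
have x4 : 0 <= kap * D * (A * B * B) by rewrite !mulr_ge0.
have x5 : 0 <= kap * D * (A * B * (A * G)) by rewrite !mulr_ge0.
have cE : coef_lip = 2 * (kap * B) + 2 * (kap * (A * G)) +
  kap * D * (A ^+ 2 * B * G) + 2 * (kap * D * (A * B * B))
  + 2 * (kap * D * (A * B * (A * G))).
  by rewrite /coef_lip -/G; ring.
clearbody G.
have fi2 (x : R) : `|x * i2| <= B * `|x|.
  by rewrite normrM (ger0_norm a3) mulrC ler_wpM2r.
have fd (x : R) : `|x| <= A -> `|x * (i2 - i1)| <= A * G * `|y2 - y1|.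
  by move=> xA; rewrite normrM -mulrA ler_pM.
have fdiff : `|(f2 - f1) * i2 + f1 * (i2 - i1)| <= B * `|f2 - f1| + A * G * `|y2 - y1|.
  by apply: (le_trans (ler_normD _ _)); rewrite lerD// fd.
have f1i1 : `|f1 * i1| <= A * B by rewrite normrM (ger0_norm a1) ler_pM.
have f2i2 : `|f2 * i2| <= A * B by rewrite normrM (ger0_norm a3) ler_pM.
have mk (x C : R) : 0 <= C -> `|C * x| = C * `|x| by move=> C0; rewrite normrM ger0_norm.
split.
- rewrite (_ : _ - _ = kap * ((f2 - f1) * i2 + 2 * (f1 * (i2 - i1)))); last by ring.
  apply: (weak _ (kap * B) (kap * (2 * (A * G)))); rewrite ?cE; try lra.
  rewrite mk// -!mulrA -mulrDr ler_wpM2l//.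
  apply: (le_trans (ler_normD _ _)); rewrite lerD// mk// ler_pM2l//.
  by apply: (le_trans (fd _ F1)); rewrite -mulrA.
- rewrite (_ : - _ - _ = - (kap * D * (f1 * (f1 * i1) * (i2 - i1)))); last by ring.
  rewrite normrN.
  apply: (weak _ 0 (kap * D * (A ^+ 2 * B * G))); rewrite ?cE; try lra.
  rewrite mul0r add0r mk ?mulr_ge0// -(mulrA (kap * D)) ler_wpM2l ?mulr_ge0//.
  rewrite normrM -mulrA; apply: ler_pM => //.
  by rewrite normrM expr2 -mulrA ler_pM.
- rewrite (_ : _ - _ = kap * 2 * ((f2 - f1) * i2 + f1 * (i2 - i1))); last by ring.
  apply: (weak _ (kap * 2 * B) (kap * 2 * (A * G))); rewrite ?cE; try lra.
  by rewrite mk ?mulr_ge0// -!(mulrA (kap * 2)) -mulrDr ler_wpM2l ?mulr_ge0.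
- rewrite (_ : - _ - _ = - (kap * D * ((f2 * i2 + f1 * i1) *
    ((f2 - f1) * i2 + f1 * (i2 - i1))))); last by ring.
  rewrite normrN.
  apply: (weak _ (kap * D * (2 * (A * B) * B)) (kap * D * (2 * (A * B) * (A * G))));
    rewrite ?cE; try lra.
  rewrite mk ?mulr_ge0// -!(mulrA (kap * D)) -mulrDr ler_wpM2l ?mulr_ge0//.
  rewrite -!(mulrA (2 * (A * B))) -mulrDr normrM ler_pM//.
  by apply: (le_trans (ler_normD _ _)); lra.
Qed.

End Coefficients.

(** * Dependence on the label *)

Section Flow.
Context {R : realType}.
Variables (D kap nu A b V : R) (y f eta zeta : R -> R -> R).
Hypothesis D0 : 0 < D.
Hypothesis kap0 : 0 <= kap.
Hypothesis nu0 : 0 <= nu.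
Hypothesis A0 : 0 <= A.
Hypothesis b0 : 0 < b.
Hypothesis V0 : 0 <= V.
Hypothesis dy : forall a (t : R), 0 <= t -> is_derive t 1 (y a) (f a t).
Hypothesis df : forall a (t : R), 0 <= t -> is_derive t 1 (f a)
  (- nu * f a t - y a t + kap * f a t ^+ 2 / (1 + D * y a t)).
Let p a t := kap * ((f a t + f a t) / (1 + D * y a t)).
Let q a t := - (kap * D * (f a t ^+ 2 / ((1 + D * y a t) * (1 + D * y a t)))).
Hypothesis deta : forall a (t : R), 0 <= t -> is_derive t 1 (eta a) (zeta a t).
Hypothesis dzeta : forall a (t : R), 0 <= t -> is_derive t 1 (zeta a)
  (- nu * zeta a t - eta a t + (p a t * zeta a t + q a t * eta a t)).
Hypothesis Sb : forall a t, 0 <= t -> b <= 1 + D * y a t.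
Hypothesis fA : forall a t, 0 <= t -> `|f a t| <= A.
Hypothesis eV : forall a t, 0 <= t -> `|eta a t| <= V /\ `|zeta a t| <= V.

Let M := coef_bound D kap A b.
Let M0 : 0 <= M.
Proof. exact: le_trans (coef_le D kap A b D0 kap0 A0 b0 _ _ _ _
  (Sb 0 0 (lexx 0)) (Sb 0 0 (lexx 0)) (fA 0 0 (lexx 0)) (fA 0 0 (lexx 0))).1. Qed.
Let coef_close a a' s (s0 : 0 <= s) := coef_le D kap A b D0 kap0 A0 b0 _ _ _ _
  (Sb a s s0) (Sb a' s s0) (fA a s s0) (fA a' s s0).
Let K1 := coef_lip D kap A b.
Let coef_lip_close a a' s (s0 : 0 <= s) := coef_lipschitz D kap A b D0 kap0 A0 b0 _ _ _ _
  (Sb a s s0) (Sb a' s s0) (fA a s s0) (fA a' s s0).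
Let G T := expR ((3 * M + 1) * T).
Let D2 (g h : R -> R -> R) a a' t := (g a' t - g a t) ^+ 2 + (h a' t - h a t) ^+ 2.

Lemma flow_close a a' T t : 0 <= t -> t <= T ->
  D2 y f a a' t <= D2 y f a a' 0 * G T.
Proof.
move=> t0 tT.
have := @linear_gronwall R nu M nu0 M0
  (fun s => kap * ((f a s + f a' s) / (1 + D * y a' s)))
  (fun s => - (kap * D * (f a s ^+ 2 / ((1 + D * y a s) * (1 + D * y a' s)))))
  (fun=> 0) (fun s => y a' s - y a s) (fun s => f a' s - f a s) 0 T (lexx 0)
  _ _ _ _ _ t t0 tT.
rewrite mul0r addr0; apply.
- by move=> s s0; have d1 := dy a' s s0; have d2 := dy a s s0; der.
- move=> s s0; have d1 := df a' s s0; have d2 := df a s s0; der.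
  have := quadratic_difference D kap b b0 (y a s) (f a s) (y a' s) (f a' s) (Sb a s s0) (Sb a' s s0).
  move=> E; transitivity (- nu * (f a' s - f a s) - (y a' s - y a s)
    + (kap * f a' s ^+ 2 / (1 + D * y a' s)
      - kap * f a s ^+ 2 / (1 + D * y a s))); first by ring.
  by rewrite E; ring.
- by move=> s s0; exact: (coef_close a a' s s0).1.
- by move=> s s0; exact: (coef_close a a' s s0).2.
- by move=> s _ _; rewrite expr0n.
Qed.

Let sq_le (x K c1 c2 d : R) : 0 <= K -> `|x| <= K * (`|c1| + `|c2|) ->
  c1 ^+ 2 + c2 ^+ 2 <= d -> x ^+ 2 <= 2 * K ^+ 2 * d.
Proof.
move=> K0 xK cd.
have h : x ^+ 2 <= (K * (`|c1| + `|c2|)) ^+ 2.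
  by rewrite -(real_normK (num_real x)) ler_sqr ?nnegrE// mulr_ge0// addr_ge0.
apply: (le_trans h); rewrite exprMn (_ : 2 * K ^+ 2 * d = K ^+ 2 * (2 * d)); last by ring.
apply: ler_wpM2l; first exact: sqr_ge0.
have : (`|c1| + `|c2|) ^+ 2 <= 2 * (c1 ^+ 2 + c2 ^+ 2).
  rewrite -(real_normK (num_real c1)) -(real_normK (num_real c2)).
  by have := sqr_ge0 (`|c1| - `|c2|); lra.
lra.
Qed.

Let K10 : 0 <= K1. Proof. exact: coef_lip_ge0. Qed.
Let e a a' T := 2 * K1 ^+ 2 * (D2 y f a a' 0 * G T).
Let D20 g h a a' t : 0 <= D2 g h a a' t.
Proof. by rewrite /D2 addr_ge0 ?sqr_ge0. Qed.
Let e0 a a' T : 0 <= e a a' T.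
Proof. by rewrite /e mulr_ge0 ?mulr_ge0 ?sqr_ge0 ?expR_ge0. Qed.

Lemma variation_close a a' T t : 0 <= t -> t <= T ->
  D2 eta zeta a a' t <= (D2 eta zeta a a' 0 + 4 * V ^+ 2 * e a a' T * T) * G T.
Proof.
move=> t0 tT.
apply: (linear_compare nu M nu0 M0 (p a') (q a') (p a) (q a)) => //.
- by move=> s s0; exact: (coef_close a' a' s s0).1.
- by move=> s s0; exact: (coef_close a' a' s s0).2.
- exact: eV.
- move=> s s0 sT.
  have [_ _ c1 c2] := coef_lip_close a a' s s0.
  by split; [apply: (sq_le _ _ _ _ _ K10 c1)|apply: (sq_le _ _ _ _ _ K10 c2)];
    exact: flow_close.
Qed.

(** The difference quotient solves a linear equation whose coefficients approach those of the
    equation for [lam * eta]. The right-hand side contains the initial error and the error [e] of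
    the coefficients; both vanish as [h] tends to [0]. *)
Lemma quotient_close a h lam T t : h != 0 -> 0 <= t -> t <= T ->
  (h^-1 * (y (a + h) t - y a t) - lam * eta a t) ^+ 2
  + (h^-1 * (f (a + h) t - f a t) - lam * zeta a t) ^+ 2 <=
  ((h^-1 * (y (a + h) 0 - y a 0) - lam * eta a 0) ^+ 2
  + (h^-1 * (f (a + h) 0 - f a 0) - lam * zeta a 0) ^+ 2
  + 4 * (`|lam| * V) ^+ 2 * e a (a + h) T * T) * G T.
Proof.
move=> hn t0 tT; set a' := a + h.
apply: (linear_compare nu M nu0 M0
  (fun s => kap * ((f a s + f a' s) / (1 + D * y a' s)))
  (fun s => - (kap * D * (f a s ^+ 2 / ((1 + D * y a s) * (1 + D * y a' s)))))
  (p a) (q a)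
  (fun s => h^-1 * (y a' s - y a s)) (fun s => h^-1 * (f a' s - f a s))
  (fun s => lam * eta a s) (fun s => lam * zeta a s)) => //.
- by rewrite mulr_ge0.
- by move=> s s0; have d1 := dy a' s s0; have d2 := dy a s s0; der; ring.
- move=> s s0; have d1 := df a' s s0; have d2 := df a s s0; der.
  have := quadratic_difference D kap b b0 (y a s) (f a s) (y a' s) (f a' s) (Sb a s s0) (Sb a' s s0).
  move=> E; transitivity (- nu * (h^-1 * (f a' s - f a s)) - h^-1 * (y a' s - y a s)
    + h^-1 * (kap * f a' s ^+ 2 / (1 + D * y a' s)
      - kap * f a s ^+ 2 / (1 + D * y a s))); first by ring.
  by rewrite E; ring.
- by move=> s s0; have d1 := deta a s s0; der; ring.
- by move=> s s0; have d1 := dzeta a s s0; der; ring.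
- by move=> s s0; exact: (coef_close a a' s s0).1.
- by move=> s s0; exact: (coef_close a a' s s0).2.
- by move=> s /(eV a)[h1 h2]; rewrite !normrM; split; apply: ler_wpM2l.
- move=> s s0 sT.
  have [c1 c2 _ _] := coef_lip_close a a' s s0.
  by split; [apply: (sq_le _ _ _ _ _ K10 c1)|apply: (sq_le _ _ _ _ _ K10 c2)];
    exact: flow_close.
Qed.

Section Continuity.
Hypothesis cy : continuous (fun a => y a 0).
Hypothesis cf : continuous (fun a => f a 0).
Hypothesis ce : continuous (fun a => eta a 0).
Hypothesis cz : continuous (fun a => zeta a 0).

Let D2_cvg (g h : R -> R -> R) a : continuous (fun a => g a 0) ->
  continuous (fun a => h a 0) -> D2 g h a a' 0 @[a' --> a] --> 0.
Proof.
move=> cg ch.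
have s0 (u : R -> R -> R) : continuous (fun a => u a 0) ->
   (u a' 0 - u a 0) ^+ 2 @[a' --> a] --> 0.
  move=> cu; have h1 : (u a' 0 - u a 0) @[a' --> a] --> 0.
    by rewrite -[X in _ --> X](subrr (u a 0)); apply: cvgB; [exact: cu|exact: cvg_cst].
  by rewrite -[X in _ --> X](mulr0 0); under eq_fun do rewrite expr2; exact: cvgM.
by rewrite -[X in _ --> X](addr0 0); apply: cvgD; exact: s0.
Qed.

Let e_cvg a T : e a a' T @[a' --> a] --> 0.
Proof.
rewrite -[X in _ --> X](mulr0 (2 * K1 ^+ 2)); apply: cvgM; first exact: cvg_cst.
rewrite -[X in _ --> X](mul0r (G T)); apply: cvgM; last exact: cvg_cst.
exact: D2_cvg.
Qed.

Let near_le (F : R -> R) (a eps : R) : 0 < eps -> F a' @[a' --> a] --> (0 : R) ->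
  \forall a' \near a, F a' <= eps.
Proof.
move=> eps0 Fa; have H := (cvgr0Pnorm_le _).1 Fa _ eps0; near=> x.
by apply: (le_trans (ler_norm _)); near: x; exact: H.
Unshelve. all: by end_near. Qed.

Let normsq (x z eps : R) : 0 < eps -> x ^+ 2 + z ^+ 2 <= eps ^+ 2 ->
  `|x| <= eps /\ `|z| <= eps.
Proof.
move=> eps0 h; have := sqr_ge0 x; have := sqr_ge0 z => z2 x2.
by split; rewrite -ler_sqr ?nnegrE ?(ltW eps0)// real_normK ?num_real//; lra.
Qed.

Let flow_near a (T eps : R) : 0 < eps -> \forall a' \near a, forall t, 0 <= t -> t <= T ->
  `|y a t - y a' t| <= eps /\ `|f a t - f a' t| <= eps.
Proof.
move=> eps0.
have : D2 y f a a' 0 * G T @[a' --> a] --> 0.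
  rewrite -[X in _ --> X](mul0r (G T)); apply: cvgM; last exact: cvg_cst.
  exact: D2_cvg.
have eps2 : 0 < eps ^+ 2 by rewrite exprn_gt0.
move=> /(near_le _ _ _ eps2) H; apply: filterS H => a' h t t0 tT.
rewrite distrC (distrC (f a t)); apply: normsq => //.
exact: le_trans (flow_close a a' T t t0 tT) h.
Qed.

Let variation_near a (T eps : R) : 0 < eps -> \forall a' \near a, forall t, 0 <= t -> t <= T ->
  `|eta a t - eta a' t| <= eps /\ `|zeta a t - zeta a' t| <= eps.
Proof.
move=> eps0.
have : (D2 eta zeta a a' 0 + 4 * V ^+ 2 * e a a' T * T) * G T @[a' --> a] --> 0.
  rewrite -[X in _ --> X](mul0r (G T)); apply: cvgM; last exact: cvg_cst.
  rewrite -[X in _ --> X](addr0 0); apply: cvgD; first exact: D2_cvg.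
  rewrite -[X in _ --> X](mul0r T); apply: cvgM; last exact: cvg_cst.
  rewrite -[X in _ --> X](mulr0 (4 * V ^+ 2)); apply: cvgM; first exact: cvg_cst.
  exact: e_cvg.
have eps2 : 0 < eps ^+ 2 by rewrite exprn_gt0.
move=> /(near_le _ _ _ eps2) H; apply: filterS H => a' h t t0 tT.
rewrite distrC (distrC (zeta a t)); apply: normsq => //.
exact: le_trans (variation_close a a' T t t0 tT) h.
Qed.

Lemma flow_continuous : [/\ continuous (fun x : R * R => y x.2 (pos_time x.1)),
  continuous (fun x : R * R => f x.2 (pos_time x.1)),
  continuous (fun x : R * R => eta x.2 (pos_time x.1)) &
  continuous (fun x : R * R => zeta x.2 (pos_time x.1))].
Proof.
split; apply: joint_continuity => a.
- by move=> t t0; exact: der_continuous (dy a t t0).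
- move=> T eps eps0; have H := flow_near a T eps eps0.
  by apply: filterS H => a' h t t0 tT; have [] := h t t0 tT.
- by move=> t t0; exact: der_continuous (df a t t0).
- move=> T eps eps0; have H := flow_near a T eps eps0.
  by apply: filterS H => a' h t t0 tT; have [] := h t t0 tT.
- by move=> t t0; exact: der_continuous (deta a t t0).
- move=> T eps eps0; have H := variation_near a T eps eps0.
  by apply: filterS H => a' h t t0 tT; have [] := h t t0 tT.
- by move=> t t0; exact: der_continuous (dzeta a t t0).
- move=> T eps eps0; have H := variation_near a T eps eps0.
  by apply: filterS H => a' h t t0 tT; have [] := h t t0 tT.
Qed.

(** Differentiability in the label is inherited from time [0] at the same label. The lemma is
    pointwise in [a] because the initial data, extended evenly, need not be differentiable at
    [a = 0]. *)
Lemma flow_derive (a lam : R) :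
  is_derive a 1 (fun a => y a 0) (lam * eta a 0) ->
  is_derive a 1 (fun a => f a 0) (lam * zeta a 0) ->
  forall t, 0 <= t -> is_derive a 1 (fun a => y a t) (lam * eta a t) /\
    is_derive a 1 (fun a => f a t) (lam * zeta a t).
Proof.
move=> /is_derive_quotient dy0 /is_derive_quotient df0 t t0.
have sq0 (g : R -> R) (l : R) : g h @[h --> 0^'] --> l ->
    (g h - l) ^+ 2 @[h --> 0^'] --> 0.
  move=> gl; have h1 : (g h - l) @[h --> 0^'] --> 0.
    by rewrite -[X in _ --> X](subrr l); apply: cvgB; [exact: gl|exact: cvg_cst].
  by rewrite -[X in _ --> X](mulr0 0); under eq_fun do rewrite expr2; exact: cvgM.
have eh : e a (a + h) t @[h --> 0^'] --> 0.
  have H2 : a + h @[h --> 0^'] --> a.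
    rewrite -[X in _ --> X](addr0 a); apply: cvgD; first exact: cvg_cst.
    by apply: cvg_within_filter; exact: cvg_id.
  exact: cvg_comp H2 (e_cvg a t).
have lim : ((h^-1 * (y (a + h) 0 - y a 0) - lam * eta a 0) ^+ 2
  + (h^-1 * (f (a + h) 0 - f a 0) - lam * zeta a 0) ^+ 2
  + 4 * (`|lam| * V) ^+ 2 * e a (a + h) t * t) * G t @[h --> 0^'] --> 0.
  rewrite -[X in _ --> X](mul0r (G t)); apply: cvgM; last exact: cvg_cst.
  rewrite -[X in _ --> X](addr0 0); apply: cvgD.
    by rewrite -[X in _ --> X](addr0 0); apply: cvgD; exact: sq0.
  rewrite -[X in _ --> X](mul0r t); apply: cvgM; last exact: cvg_cst.
  by rewrite -[X in _ --> X](mulr0 (4 * (`|lam| * V) ^+ 2)); apply: cvgM;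
    [exact: cvg_cst|exact: eh].
have key (eps : R) : 0 < eps -> \forall h \near 0^',
   `|lam * eta a t - h^-1 * (y (a + h) t - y a t)| <= eps /\
   `|lam * zeta a t - h^-1 * (f (a + h) t - f a t)| <= eps.
  move=> eps0; have eps2 : 0 < eps ^+ 2 by rewrite exprn_gt0.
  have h1 := (cvgr0Pnorm_le _).1 lim _ eps2.
  near=> h; rewrite distrC (distrC (lam * zeta a t)); apply: normsq => //.
  have hn : h != 0 by near: h; exact: nbhs_dnbhs_neq.
  apply: (le_trans (quotient_close a h lam t t hn t0 (lexx t))).
  apply: (le_trans (ler_norm _)); near: h; exact: h1.
split; apply/is_derive_quotient; apply/cvgrPdist_le => eps eps0.
- by have H := key eps eps0; apply: filterS H => h [].
- by have H := key eps eps0; apply: filterS H => h [].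
Unshelve. all: by end_near. Qed.

End Continuity.
End Flow.

(** * Positivity of the reciprocal density *)

Section Cone.
Context {R : realType}.

Lemma dnegpart2 (x : R) : is_derive x 1 (fun x => Num.min x 0 ^+ 2) (2 * Num.min x 0).
Proof.
apply/is_derive_quotient/cvgrPdist_le => e e0.
near=> h.
have hn : h != 0 by near: h; exact: nbhs_dnbhs_neq.
have he : `|h| <= e by near: h; apply: dnbhs0_le.
apply: le_trans he.
have hh : 0 < `|h| by rewrite normr_gt0.
rewrite -(ler_pM2l hh) -normrM mulrBr mulVKf//.
have -> : `|h| * `|h| = h ^+ 2 by rewrite -expr2 real_normK ?num_real.
have := sqr_ge0 h => h2.
have [a|a] := leP x 0; have [b|b] := leP (x + h) 0;
  rewrite ler_norml; apply/andP; split; nra.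
Unshelve. all: by end_near. Qed.

(** The off-diagonal coefficients [1] and [q] are nonnegative, so a negative part of [u] or [v] is
    driven only by negative parts. The squares of the negative parts are differentiable, and
    Gronwall's inequality started from [0] keeps their sum at [0]. This treats the closed cone
    directly, with no strict inequality or first exit time. *)
Lemma cone_positive (al Bm : R) (p q g u v : R -> R) : 0 <= al -> 0 <= Bm ->
  (forall t : R, 0 <= t -> is_derive t 1 u (v t - al * u t)) ->
  (forall t : R, 0 <= t -> is_derive t 1 v (- p t * v t + q t * u t + g t)) ->
  (forall t, 0 <= t -> 0 <= p t) -> (forall t, 0 <= t -> 0 <= q t <= Bm) ->
  (forall t, 0 <= t -> 0 <= g t) -> 0 <= u 0 -> 0 <= v 0 ->
  forall t, 0 <= t -> 0 <= u t.
Proof.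
move=> al0 Bm0 du dv p0 q0 g0 u0 v0 t t0.
pose E s := Num.min (u s) 0 ^+ 2 + Num.min (v s) 0 ^+ 2.
have dE (s : R) : 0 <= s -> is_derive s 1 E
   (2 * Num.min (u s) 0 * (v s - al * u s) +
    2 * Num.min (v s) 0 * (- p s * v s + q s * u s + g s)).
  move=> s0; apply: (derD (fun s => Num.min (u s) 0 ^+ 2)
    (fun s => Num.min (v s) 0 ^+ 2)).
    by apply: (der_comp (fun x => Num.min x 0 ^+ 2) u); [exact: dnegpart2|exact: du].
  by apply: (der_comp (fun x => Num.min x 0 ^+ 2) v); [exact: dnegpart2|exact: dv].
have C0 : 0 <= 1 + Bm by lra.
have := gronwall E _ (1 + Bm) 0 t C0 (lexx 0) dE _ t t0 (lexx t).
have -> : E 0 = 0 by rewrite /E !min_r// expr0n/= addr0.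
rewrite add0r mul0r mul0r => H.
have {}H : E t <= 0.
  apply: H => s s0 _; have := p0 s s0; have := q0 s s0; have := g0 s s0.
  rewrite addr0 /E.
  have mU : Num.min (u s) 0 <= 0 by rewrite ge_min lexx orbT.
  have mV : Num.min (v s) 0 <= 0 by rewrite ge_min lexx orbT.
  have mUu : Num.min (u s) 0 <= u s by rewrite ge_min lexx.
  have mVv : Num.min (v s) 0 <= v s by rewrite ge_min lexx.
  have mU2 : Num.min (u s) 0 * u s = Num.min (u s) 0 ^+ 2.
    by rewrite expr2; have [h|h] := leP (u s) 0 => //; rewrite !mul0r.
  have mV2 : Num.min (v s) 0 * v s = Num.min (v s) 0 ^+ 2.
    by rewrite expr2; have [h|h] := leP (v s) 0 => //; rewrite !mul0r.
  move: (Num.min (u s) 0) (Num.min (v s) 0) mU mV mUu mVv mU2 mV2 => U W U0 W0 Uu Ww U2 W2.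
  move: (p s) (q s) (g s) => P Q G0 G0' /andP[Q0 QB] P0.
  have h1 : U * v s <= U * W by apply: ler_wnM2l.
  have h2 : W * (Q * u s) <= Q * (U * W).
    rewrite (_ : Q * (U * W) = W * (Q * U)); last by ring.
    by apply: ler_wnM2l => //; apply: ler_wpM2l.
  have h3 : Q * (U * W) <= Bm * (U * W) by apply: ler_wpM2r => //; exact: mulr_le0.
  have h4 : W * G0 <= 0 by exact: mulr_le0_ge0.
  have h5 : 0 <= P * W ^+ 2 by rewrite mulr_ge0 ?sqr_ge0.
  have h6 : 0 <= al * U ^+ 2 by rewrite mulr_ge0 ?sqr_ge0.
  have h7 : 2 * (U * W) <= U ^+ 2 + W ^+ 2 by have := sqr_ge0 (U - W); lra.
  have h8 : Bm * (2 * (U * W)) <= Bm * (U ^+ 2 + W ^+ 2) by rewrite ler_wpM2l.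
  rewrite (_ : 2 * U * (v s - al * u s) = 2 * (U * v s) - 2 * (al * U ^+ 2)); last first.
    by rewrite -U2; ring.
  rewrite (_ : 2 * W * (- P * v s + Q * u s + G0) =
    - 2 * (P * W ^+ 2) + 2 * (W * (Q * u s)) + 2 * (W * G0)); last first.
    by rewrite -W2; ring.
  lra.
rewrite leNgt; apply/negP => ut.
have : 0 < u t ^+ 2 by nra.
have := sqr_ge0 (Num.min (v t) 0); move: H; rewrite /E (min_l (ltW ut)); lra.
Qed.

End Cone.

Section Single.
Context {R : realType}.
Variables (D kap B b mu : R).
Hypothesis D0 : 0 < D.
Hypothesis kap0 : 0 <= kap.
Hypothesis B0 : 0 < B.
Hypothesis b0 : 0 < b.
Hypothesis mu0 : 0 < mu.
Hypothesis mu8 : mu <= 1 / 8.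
Variables (y f : R -> R).
Let E (t : R) := expR (- (3 / 4 * mu * t)).
Hypothesis dy : forall t : R, 0 <= t -> is_derive t 1 y (f t).
Hypothesis df : forall t : R, 0 <= t -> is_derive t 1 f
  (- (mu + mu^-1) * f t - y t + kap * f t ^+ 2 / (1 + D * y t)).
Hypothesis Sb : forall t, 0 <= t -> b <= 1 + D * y t.
Hypothesis fE : forall t, 0 <= t -> `|f t| <= 5 * B * E t.

Let g := 3 / 4 * mu.
Let g0 : 0 < g. Proof. by rewrite /g; have := mu0; lra. Qed.
Let E0 t : 0 <= E t. Proof. exact: expR_ge0. Qed.
Let E1 t : 0 <= t -> E t <= 1.
Proof.
by move=> t0; rewrite -expR0 ler_expR oppr_le0 !mulr_ge0// ltW.
Qed.
Let A := 5 * B.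
Let A0 : 0 <= A. Proof. by rewrite /A; have := B0; lra. Qed.
(** One copy of the bound is for [p * zeta] and one for [q * eta], the two terms of the linearized
    perturbation. *)
Let e0 := coef_bound D kap A b + coef_bound D kap A b.
Let p t := kap * ((f t + f t) / (1 + D * y t)).
Let q t := - (kap * D * (f t ^+ 2 / ((1 + D * y t) * (1 + D * y t)))).
Definition decay_const := 24 * expR (8 * e0 / g).

Let cb0 : 0 <= coef_bound D kap A b.
Proof.
rewrite /coef_bound; apply: addr_ge0.
  by rewrite !mulr_ge0 ?invr_ge0// ltW.
by rewrite mulr_ge0 ?sqr_ge0// mulr_ge0// ltW.
Qed.

(** Every term of [coef_bound] has degree at least one in the bound on [f], so inserting [A * E t]
    with [E t <= 1] brings out a factor [E t]. This is the integrability in time that [exact_decay]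
    asks for. *)
Let pqE t : 0 <= t -> `|p t| <= coef_bound D kap A b * E t /\
  `|q t| <= coef_bound D kap A b * E t.
Proof.
move=> t0.
have AE : 0 <= A * E t by rewrite mulr_ge0.
have [h1 h2] := coef_le D kap (A * E t) b D0 kap0 AE b0 _ _ _ _
  (Sb t t0) (Sb t t0) (fE t t0) (fE t t0).
have h3 : coef_bound D kap (A * E t) b <= coef_bound D kap A b * E t.
  rewrite /coef_bound [X in _ <= X]mulrDl.
  rewrite (_ : kap * (2 * (A * E t) / b) = kap * (2 * A / b) * E t); last by ring.
  rewrite lerD2l.
  rewrite (_ : kap * D * (A * E t / b) ^+ 2 = kap * D * (A / b) ^+ 2 * (E t * E t));
    last by ring.
  apply: ler_wpM2l; last by rewrite ler_piMr// E1.
  by rewrite mulr_ge0 ?sqr_ge0// mulr_ge0// ltW.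
by split; apply: le_trans h3.
Qed.

Lemma coef_bounded t : 0 <= t ->
  `|p t| <= coef_bound D kap A b /\ `|q t| <= coef_bound D kap A b.
Proof.
by move=> t0; have [h1 h2] := pqE t t0; split; [apply: (le_trans h1)|apply: (le_trans h2)];
  rewrite ler_piMr// E1.
Qed.

Lemma coef_continuous (t : R) : 0 <= t ->
  {for t, continuous p} /\ {for t, continuous q}.
Proof.
move=> t0; have d1 := dy t t0; have d2 := df t t0.
have n0 : 1 + D * y t != 0 by rewrite gt_eqF// (lt_le_trans b0)// Sb.
have dS : is_derive t 1 (fun s => 1 + D * y s) (D * f t) by der; ring.
split.
- apply: (@der_continuous _ _ _ (kap * ((f t + f t) * (- (1 + D * y t) ^- 2 * (D * f t)) +
    (1 + D * y t)^-1 * (2 * (- (mu + mu^-1) * f t - y t + kap * f t ^+ 2 / (1 + D * y t)))))).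
  have d3 := derV (fun s => 1 + D * y s) t _ n0 dS.
  by rewrite /p; der; ring.
- have dSS : is_derive t 1 (fun s => (1 + D * y s) * (1 + D * y s))
     (2 * (1 + D * y t) * (D * f t)) by der; ring.
  have nn : (1 + D * y t) * (1 + D * y t) != 0 by rewrite mulf_neq0.
  have d3 := derV (fun s => (1 + D * y s) * (1 + D * y s)) t _ nn dSS.
  apply: (@der_continuous R); rewrite /q; der; reflexivity.
Qed.

Lemma flow_decay t : 0 <= t -> y t ^+ 2 + f t ^+ 2 <=
  decay_const * (y 0 ^+ 2 + f 0 ^+ 2) * expR (- (2 * mu * t)).
Proof.
move=> t0.
apply: (exact_decay mu mu0 mu8 y f
   (fun t => kap * f t ^+ 2 / (1 + D * y t)) dy df e0 g) => //.
  by rewrite /e0 addr_ge0.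
move=> s s0; have [h1 _] := pqE s s0.
have -> : kap * f s ^+ 2 / (1 + D * y s) = p s * f s / 2.
  by rewrite /p; field; rewrite gt_eqF// (lt_le_trans b0)// Sb.
rewrite normrM [`|2^-1|]ger0_norm ?invr_ge0// normrM.
have h2 : `|p s| * `|f s| <= coef_bound D kap A b * E s * (`|y s| + `|f s|).
  by apply: ler_pM => //; rewrite lerDr.
have h3 : 0 <= coef_bound D kap A b * E s * (`|y s| + `|f s|).
  by rewrite mulr_ge0 ?addr_ge0// mulr_ge0.
by rewrite /e0 -/(E s); lra.
Qed.

Variables (eta zeta : R -> R).
Hypothesis deta : forall t : R, 0 <= t -> is_derive t 1 eta (zeta t).
Hypothesis dzeta : forall t : R, 0 <= t -> is_derive t 1 zeta
  (- (mu + mu^-1) * zeta t - eta t + (p t * zeta t + q t * eta t)).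

Lemma variation_decay t : 0 <= t -> eta t ^+ 2 + zeta t ^+ 2 <=
  decay_const * (eta 0 ^+ 2 + zeta 0 ^+ 2) * expR (- (2 * mu * t)).
Proof.
move=> t0.
apply: (exact_decay mu mu0 mu8 eta zeta
   (fun t => p t * zeta t + q t * eta t) deta dzeta e0 g) => //.
  by rewrite /e0 addr_ge0.
move=> s s0; have [h1 h2] := pqE s s0.
apply: (le_trans (ler_normD _ _)); rewrite (normrM (p s)) (normrM (q s)).
have h3 : `|p s| * `|zeta s| <= coef_bound D kap A b * E s * (`|eta s| + `|zeta s|).
  by apply: ler_pM => //; rewrite lerDr.
have h4 : `|q s| * `|eta s| <= coef_bound D kap A b * E s * (`|eta s| + `|zeta s|).
  by apply: ler_pM => //; rewrite lerDl.
by rewrite /e0 -/(E s); lra.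
Qed.

Let Fm := A / b.
Variables (al b2 : R).
Hypothesis al0 : 0 < al.
Hypothesis b20 : 0 < b2.
Hypothesis b2F : b2 * (1 + kap * D * Fm ^+ 2) <= 1.
Hypothesis muF : mu * (al + 2 * kap * Fm + (1 + kap * D * Fm ^+ 2) / al) <= 1.
Let X t := 1 + D * (y t + eta t).
Hypothesis X0 : b2 <= X 0.
Hypothesis X1 : 0 <= D * (f 0 + zeta 0) + al * (X 0 - b2).

(* [X] is the reciprocal of the density along the characteristic. It solves
   [X'' + (nu - 2 kap F) X' + (1 + kap D F^2) X = 1] with [F = f / (1 + D y)], hence
   the system [u' = v - al u, v' = - P v + Q u + g] for [u = X - b2] and
   [v = X' + al (X - b2)], with nonnegative [P], [Q] and [g]. *)
Lemma jacobian_positive t : 0 <= t -> b2 <= X t.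
Proof.
move=> t0; rewrite -subr_ge0.
pose F s := f s / (1 + D * y s).
pose nu := mu + mu^-1.
have n0 s : 0 <= s -> 1 + D * y s != 0.
  by move=> s0; rewrite gt_eqF// (lt_le_trans b0)// Sb.
have FFm s : 0 <= s -> `|F s| <= Fm.
  move=> s0; rewrite /F /Fm normrM; apply: ler_pM => //.
    by apply: (le_trans (fE s s0)); rewrite ler_piMr// E1.
  have S0 : 0 < 1 + D * y s by rewrite (lt_le_trans b0)// Sb.
  by rewrite normfV gtr0_norm// lef_pV2 ?posrE// Sb.
have F2 s : 0 <= s -> F s ^+ 2 <= Fm ^+ 2.
  move=> s0; rewrite -(real_normK (num_real (F s))) ler_sqr ?nnegrE ?FFm//.
  by rewrite /Fm divr_ge0// ltW.
have kF s : 0 <= s -> kap * F s <= kap * Fm.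
  by move=> s0; apply: ler_wpM2l => //; apply: (le_trans (ler_norm _)); exact: FFm.
have kF' s : 0 <= s -> - (kap * Fm) <= kap * F s.
  move=> s0; have := FFm s s0; rewrite ler_norml => /andP[h _].
  by rewrite -mulrN; exact: ler_wpM2l.
have kD2 s : 0 <= s -> 0 <= kap * D * F s ^+ 2 <= kap * D * Fm ^+ 2.
  by move=> s0; rewrite mulr_ge0 ?sqr_ge0 ?mulr_ge0 ?(ltW D0)//= ler_wpM2l ?F2// mulr_ge0// ltW.
(* [muF] says that [1 / mu], hence also [nu], exceeds this sum. It gives
   [P >= (1 + kap * D * Fm ^+ 2) / al], so that [al * P] outweighs the restoring coefficient and
   [Q >= 0]. *)
have nub : al + 2 * kap * Fm + (1 + kap * D * Fm ^+ 2) / al <= nu.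
  have h : mu^-1 * (mu * (al + 2 * kap * Fm + (1 + kap * D * Fm ^+ 2) / al)) <= mu^-1 * 1.
    by rewrite ler_wpM2l// invr_ge0 ltW.
  by rewrite mulKf ?gt_eqF// mulr1 in h; rewrite /nu; have := mu0; lra.
have aq : al * ((1 + kap * D * Fm ^+ 2) / al) = 1 + kap * D * Fm ^+ 2.
  by rewrite mulrC divfK// gt_eqF.
have kFm0 : 0 <= kap * D * Fm ^+ 2.
  by rewrite mulr_ge0 ?sqr_ge0// mulr_ge0// ltW.
have qa0 : 0 <= (1 + kap * D * Fm ^+ 2) / al by rewrite divr_ge0 ?ltW//; lra.
pose P s := nu - al - 2 * kap * F s.
pose Q s := al * P s - (1 + kap * D * F s ^+ 2).
have Pge s : 0 <= s -> (1 + kap * D * Fm ^+ 2) / al <= P s.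
  by move=> s0; have := kF s s0; rewrite /P; lra.
apply: (cone_positive al (al * (nu - al + 2 * kap * Fm))
  P Q (fun s => 1 - b2 * (1 + kap * D * F s ^+ 2)) (fun s => X s - b2)
  (fun s => D * (f s + zeta s) + al * (X s - b2))) => //.
- exact: ltW.
- rewrite mulr_ge0 ?(ltW al0)//; have := kF' 0 (lexx 0); have := Pge 0 (lexx 0).
  by rewrite /P; lra.
- by move=> s s0; have d1 := dy s s0; have d2 := deta s s0; rewrite /X; der; ring.
- move=> s s0; have d1 := dy s s0; have d2 := deta s s0.
  have d3 := df s s0; have d4 := dzeta s s0; rewrite /X; der.
  by rewrite /Q /P /X /p /q /F -/nu; field; rewrite n0.
- by move=> s s0; have := Pge s s0; lra.
- move=> s s0; have := Pge s s0 => Ps; have /andP[k1 k2] := kD2 s s0.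
  have := kF' s s0 => k3.
  have h1 : al * ((1 + kap * D * Fm ^+ 2) / al) <= al * P s by rewrite ler_pM2l.
  have h2 : al * P s <= al * (nu - al + 2 * kap * Fm).
    by rewrite ler_pM2l// /P; lra.
  by rewrite aq in h1; rewrite /Q; apply/andP; split; lra.
- move=> s s0; have /andP[k1 k2] := kD2 s s0.
  have : b2 * (1 + kap * D * F s ^+ 2) <= b2 * (1 + kap * D * Fm ^+ 2).
    by rewrite ler_pM2l//; lra.
  by have := b2F; lra.
- by rewrite subr_ge0.
Qed.

End Single.

(** * Initial data in Lagrangian variables and the choice of the friction *)

Section Lagrangian.
Context {R : realType}.
Variables (D : R) (F0 F1 G0 G1 : R -> R) (B1 c : R).
Hypothesis D1 : 1 <= D.
Hypothesis dF0 : forall a : R, 0 < a -> is_derive a 1 F0 (F1 a).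
Hypothesis dG0 : forall a : R, 0 < a -> is_derive a 1 G0 (G1 a).
Hypothesis cF0 : continuous (fun a : R => F0 `|a|).
Hypothesis cG0 : continuous (fun a : R => G0 `|a|).
Hypothesis cF1 : continuous (fun a : R => `|a| * F1 `|a|).
Hypothesis cG1 : continuous (fun a : R => `|a| * G1 `|a|).
Hypothesis B10 : 0 <= B1.
Hypothesis bF : forall a, 0 <= a -> `|F0 a| <= B1 /\ `|a * F1 a| <= B1.
Hypothesis bG : forall a, 0 <= a -> `|G0 a| <= B1 /\ `|a * G1 a| <= B1.
Hypothesis c0 : 0 < c.
Hypothesis mc : forall a, 0 <= a -> c <= 1 - D * G0 a.
Hypothesis nc : forall a, 0 <= a -> c <= 1 - D * G0 a - a * G1 a.

(* [eta_init] and [zeta_init] are the derivatives of [y_init] and [f_init] divided by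
   [label_rate], a normalization that removes the singularity at [a = 0]. *)
Definition mass (a : R) := 1 - D * G0 `|a|.
Definition dens (a : R) := 1 - D * G0 `|a| - `|a| * G1 `|a|.
Definition y_init (a : R) := G0 `|a| / mass a.
Definition f_init (a : R) := F0 `|a| / mass a.
Definition eta_init (a : R) := `|a| * G1 `|a| / (D * dens a * mass a).
Definition zeta_init (a : R) :=
  (`|a| * F1 `|a| + D * F0 `|a| * (`|a| * G1 `|a|) / mass a) / (D * dens a).
Definition label_rate (a : R) := D * dens a / (a * mass a).

Lemma mass_ge (a : R) : c <= mass a. Proof. exact: mc. Qed.
Lemma dens_ge (a : R) : c <= dens a. Proof. exact: nc. Qed.
Let D0 : 0 < D. Proof. by have := D1; lra. Qed.
Let mass0 (a : R) : 0 < mass a. Proof. exact: lt_le_trans c0 (mass_ge a). Qed.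
Let dens0 (a : R) : 0 < dens a. Proof. exact: lt_le_trans c0 (dens_ge a). Qed.
Let mass_neq0 (a : R) : mass a != 0. Proof. by rewrite gt_eqF. Qed.
Let dens_neq0 (a : R) : dens a != 0. Proof. by rewrite gt_eqF. Qed.
Let D_neq0 : D != 0. Proof. by rewrite gt_eqF. Qed.

Let mass_cont : continuous mass.
Proof.
apply: continuous_sub; first exact: continuous_const.
by apply: continuous_mul; [exact: continuous_const|exact: cG0].
Qed.

Let dens_cont : continuous dens.
Proof. by apply: continuous_sub; [exact: mass_cont|exact: cG1]. Qed.

Lemma init_continuous : [/\ continuous y_init, continuous f_init,
  continuous eta_init & continuous zeta_init].
Proof.
have cC (k : R) : continuous (fun _ : R => k) := continuous_const k.
have cmi := continuous_inv _ mass_neq0 mass_cont.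
have cni : continuous (fun a => (D * dens a)^-1).
  by apply: continuous_inv; [move=> a; rewrite mulf_neq0|apply: continuous_mul].
split.
- exact: continuous_mul.
- exact: continuous_mul.
- apply: continuous_mul => //; apply: continuous_inv; first by move=> a; rewrite !mulf_neq0.
  by apply: continuous_mul => //; apply: continuous_mul.
- apply: continuous_mul => //; apply: continuous_add => //.
  by do 2 (apply: continuous_mul => //); apply: continuous_mul.
Qed.

Lemma init_derive (a : R) : 0 < a ->
  is_derive a 1 y_init (label_rate a * eta_init a) /\
  is_derive a 1 f_init (label_rate a * zeta_init a).
Proof.
move=> a0.
have na : \forall x \near a, 0 < x by exact: lt_nbhsr.
have d1 := dG0 a a0; have d2 := dF0 a a0.
have m0 : 1 - D * G0 a != 0 by have := mass_neq0 a; rewrite /mass gtr0_norm.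
have a_neq0 : a != 0 by rewrite gt_eqF.
have n0 : 1 - D * G0 a - a * G1 a != 0.
  by have := dens_neq0 a; rewrite /dens gtr0_norm.
have dm : is_derive a 1 (fun x => 1 - D * G0 x) (- (D * G1 a)) by der; ring.
have dmi := derV (fun x => 1 - D * G0 x) a _ m0 dm.
split.
- apply: (@near_eq_is_derive _ _ _ (fun x => G0 x / (1 - D * G0 x))).
  + by near=> x; rewrite /y_init /mass (gtr0_norm (x := x))//; near: x.
  + der; rewrite /label_rate /eta_init /mass /dens (gtr0_norm a0).
    by field; rewrite m0 n0 a_neq0 D_neq0.
- apply: (@near_eq_is_derive _ _ _ (fun x => F0 x / (1 - D * G0 x))).
  + by near=> x; rewrite /f_init /mass (gtr0_norm (x := x))//; near: x.
  + der; rewrite /label_rate /zeta_init /mass /dens (gtr0_norm a0).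
    by field; rewrite m0 n0 a_neq0 D_neq0.
Unshelve. all: by end_near. Qed.

(** The denominator bounds both [mass] and [dens] from above, so [c1] bounds their reciprocals from
    below; these are the initial values of [1 + D * y] and of the reciprocal density. *)
Let c1 := (1 + D * B1 + B1)^-1.
(** The summands bound, in order, the initial values of [y] and [f], of [eta], and of [zeta]. The
    final [1] makes [B] positive. *)
Let B := B1 / c + B1 / c ^+ 2 + (B1 + D * B1 * B1 / c) / c + 1.
Let t1 : 0 <= B1 / c. Proof. by rewrite divr_ge0// ltW. Qed.
Let t2 : 0 <= B1 / c ^+ 2. Proof. by rewrite divr_ge0// sqr_ge0. Qed.
Let t3 : 0 <= (B1 + D * B1 * B1 / c) / c.
Proof.
by rewrite divr_ge0 ?(ltW c0)// addr_ge0// divr_ge0 ?(ltW c0)// !mulr_ge0// ltW.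
Qed.
Let B0 : 0 < B. Proof. by rewrite /B; have := t1; have := t2; have := t3; lra. Qed.
Let c1den : 1 <= 1 + D * B1 + B1.
Proof. by have := mulr_ge0 (ltW D0) B10; have := B10; lra. Qed.
Let c10 : 0 < c1. Proof. by rewrite invr_gt0; have := c1den; lra. Qed.
Let c11 : c1 <= 1. Proof. by rewrite invf_le1//; have := c1den; lra. Qed.

Let massV (a : R) : `|(mass a)^-1| <= c^-1.
Proof. by rewrite normfV gtr0_norm// lef_pV2 ?posrE// mass_ge. Qed.

Lemma init_bounds (a : R) : [/\ `|y_init a| <= B, `|f_init a| <= B,
  `|eta_init a| <= B & `|zeta_init a| <= B].
Proof.
have [f1 f2] := bF _ (normr_ge0 a); have [g1 g2] := bG _ (normr_ge0 a).
have densV : `|(D * dens a)^-1| <= c^-1.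
  rewrite normfV gtr0_norm ?mulr_gt0// lef_pV2 ?posrE ?mulr_gt0//.
  by have := dens_ge a; have := c0; have := D1; nra.
split.
- apply: (@le_trans _ _ (B1 / c)); last by rewrite /B; have := t2; have := t3; lra.
  by rewrite /y_init normrM ler_pM.
- apply: (@le_trans _ _ (B1 / c)); last by rewrite /B; have := t2; have := t3; lra.
  by rewrite /f_init normrM ler_pM.
- apply: (@le_trans _ _ (B1 / c ^+ 2)); last by rewrite /B; have := t1; have := t3; lra.
  rewrite /eta_init invfM normrM; apply: ler_pM => //.
  by rewrite normrM -exprVn expr2 ler_pM.
- apply: (@le_trans _ _ ((B1 + D * B1 * B1 / c) / c)); last first.
    by rewrite /B; have := t1; have := t2; lra.
  rewrite /zeta_init normrM; apply: ler_pM => //.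
  apply: (le_trans (ler_normD _ _)); rewrite lerD// normrM; apply: ler_pM => //.
  by rewrite normrM normrM (gtr0_norm D0) -!mulrA ler_wpM2l ?(ltW D0)// ler_pM.
Qed.

Let c1y (a : R) : c1 <= 1 + D * y_init a.
Proof.
have -> : 1 + D * y_init a = (mass a)^-1.
  by rewrite /y_init /mass; field; exact: mass_neq0.
rewrite lef_pV2 ?posrE//; last by have := c1den; lra.
have [g1 _] := bG _ (normr_ge0 a); rewrite /mass.
have : D * - G0 `|a| <= D * B1.
  by rewrite ler_pM2l//; apply: (le_trans (ler_norm _)); rewrite normrN.
by have := B10; lra.
Qed.

(** The factor [D * dens a] in the normalization of [eta] is chosen for this: the reciprocal density
    becomes an affine function of [y + eta], so its evolution follows from the oscillator and its
    linearization. *)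
Let XE (a : R) : 1 + D * (y_init a + eta_init a) = (dens a)^-1.
Proof.
have hm := mass_neq0 a; have hn := dens_neq0 a.
have {1}-> : y_init a = (1 - mass a) / D / mass a.
  by rewrite /y_init; congr (_ / _); rewrite /mass; field.
have -> : eta_init a = (mass a - dens a) / (D * dens a * mass a).
  by rewrite /eta_init; congr (_ / _); rewrite /mass /dens; ring.
by field; rewrite hm hn D_neq0.
Qed.

Let c1X (a : R) : c1 <= 1 + D * (y_init a + eta_init a).
Proof.
rewrite XE lef_pV2 ?posrE//; last by have := c1den; lra.
have [g1 g2] := bG _ (normr_ge0 a); rewrite /dens.
have : D * - G0 `|a| <= D * B1.
  by rewrite ler_pM2l//; apply: (le_trans (ler_norm _)); rewrite normrN.
by move: g2; rewrite ler_norml => /andP[]; lra.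
Qed.

Let kap := D - 1.
Let kap0 : 0 <= kap. Proof. by rewrite /kap; have := D1; lra. Qed.
Let b := c1 / 2.
Let b0 : 0 < b. Proof. by rewrite /b divr_gt0. Qed.
Let Fm := 5 * B / b.
Let k0 : 0 <= kap * D * Fm ^+ 2.
Proof. by rewrite mulr_ge0 ?sqr_ge0// mulr_ge0// ltW. Qed.
(** Initially [X' = D * (f + zeta) >= - 2 * D * B] and [X - b2 >= c1 / 2], so this slope makes
    [X' + al * (X - b2)] nonnegative at time [0]. *)
Let al := 4 * D * B / c1.
Let al0 : 0 < al. Proof. by rewrite /al divr_gt0// !mulr_gt0. Qed.
(** Dividing by the largest restoring coefficient keeps the forcing
    [1 - b2 * (1 + kap * D * F ^+ 2)] nonnegative. As [b2 <= b], the same number bounds [1 + D * y]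
    from below. *)
Let b2 := b / (1 + kap * D * Fm ^+ 2).
Let b20 : 0 < b2. Proof. by rewrite /b2 divr_gt0//; have := k0; lra. Qed.
Let b2F : b2 * (1 + kap * D * Fm ^+ 2) <= 1.
Proof.
rewrite /b2 divfK; last by apply: lt0r_neq0; have := k0; lra.
by rewrite /b; have := c11; have := c10; lra.
Qed.
Let b2b : b2 <= b.
Proof.
rewrite /b2 ler_pdivrMr; last by have := k0; lra.
by rewrite ler_peMr ?(ltW b0)//; have := k0; lra.
Qed.

Lemma lagrangian : exists (mu b C : R) (y f eta zeta : R -> R -> R),
  [/\ 0 < mu < 1, 0 < b, 0 <= C &
  [/\ (forall a, [/\ y a 0 = y_init a & f a 0 = f_init a]),
    (forall a (t : R), 0 <= t -> is_derive t 1 (y a) (f a t)),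
    (forall a (t : R), 0 <= t -> is_derive t 1 (f a)
      (- (mu + mu^-1) * f a t - y a t + (D - 1) * f a t ^+ 2 / (1 + D * y a t))),
    (forall a t, 0 <= t -> b <= 1 + D * y a t /\ b <= 1 + D * (y a t + eta a t)) &
  [/\ [/\ continuous (fun x : R * R => y x.2 (pos_time x.1)),
    continuous (fun x : R * R => f x.2 (pos_time x.1)),
    continuous (fun x : R * R => eta x.2 (pos_time x.1)) &
    continuous (fun x : R * R => zeta x.2 (pos_time x.1))],
    (forall a : R, 0 < a -> forall t, 0 <= t ->
      is_derive a 1 (fun a => y a t) (label_rate a * eta a t) /\
      is_derive a 1 (fun a => f a t) (label_rate a * zeta a t)),
    (forall a t, 0 <= t -> y a t ^+ 2 + f a t ^+ 2 <=
       C * (y_init a ^+ 2 + f_init a ^+ 2) * expR (- (2 * mu * t))) &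
    (forall a t, 0 <= t -> eta a t ^+ 2 + zeta a t ^+ 2 <=
       C * (eta_init a ^+ 2 + zeta_init a ^+ 2) * expR (- (2 * mu * t)))]]].
Proof.
(* The three numbers encode the smallness conditions on [mu]: [q1] for the Lyapunov function, [q2]
   for the lower bound on [1 + D * y], [q3] for the cone. They depend only on the data, so the
   reciprocal of [8] plus their sum meets all of them together with [mu <= 1 / 8]. *)
pose q1 := 16 * (kap * (5 * B) / b).
pose q2 := 9 * D * B / b.
pose q3 := al + 2 * kap * Fm + (1 + kap * D * Fm ^+ 2) / al.
have q10 : 0 <= q1 by rewrite /q1 mulr_ge0// divr_ge0 ?(ltW b0)// mulr_ge0// mulr_ge0// ltW.
have q20 : 0 <= q2 by rewrite /q2 divr_ge0 ?(ltW b0)// !mulr_ge0// ltW.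
have Fm0 : 0 <= Fm by rewrite /Fm divr_ge0 ?(ltW b0)// mulr_ge0// ltW.
have q30 : 0 <= q3.
  rewrite /q3; apply: addr_ge0; last by rewrite divr_ge0 ?(ltW al0)//; have := k0; lra.
  apply: addr_ge0; first exact: ltW.
  by apply: mulr_ge0 => //; apply: mulr_ge0.
pose mu := (8 + q1 + q2 + q3)^-1.
have mu0 : 0 < mu by rewrite invr_gt0; lra.
have muQ : mu * (8 + q1 + q2 + q3) = 1 by rewrite mulVf// gt_eqF//; lra.
have m1 := mulr_ge0 (ltW mu0) q10; have m2 := mulr_ge0 (ltW mu0) q20.
have m3 := mulr_ge0 (ltW mu0) q30.
have mu8 : mu <= 1 / 8 by lra.
have muK : mu * (kap * (5 * B) / (c1 / 2)) <= 1 / 16.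
  have h : mu * q1 <= 1 by lra.
  by move: h; rewrite -/b /q1; lra.
have muB : 9 * D * B * mu <= c1 / 2.
  have h : mu * q2 <= 1 by lra.
  move: h; rewrite -/b /q2 mulrA ler_pdivrMr// mul1r; lra.
have muF : mu * q3 <= 1 by lra.
clearbody mu.
have nl a := @nonlinear_solution R D kap B c1 mu D0 kap0 B0 c10 c11 mu0 mu8 muK muB
  (y_init a) (f_init a) (let: And4 h _ _ _ := init_bounds a in h)
  (let: And4 _ h _ _ := init_bounds a in h) (c1y a).
have /choice[yf hyf] : forall a, exists yf : (R -> R) * (R -> R),
    [/\ yf.1 0 = y_init a, yf.2 0 = f_init a,
    forall t : R, 0 <= t -> is_derive t 1 yf.1 (yf.2 t),
    forall t : R, 0 <= t -> is_derive t 1 yf.2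
      (- (mu + mu^-1) * yf.2 t - yf.1 t + kap * yf.2 t ^+ 2 / (1 + D * yf.1 t)) &
    forall t : R, 0 <= t -> [/\ c1 / 2 <= 1 + D * yf.1 t,
      `|yf.1 t| <= 5 * B * expR (- (3 / 4 * mu * t)) &
      `|yf.2 t| <= 5 * B * expR (- (3 / 4 * mu * t))]].
  by move=> a; have [y [f h]] := nl a; exists (y, f).
pose y a := (yf a).1; pose f a := (yf a).2.
have yI a : y a 0 = y_init a by have [] := hyf a.
have fI a : f a 0 = f_init a by have [] := hyf a.
have dy a (t : R) : 0 <= t -> is_derive t 1 (y a) (f a t).
  by have [_ _ h _ _] := hyf a; exact: h.
have df a (t : R) : 0 <= t -> is_derive t 1 (f a)
    (- (mu + mu^-1) * f a t - y a t + kap * f a t ^+ 2 / (1 + D * y a t)).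
  by have [_ _ _ h _] := hyf a; exact: h.
have Sb a t : 0 <= t -> b <= 1 + D * y a t.
  by move=> t0; have [_ _ _ _ /(_ t t0)[]] := hyf a.
have fE a t : 0 <= t -> `|f a t| <= 5 * B * expR (- (3 / 4 * mu * t)).
  by move=> t0; have [_ _ _ _ /(_ t t0)[]] := hyf a.
pose p a t := kap * ((f a t + f a t) / (1 + D * y a t)).
pose q a t := - (kap * D * (f a t ^+ 2 / ((1 + D * y a t) * (1 + D * y a t)))).
have A0 : 0 <= 5 * B by rewrite mulr_ge0// ltW.
have nu0 : 0 <= mu + mu^-1 by rewrite addr_ge0 ?invr_ge0 ?(ltW mu0).
have pq a := coef_bounded D kap B b mu D0 kap0 B0 b0 mu0 (y a) (f a) (Sb a) (fE a).
have M0 : 0 <= coef_bound D kap (5 * B) b by exact: le_trans (pq 0 0 (lexx 0)).1.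
have cpq a := coef_continuous D kap b mu b0 (y a) (f a) (dy a) (df a) (Sb a).
have /choice[ez hez] : forall a, exists ez : (R -> R) * (R -> R),
    [/\ ez.1 0 = eta_init a, ez.2 0 = zeta_init a,
    forall t : R, 0 <= t -> is_derive t 1 ez.1 (ez.2 t) &
    forall t : R, 0 <= t -> is_derive t 1 ez.2
      (- (mu + mu^-1) * ez.2 t - ez.1 t + (p a t * ez.2 t + q a t * ez.1 t))].
  move=> a; have [u [v h]] := linear_solution (mu + mu^-1) _ nu0 (p a) (q a)
    (eta_init a) (zeta_init a) (fun t t0 => (cpq a t t0).1)
    (fun t t0 => (cpq a t t0).2) (fun t t0 => (pq a t t0).1)
    (fun t t0 => (pq a t t0).2).
  by exists (u, v).
pose eta a := (ez a).1; pose zeta a := (ez a).2.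
have eI a : eta a 0 = eta_init a by have [] := hez a.
have zI a : zeta a 0 = zeta_init a by have [] := hez a.
have deta a (t : R) : 0 <= t -> is_derive t 1 (eta a) (zeta a t).
  by have [_ _ h _] := hez a; exact: h.
have dzeta a (t : R) : 0 <= t -> is_derive t 1 (zeta a)
    (- (mu + mu^-1) * zeta a t - eta a t + (p a t * zeta a t + q a t * eta a t)).
  by have [_ _ _ h] := hez a; exact: h.
pose C := decay_const D kap B b mu.
have C0 : 0 <= C by rewrite /C /decay_const mulr_ge0// expR_ge0.
have dec1 a t : 0 <= t -> y a t ^+ 2 + f a t ^+ 2 <=
       C * (y_init a ^+ 2 + f_init a ^+ 2) * expR (- (2 * mu * t)).
  by rewrite -yI -fI; exact: (flow_decay D kap B b mu D0 kap0 B0 b0 mu0 mu8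
    (y a) (f a) (dy a) (df a) (Sb a) (fE a)).
have dec2 a t : 0 <= t -> eta a t ^+ 2 + zeta a t ^+ 2 <=
       C * (eta_init a ^+ 2 + zeta_init a ^+ 2) * expR (- (2 * mu * t)).
  by rewrite -eI -zI; exact: (variation_decay D kap B b mu D0 kap0 B0 b0 mu0 mu8
    (y a) (f a) (Sb a) (fE a) (eta a) (zeta a) (deta a) (dzeta a)).
pose V := 1 + C * (2 * B ^+ 2).
have V0 : 0 <= V by rewrite /V addr_ge0// mulr_ge0// mulr_ge0// sqr_ge0.
have sqle (x k : R) : x ^+ 2 <= k -> `|x| <= 1 + k.
  move=> xk; have : 0 <= (`|x| - 1) ^+ 2 by exact: sqr_ge0.
  by have := sqr_ge0 x; move: xk; rewrite -(real_normK (num_real x)); nra.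
have sqB (x : R) : `|x| <= B -> x ^+ 2 <= B ^+ 2.
  by move=> xB; rewrite -(real_normK (num_real x)) ler_sqr ?nnegrE// ltW.
have eV a t : 0 <= t -> `|eta a t| <= V /\ `|zeta a t| <= V.
  move=> t0; have [_ _ /sqB h1 /sqB h2] := init_bounds a.
  have h : eta a t ^+ 2 + zeta a t ^+ 2 <= C * (2 * B ^+ 2).
    apply: (le_trans (dec2 a t t0)).
    have E1 : expR (- (2 * mu * t)) <= 1.
      by rewrite -expR0 ler_expR oppr_le0 !mulr_ge0// ltW.
    have s0 : 0 <= eta_init a ^+ 2 + zeta_init a ^+ 2 by rewrite addr_ge0 ?sqr_ge0.
    apply: (@le_trans _ _ (C * (eta_init a ^+ 2 + zeta_init a ^+ 2))).
      by rewrite ler_piMr// mulr_ge0.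
    by rewrite ler_wpM2l//; lra.
  have := sqr_ge0 (eta a t); have := sqr_ge0 (zeta a t).
  by split; apply: sqle; lra.
have [ciy cif cie ciz] := init_continuous.
have fA a t : 0 <= t -> `|f a t| <= 5 * B.
  move=> t0; apply: (le_trans (fE a t t0)); rewrite ler_piMr//.
  by rewrite -expR0 ler_expR oppr_le0 !mulr_ge0// ltW.
have eqI (g : R -> R -> R) gi : continuous gi -> (forall a, g a 0 = gi a) ->
    continuous (fun a => g a 0).
  by move=> cg gE; rewrite (_ : (fun a => g a 0) = gi)//; apply/funext.
exists mu, b2, C, y, f, eta, zeta; split => //.
  by apply/andP; split=> //; lra.
split => //.
  move=> a t t0; split; first by apply: (le_trans b2b); exact: Sb.
  apply: (jacobian_positive D kap B b mu D0 kap0 B0 b0 mu0 (y a) (f a) (dy a) (df a)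
    (Sb a) (fE a) (eta a) (zeta a) (deta a) (dzeta a) al b2 al0 b20 b2F muF) => //.
    rewrite yI eI; apply: (le_trans b2b); rewrite /b.
    by have := c1X a; have := c10; lra.
  rewrite yI eI fI zI.
  have [_ h2 _ h4] := init_bounds a.
  move: h2 h4; rewrite !ler_norml => /andP[h2 _] /andP[h4 _].
  have h5 : c1 / 2 <= 1 + D * (y_init a + eta_init a) - b2.
    by have := c1X a; have := b2b; rewrite /b; lra.
  have h6 : al * (c1 / 2) <= al * (1 + D * (y_init a + eta_init a) - b2).
    by rewrite ler_pM2l.
  have alE : al * (c1 / 2) = 2 * D * B by rewrite /al; field; rewrite gt_eqF.
  have h7 : D * (- 2 * B) <= D * (f_init a + zeta_init a) by rewrite ler_pM2l//; lra.
  lra.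
have cy := eqI y _ ciy yI; have cf := eqI f _ cif fI.
have ce := eqI eta _ cie eI; have cz := eqI zeta _ ciz zI.
split => //.
  exact: (flow_continuous D kap (mu + mu^-1) (5 * B) b V y f eta zeta D0 kap0 nu0 A0
    b0 V0 dy df deta dzeta Sb fA eV cy cf ce cz).
move=> a a0 t t0.
apply: (flow_derive D kap (mu + mu^-1) (5 * B) b V y f eta zeta D0 kap0 nu0 A0
    b0 V0 dy df deta dzeta Sb fA eV cy cf _ _ _ _ t t0).
- rewrite eI (_ : (fun a => y a 0) = y_init); last by apply/funext.
  exact: (init_derive a a0).1.
- rewrite zI (_ : (fun a => f a 0) = f_init); last by apply/funext.
  exact: (init_derive a a0).2.
Qed.

End Lagrangian.

(** * Eulerian profiles *)

Section HalfDerivative.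
Context {R : realType}.

Lemma mean_value (f df : R -> R) (x y : R) :
  (forall z : R, `|z - x| <= `|y - x| -> is_derive z 1 f (df z)) ->
  exists2 z, `|z - x| <= `|y - x| & f y - f x = df z * (y - x).
Proof.
move=> d; have [xy|yx|<-] := ltgtP x y; last first.
- by exists x => //; rewrite !subrr mulr0.
- have B z : y <= z <= x -> `|z - x| <= `|y - x|.
    by move=> /andP[? ?]; rewrite !ler0_norm; lra.
  have [||z zz E] := @MVT_segment R f df y x (ltW yx).
  + by move=> z; rewrite in_itv/= => /andP[? ?]; apply: d; apply: B; rewrite !ltW.
  + apply: continuous_in_subspaceT => z.
    by rewrite inE/= in_itv/= => zz; exact: der_continuous (d z (B z zz)).
  + by move: zz; rewrite in_itv/= => zz; exists z; [exact: B|lra].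
- have B z : x <= z <= y -> `|z - x| <= `|y - x|.
    by move=> /andP[? ?]; rewrite !ger0_norm; lra.
  have [||z zz E] := @MVT_segment R f df x y (ltW xy).
  + by move=> z; rewrite in_itv/= => /andP[? ?]; apply: d; apply: B; rewrite !ltW.
  + apply: continuous_in_subspaceT => z.
    by rewrite inE/= in_itv/= => zz; exact: der_continuous (d z (B z zz)).
  + by move: zz; rewrite in_itv/= => zz; exists z; [exact: B|lra].
Qed.

Global Instance half_nbhs_filter (t : R) : Filter (half_nbhs t).
Proof. exact: within_filter. Qed.

Lemma half_nbhs_proper (t : R) : 0 <= t -> ProperFilter (half_nbhs t).
Proof.
move=> t0; apply: Build_ProperFilter_ex => P [e /= e0 he].
exists (e / 2); apply: he => /=.
- rewrite sub0r normrN gtr0_norm; [lra|by lra].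
- by apply: lt0r_neq0; lra.
- lra.
Qed.

Lemma half_nbhs_pos (t : R) : 0 < t -> half_nbhs t = 0^'.
Proof.
move=> t0; apply/seteqP; split => P.
- move=> H; have H2 : \forall h \near (0 : R)^', 0 <= t + h.
    near=> h; have : `|h| <= t by near: h; exact: dnbhs0_le.
    by rewrite ler_norml => /andP[]; lra.
  by rewrite /half_nbhs /within/= in H; apply: filterS2 H H2 => h; exact.
- by move=> H; rewrite /half_nbhs /within/=; apply: filterS H => h.
Unshelve. all: by end_near. Qed.

Section Gen.
Context {W : normedModType R}.

Definition is_half_derive (U : R -> W) (t : R) (l : W) :=
  half_quotient U t h @[h --> half_nbhs t] --> l.

Lemma is_half_derive_val (U : R -> W) t l : 0 <= t -> is_half_derive U t l ->
  half_derivable U t /\ half_derive U t = l.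
Proof.
move=> t0 H; have := half_nbhs_proper t t0 => PF.
by split; [apply/cvg_ex; exists l|exact: cvg_lim].
Qed.

Lemma half_derivable_is_derive (U : R -> W) t : half_derivable U t ->
  is_half_derive U t (half_derive U t).
Proof. by []. Qed.

Lemma is_half_derive_eq (U : R -> W) t l l' :
  is_half_derive U t l -> l = l' -> is_half_derive U t l'.
Proof. by move=> ? <-. Qed.

Lemma is_half_derive_ext (U U' : R -> W) t l : 0 <= t -> (forall s, 0 <= s -> U s = U' s) ->
  is_half_derive U t l -> is_half_derive U' t l.
Proof.
move=> t0 UU H.
have E : \forall h \near half_nbhs t, half_quotient U t h = half_quotient U' t h.
  rewrite /half_nbhs near_withinE; near=> h => th.
  by rewrite /half_quotient !UU.
apply: cvg_trans H; apply: near_eq_cvg; exact: E.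
Unshelve. all: by end_near. Qed.

End Gen.

Lemma is_derive_half (U : R -> R) (t l : R) : is_derive t 1 U l -> is_half_derive U t l.
Proof.
move=> /is_derive_quotient H.
rewrite /is_half_derive /half_nbhs.
apply: (@cvg_within_filter _ _ _ 0^').
exact: H.
Qed.

Lemma half_is_derive (U : R -> R) (t l : R) : 0 < t -> is_half_derive U t l -> is_derive t 1 U l.
Proof. by move=> t0 H; apply/is_derive_quotient; rewrite /is_half_derive half_nbhs_pos in H. Qed.

Lemma is_half_derive_cvg (U : R -> R) (t l : R) : is_half_derive U t l ->
  U (t + h) @[h --> half_nbhs t] --> U t.
Proof.
move=> H.
have h0 : h @[h --> half_nbhs t] --> (0 : R).
  by apply: cvg_within_filter; apply: cvg_within_filter; exact: cvg_id.
have H2 : U t + h * half_quotient U t h @[h --> half_nbhs t] --> U t.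
  rewrite -[X in _ --> X]addr0 -[X in _ --> _ + X](mul0r l).
  by apply: cvgD; [exact: cvg_cst|exact: cvgM].
apply: cvg_trans H2; apply: near_eq_cvg.
rewrite /half_nbhs near_withinE; near=> h => th.
have hn : h != 0 by near: h; exact: nbhs_dnbhs_neq.
rewrite /half_quotient [_ *: _]/( _ * _) mulVKf//; ring.
Unshelve. all: by end_near. Qed.

(** To the left of [0] the function is continued by its tangent line. The one-sided derivative at
    [0] becomes two-sided, and [gronwall] applies. *)
Lemma half_extension (u u' : R -> R) : (forall t, 0 <= t -> is_half_derive u t (u' t)) ->
  exists v : R -> R, (forall t, 0 <= t -> v t = u t) /\
    forall t : R, 0 <= t -> is_derive t 1 v (u' t).
Proof.
move=> hu; pose v t := if 0 <= t then u t else u 0 + u' 0 * t.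
have vE t : 0 <= t -> v t = u t by rewrite /v => ->.
exists v; split=> // t; rewrite le_eqVlt => /predU1P[<-|t0]; last first.
  apply: half_is_derive => //; apply: (is_half_derive_ext u) => //; first exact: ltW.
    by move=> s s0; rewrite vE.
  exact/hu/ltW.
apply/is_derive_quotient/cvgrPdist_le => e e0.
have := (cvgrPdist_le _ _).1 (hu 0 (lexx 0)) e e0.
rewrite {1}/half_nbhs near_withinE => H.
near=> h.
have hn : h != 0 by near: h; exact: nbhs_dnbhs_neq.
rewrite add0r (vE 0)//; have [h0|h0] := leP 0 h.
  have : 0 <= 0 + h -> `|u' 0 - half_quotient u 0 h| <= e by near: h; exact: H.
  by rewrite /half_quotient !add0r vE//; apply.
rewrite /v (lt_geF h0) addrAC subrr add0r mulrCA mulVf// mulr1 subrr normr0.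
exact: ltW.
Unshelve. all: by end_near. Qed.

(** The spatial half of the chain rule along a moving point. The mean value theorem in [r] at time
    [t + h] and continuity of [Ur] at [(t, r)] suffice; no time derivative of [U] is assumed. It is
    used in both directions, from Lagrangian to Eulerian time derivatives and back. *)
Lemma half_chain (U Ur : R -> R -> R) (q : R -> R) (t r q' : R) :
  0 <= t -> 0 < r -> q t = r -> is_half_derive q t q' ->
  (forall t' r' : R, 0 <= t' -> 0 < r' -> is_derive r' 1 (U t') (Ur t' r')) ->
  (forall e, 0 < e -> \forall x \near (t, r), 0 <= x.1 ->
     `|Ur t r - Ur x.1 x.2| <= e) ->
  h^-1 * (U (t + h) (q (t + h)) - U (t + h) r) @[h --> half_nbhs t]
    --> Ur t r * q'.
Proof.
move=> t0 r0 qt dq dU cU.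
(* The point may be back at [r] at time [t + h]; the divided difference is then given its limit as
   value. *)
pose g h := if q (t + h) == r then Ur t r
  else (U (t + h) (q (t + h)) - U (t + h) r) / (q (t + h) - r).
have gE h : U (t + h) (q (t + h)) - U (t + h) r = g h * (q (t + h) - r).
  rewrite /g; case: eqVneq => [->|ne]; first by rewrite !subrr mulr0.
  by rewrite divfK// subr_eq0.
have qc := is_half_derive_cvg q t q' dq.
have tc : t + h @[h --> half_nbhs t] --> t.
  rewrite -[X in _ --> X](addr0 t); apply: cvgD; first exact: cvg_cst.
  by apply: cvg_within_filter; apply: cvg_within_filter; exact: cvg_id.
have gc : g h @[h --> half_nbhs t] --> Ur t r.
  apply/cvgrPdist_le => e e0.
  have /nbhs_ballP[d /= d0 hU] := cU e e0.
  have m0 : 0 < Num.min d (r / 2) by rewrite lt_min d0/=; lra.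
  have H1 := (cvgrPdist_lt _ _).1 qc _ m0.
  have H2 := (cvgrPdist_lt _ _).1 tc _ d0.
  have H3 : \forall h \near half_nbhs t, 0 <= t + h.
    by rewrite /half_nbhs near_withinE; near=> h.
  near=> h.
  have h1 : `|q t - q (t + h)| < Num.min d (r / 2) by near: h; exact: H1.
  have h2 : `|t - (t + h)| < d by near: h; exact: H2.
  have h3 : 0 <= t + h by near: h; exact: H3.
  move: h1; rewrite qt lt_min distrC => /andP[h1 h1'].
  have Q (z : R) : `|z - r| <= `|q (t + h) - r| -> 0 < z /\ `|r - z| < d.
    move=> zq; split; last by rewrite distrC; exact: le_lt_trans h1.
    have := le_lt_trans zq h1'.
    by rewrite ltr_norml => /andP[]; lra.
  rewrite /g; case: eqVneq => [_|ne]; first by rewrite subrr normr0 ltW.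
  have [z zq ->] := mean_value (U (t + h)) (Ur (t + h)) r (q (t + h))
     (fun z zq => dU (t + h) z h3 (Q z zq).1).
  rewrite mulfK ?subr_eq0//.
  by apply: (hU (t + h, z)) => //; split=> //=; exact: (Q z zq).2.
have H : g h * half_quotient q t h @[h --> half_nbhs t] --> Ur t r * q'.
  exact: cvgM gc dq.
apply: cvg_trans H; apply: near_eq_cvg; near=> h.
by rewrite gE /half_quotient qt; exact: mulrCA.
Unshelve. all: by end_near. Qed.

End HalfDerivative.

Lemma continuous_pair {T U V : topologicalType} (f : T -> U) (g : T -> V) t :
  {for t, continuous f} -> {for t, continuous g} ->
  {for t, continuous (fun t => (f t, g t))}.
Proof.
by move=> cf cg; apply: (@cvg_pair _ _ _ _ (nbhs (f t)) (nbhs (g t))).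
Qed.

(** * Inversion of the label map and transport to Eulerian variables *)

Section LabelMap.
Context {R : realType}.
Variables (Q Qa : R -> R -> R) (k : R).
Hypothesis k0 : 0 < k.
Hypothesis Q0 : forall t, 0 <= t -> Q 0 t = 0.
Hypothesis dQ : forall a t : R, 0 < a -> 0 <= t ->
  is_derive a 1 (Q ^~ t) (Qa a t).
Hypothesis Qa0 : forall a t, 0 < a -> 0 <= t -> 0 < Qa a t.
Hypothesis cQ : continuous (fun x : R * R => Q x.2 (pos_time x.1)).
Hypothesis kQ : forall a t, 0 <= a -> 0 <= t -> k * a <= Q a t.

Let cQt (a : R) : continuous (fun t => Q a (pos_time t)).
Proof.
move=> t; apply: (@continuous_comp _ _ _ (fun t : R => (t, a))
  (fun x : R * R => Q x.2 (pos_time x.1))); last exact: cQ.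
by apply: (@continuous_pair _ _ _ (fun t => t) (fun=> a)); [exact: cvg_id|exact: cvg_cst].
Qed.

Let cQa (t : R) : 0 <= t -> continuous (Q ^~ t).
Proof.
move=> t0; rewrite -(pos_time_id t t0) => a.
apply: (@continuous_comp _ _ _ (fun a : R => (t, a))
  (fun x : R * R => Q x.2 (pos_time x.1))); last exact: cQ.
by apply: (@continuous_pair _ _ _ (fun=> t) (fun a => a)); [exact: cvg_cst|exact: cvg_id].
Qed.

Lemma label_map_lt (a a' t : R) : 0 <= t -> 0 <= a -> a < a' -> Q a t < Q a' t.
Proof.
move=> t0 a0 aa.
apply: (@gtr0_derive1_lt_cc _ (Q ^~ t) 0 a') => //.
- by move=> x; rewrite in_itv/= => /andP[x0 _]; case: (dQ x t x0 t0).
- move=> x; rewrite in_itv/= => /andP[x0 _]; rewrite derive1E.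
  by have [_ ->] := dQ x t x0 t0; exact: Qa0.
- by apply: continuous_subspaceT; exact: cQa.
- by rewrite in_itv/= a0 ltW.
- by rewrite in_itv/= lexx andbT (le_trans a0 (ltW aa)).
Qed.

Lemma label_map_le (a a' t : R) : 0 <= t -> 0 <= a -> 0 <= a' ->
  Q a t <= Q a' t -> a <= a'.
Proof.
move=> t0 a0 a0' QQ; rewrite leNgt; apply/negP => aa.
by have := label_map_lt a' a t t0 a0' aa; lra.
Qed.

Lemma label_exists : exists L : R -> R -> R, forall t r, 0 <= t -> 0 <= r ->
  0 <= L t r /\ Q (L t r) t = r.
Proof.
have /choice[L hL] : forall x : R * R, exists a, 0 <= x.1 -> 0 <= x.2 ->
    0 <= a /\ Q a x.1 = x.2.
  move=> [t r] /=.
  have [t0|t0] := leP 0 t; last by exists 0.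
  have [r0|r0] := leP 0 r; last by exists 0.
  have rk : 0 <= r / k by rewrite divr_ge0// ltW.
  have [| |a] := @IVT _ (Q ^~ t) 0 (r / k) r rk.
  - by apply: continuous_subspaceT; exact: cQa.
  - rewrite Q0//; have h : r <= Q (r / k) t.
      by have := kQ _ _ rk t0; rewrite mulrC divfK ?gt_eqF.
    by rewrite ge_min r0/= le_max h orbT.
  - by rewrite in_itv/= => /andP[a0 _] Qa'; exists a.
by exists (fun t r => L (t, r)) => t r t0 r0; exact: (hL (t, r)).
Qed.

Variables (L : R -> R -> R).
Hypothesis hL : forall t r, 0 <= t -> 0 <= r -> 0 <= L t r /\ Q (L t r) t = r.

Lemma labelK a t : 0 <= a -> 0 <= t -> L t (Q a t) = a.
Proof.
move=> a0 t0; have Q0' : 0 <= Q a t.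
  by apply: le_trans (kQ a t a0 t0); rewrite mulr_ge0// ltW.
have [l0 lE] := hL t (Q a t) t0 Q0'.
by apply: le_anti; apply/andP; split; apply: (label_map_le _ _ t) => //; rewrite lE.
Qed.

Lemma label_map_ge0 a t : 0 <= a -> 0 <= t -> 0 <= Q a t.
Proof. by move=> a0 t0; apply: le_trans (kQ a t a0 t0); rewrite mulr_ge0// ltW. Qed.

Lemma label0 t : 0 <= t -> L t 0 = 0.
Proof. by move=> t0; rewrite -{1}(Q0 t t0) labelK. Qed.

Lemma label_gt0 t r : 0 <= t -> 0 < r -> 0 < L t r.
Proof.
move=> t0 r0; have [l0 lE] := hL t r t0 (ltW r0).
rewrite lt_def l0 andbT; apply/eqP => L0.
by move: lE r0; rewrite L0 Q0// => <-; rewrite ltxx.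
Qed.

(** By monotonicity, [L <= a + e] holds as soon as the position is at most [Q (a + e) t]. For a
    fixed label this is a condition on a continuous function of time and position, strict at the
    base point; the lower bound is symmetric. The argument also covers [r = 0], where the label map
    is not assumed differentiable. *)
Lemma label_continuous : continuous (fun x : R * R => L (pos_time x.1) `|x.2|).
Proof.
move=> [t r]; apply: near_continuous => e e0 /=.
have [l0 lE] := hL (pos_time t) `|r| (pos_time_ge0 t) (normr_ge0 r).
set a := L (pos_time t) `|r| in l0 lE *.
have cdiff b : continuous (fun x : R * R => Q b (pos_time x.1) - `|x.2|).
  move=> x; apply: (@continuousB _ _ _ (fun x : R * R => Q b (pos_time x.1))
    (fun x : R * R => `|x.2|)).
    apply: (@continuous_comp _ _ _ fst (fun t => Q b (pos_time t))); last exact: cQt.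
    exact: cvg_fst.
  apply: (@continuous_comp _ _ _ snd (fun r : R => `|r|)); first exact: cvg_snd.
  exact: norm_continuous.
have up : \forall x \near (t, r), L (pos_time x.1) `|x.2| <= a + e.
  have pos : 0 < Q (a + e) (pos_time t) - `|r|.
    rewrite subr_gt0 -[X in X < _]lE; apply: label_map_lt; [exact: pos_time_ge0|by []|lra].
  have H := continuous_near _ _ (cdiff (a + e) (t, r)) _ pos.
  near=> x.
  have h : `|Q (a + e) (pos_time t) - `|r| - (Q (a + e) (pos_time x.1) - `|x.2|)|
      <= Q (a + e) (pos_time t) - `|r| by near: x; exact: H.
  have [lx lxE] := hL (pos_time x.1) `|x.2| (pos_time_ge0 x.1) (normr_ge0 x.2).
  apply: (label_map_le _ _ (pos_time x.1)) => //; first exact: pos_time_ge0.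
    by rewrite addr_ge0// ltW.
  by rewrite lxE; move: h; rewrite ler_norml => /andP[]; lra.
have low : \forall x \near (t, r), a - e <= L (pos_time x.1) `|x.2|.
  (* Near the origin [a - e] may be negative and is then no label; the bound holds there because
     labels are nonnegative. *)
  have [ae|ae] := leP 0 (a - e); last first.
    near=> x; have [lx _] := hL (pos_time x.1) `|x.2| (pos_time_ge0 x.1) (normr_ge0 x.2).
    by lra.
  have pos : 0 < `|r| - Q (a - e) (pos_time t).
    rewrite subr_gt0 -[X in _ < X]lE; apply: label_map_lt; [exact: pos_time_ge0|by []|lra].
  have H := continuous_near _ _ (cdiff (a - e) (t, r)) _ pos.
  near=> x.
  have h : `|Q (a - e) (pos_time t) - `|r| - (Q (a - e) (pos_time x.1) - `|x.2|)|
      <= `|r| - Q (a - e) (pos_time t) by near: x; exact: H.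
  have [lx lxE] := hL (pos_time x.1) `|x.2| (pos_time_ge0 x.1) (normr_ge0 x.2).
  apply: (label_map_le _ _ (pos_time x.1)) => //; first exact: pos_time_ge0.
  by rewrite lxE; move: h; rewrite ler_norml => /andP[]; lra.
near=> x; rewrite ler_norml; apply/andP; split.
- have : L (pos_time x.1) `|x.2| <= a + e by near: x.
  by lra.
- have : a - e <= L (pos_time x.1) `|x.2| by near: x.
  by lra.
Unshelve. all: by end_near. Qed.

Lemma label_derive (t r : R) : 0 <= t -> 0 < r ->
  is_derive r 1 (fun r => L t `|r|) (Qa (L t r) t)^-1.
Proof.
move=> t0 r0; have [_ lE] := hL t r t0 (ltW r0); have l0 := label_gt0 t r t0 r0.
rewrite -{1}lE; apply: (@is_derive_inverse _ (Q ^~ t)).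
- have na : \forall x \near L t r, 0 < x by exact: lt_nbhsr.
  near=> x; have x0 : 0 < x by near: x.
  by rewrite ger0_norm ?label_map_ge0 ?labelK// ltW.
- by near=> x; exact: cQa.
- exact: dQ.
- by rewrite gt_eqF// Qa0.
Unshelve. all: by end_near. Qed.

Section Transport.
Variables (P Pa Pt Qt A : R -> R -> R).
Hypothesis cP : continuous (fun x : R * R => P x.2 (pos_time x.1)).
Hypothesis cA : continuous (fun x : R * R => A x.2 (pos_time x.1)).
Hypothesis dP : forall a t : R, 0 < a -> 0 <= t -> is_derive a 1 (P ^~ t) (Pa a t).
Hypothesis PA : forall a t, 0 < a -> 0 <= t -> Pa a t / Qa a t = A a t / Q a t.
Hypothesis dPt : forall a t : R, 0 <= a -> 0 <= t -> is_derive t 1 (P a) (Pt a t).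
Hypothesis dQt : forall a t : R, 0 <= a -> 0 <= t -> is_derive t 1 (Q a) (Qt a t).

Definition eulerian (g : R -> R -> R) (t r : R) := g (L (pos_time t) `|r|) (pos_time t).

Lemma eulerian_continuous (g : R -> R -> R) :
  continuous (fun x : R * R => g x.2 (pos_time x.1)) ->
  continuous (fun x : R * R => eulerian g x.1 x.2).
Proof.
move=> cg x.
apply: (@continuous_comp _ _ _ (fun x : R * R => (x.1, L (pos_time x.1) `|x.2|))
  (fun x : R * R => g x.2 (pos_time x.1))); last exact: cg.
by apply: (@continuous_pair _ _ _ fst (fun x : R * R => L (pos_time x.1) `|x.2|));
  [exact: cvg_fst|exact: label_continuous].
Qed.

Lemma eulerianE g t r : 0 <= t -> 0 <= r -> eulerian g t r = g (L t r) t.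
Proof. by move=> t0 r0; rewrite /eulerian pos_time_id// ger0_norm. Qed.

Lemma eulerian_dr (t r : R) : 0 <= t -> 0 < r ->
  is_derive r 1 (eulerian P t) (eulerian A t r / r).
Proof.
move=> t0 r0; have [_ lE] := hL t r t0 (ltW r0); have l0 := label_gt0 t r t0 r0.
have -> : eulerian A t r / r = Pa (L t r) t * (Qa (L t r) t)^-1.
  by rewrite PA// lE eulerianE// ltW.
rewrite /eulerian pos_time_id//.
apply: (der_comp (P ^~ t) (fun r => L t `|r|)); last exact: label_derive.
by rewrite ger0_norm ?(ltW r0)//; exact: dP.
Qed.

(** The Lagrangian derivative equals the Eulerian one plus velocity times [r]-derivative. Solving
    this for the Eulerian one along the characteristic through [(t, r)] avoids differentiating the
    label [L] in time. *)
Lemma eulerian_dt (t r : R) : 0 <= t -> 0 < r ->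
  is_half_derive (eulerian P ^~ r) t
    (Pt (L t r) t - eulerian A t r / r * Qt (L t r) t).
Proof.
move=> t0 r0; have [_ lE] := hL t r t0 (ltW r0); have l0 := label_gt0 t r t0 r0.
have cAr : continuous_at (t, r) (fun x : R * R => eulerian A x.1 x.2 / x.2).
  apply: (@continuousM _ _ (fun x : R * R => eulerian A x.1 x.2)
    (fun x : R * R => x.2^-1)); first exact: eulerian_continuous.
  by apply: continuousV => /=; [rewrite gt_eqF|exact: cvg_snd].
have nA (e : R) : 0 < e -> \forall x \near (t, r), 0 <= x.1 ->
    `|eulerian A t r / r - eulerian A x.1 x.2 / x.2| <= e.
  by move=> e0; have := continuous_near _ _ cAr _ e0 => h; near=> x => _; near: x; exact: h.
have H := half_chain (eulerian P) (fun t r => eulerian A t r / r) (Q (L t r)) t r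
  (Qt (L t r) t) t0 r0 lE (is_derive_half _ _ _ (dQt _ _ (ltW l0) t0)) eulerian_dr nA.
have H2 := is_derive_half _ _ _ (dPt _ _ (ltW l0) t0).
have H3 : half_quotient (P (L t r)) t h - h^-1 *
    (eulerian P (t + h) (Q (L t r) (t + h)) - eulerian P (t + h) r)
    @[h --> half_nbhs t] --> Pt (L t r) t - eulerian A t r / r * Qt (L t r) t.
  exact: cvgB H2 H.
rewrite /is_half_derive; apply: cvg_trans H3; apply: near_eq_cvg.
rewrite /half_nbhs near_withinE; near=> h => /= th.
have h1 : eulerian P (t + h) (Q (L t r) (t + h)) = P (L t r) (t + h).
  by rewrite eulerianE ?label_map_ge0 ?labelK// ltW.
have h2 : eulerian P t r = P (L t r) t by rewrite eulerianE// ltW.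
rewrite /half_quotient h1 h2.
rewrite -[h^-1 *: _]/(h^-1 * _) -[h^-1 *: (_ - P _ _)]/(h^-1 * _).
ring.
Unshelve. all: by end_near. Qed.

End Transport.
End LabelMap.

(** * Construction and decay of the Eulerian profiles *)

Section Profiles.
Context {R : realType}.
Variables (D : R) (F0 F1 G0 G1 : R -> R) (B1 c : R).
Hypothesis D1 : 1 <= D.
Hypothesis dF0 : forall a : R, 0 < a -> is_derive a 1 F0 (F1 a).
Hypothesis dG0 : forall a : R, 0 < a -> is_derive a 1 G0 (G1 a).
Hypothesis cF0 : continuous (fun a : R => F0 `|a|).
Hypothesis cG0 : continuous (fun a : R => G0 `|a|).
Hypothesis cF1 : continuous (fun a : R => `|a| * F1 `|a|).
Hypothesis cG1 : continuous (fun a : R => `|a| * G1 `|a|).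
Hypothesis B10 : 0 <= B1.
Hypothesis bF : forall a, 0 <= a -> `|F0 a| <= B1 /\ `|a * F1 a| <= B1.
Hypothesis bG : forall a, 0 <= a -> `|G0 a| <= B1 /\ `|a * G1 a| <= B1.
Hypothesis baF : forall a, 0 <= a -> `|a * F0 a| <= B1 /\ `|a * G0 a| <= B1.
Hypothesis c0 : 0 < c.
Hypothesis mc : forall a, 0 <= a -> c <= 1 - D * G0 a.
Hypothesis nc : forall a, 0 <= a -> c <= 1 - D * G0 a - a * G1 a.

Let D0 : 0 < D. Proof. by have := D1; lra. Qed.
Let D_neq0 : D != 0. Proof. by rewrite gt_eqF. Qed.
Let m := mass D G0.
Let n := dens D G0 G1.
Let m_gt0 (a : R) : 0 < m a. Proof. exact: lt_le_trans c0 (mc _ (normr_ge0 a)). Qed.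
Let n_gt0 (a : R) : 0 < n a. Proof. exact: lt_le_trans c0 (nc _ (normr_ge0 a)). Qed.
Let m_neq0 (a : R) : m a != 0. Proof. by rewrite gt_eqF. Qed.
Let n_neq0 (a : R) : n a != 0. Proof. by rewrite gt_eqF. Qed.

Let dm (a : R) : 0 < a -> is_derive a 1 m (- (D * G1 a)).
Proof.
move=> a0; have na : \forall x \near a, 0 < x by exact: lt_nbhsr.
have d1 := dG0 a a0.
apply: (@near_eq_is_derive _ _ _ (fun x => 1 - D * G0 x)).
  by near=> x; rewrite /m /mass (gtr0_norm (x := x))//; near: x.
by der; ring.
Unshelve. all: by end_near. Qed.

Let cm : continuous m.
Proof.
apply: continuous_sub; first exact: continuous_const.
by apply: continuous_mul; [exact: continuous_const|exact: cG0].
Qed.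

Let comp_snd (g : R -> R) : continuous g -> continuous (fun x : R * R => g x.2).
Proof.
by move=> cg x; apply: (@continuous_comp _ _ _ snd g); [exact: cvg_snd|exact: cg].
Qed.

Let sq_bound (x k E : R) : 0 <= k -> 0 <= E -> x ^+ 2 <= k * E ^+ 2 -> `|x| <= (1 + k) * E.
Proof.
move=> k0 E0 h; rewrite -ler_sqr ?nnegrE//; last by rewrite mulr_ge0//; lra.
rewrite real_normK ?num_real//; apply: (le_trans h).
by rewrite exprMn ler_wpM2r ?sqr_ge0//; have := sqr_ge0 k; lra.
Qed.

(* [A] and [B] are [r F_r] and [r G_r]. *)
Lemma profiles : exists (mu C : R) (F G A B Q P S : R -> R -> R),
  [/\ 0 < mu < 1,
  [/\ continuous (fun x : R * R => F x.1 x.2), continuous (fun x : R * R => G x.1 x.2),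
    continuous (fun x : R * R => A x.1 x.2) & continuous (fun x : R * R => B x.1 x.2)],
  [/\ (forall t, 0 <= t -> A t 0 = 0 /\ B t 0 = 0),
    (forall r, 0 <= r -> F 0 r = F0 r /\ G 0 r = G0 r),
    (forall t r : R, 0 <= t -> 0 < r -> is_derive r 1 (F t) (A t r / r) /\
       is_derive r 1 (G t) (B t r / r)) &
    (forall t r : R, 0 <= t -> 0 < r ->
      is_half_derive (F ^~ r) t (- F t r ^+ 2 - (mu + mu^-1) * F t r - G t r - F t r * A t r) /\
      is_half_derive (G ^~ r) t (F t r * (1 - D * G t r) - F t r * B t r))],
  (forall t r, 0 <= t -> 0 <= r ->
    [/\ `|r * F t r| <= C * expR (- (mu * t)), `|r * G t r| <= C * expR (- (mu * t)),
      `|F t r + A t r| <= C * expR (- (mu * t)) &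
      `|G t r + B t r| <= C * expR (- (mu * t))]) &
  [/\ (forall a : R, 0 < a -> [/\ Q a 0 = a, P a 0 = F0 a & S a 0 = G0 a]),
    (forall a t : R, 0 < a -> 0 <= t -> [/\ 0 < Q a t, F t (Q a t) = P a t &
       G t (Q a t) = S a t]),
    (forall t r, 0 <= t -> 0 < r -> exists2 a, 0 < a & Q a t = r) &
    (forall a t : R, 0 < a -> 0 <= t -> [/\ is_derive t 1 (Q a) (Q a t * P a t),
       is_derive t 1 (P a) (- P a t ^+ 2 - (mu + mu^-1) * P a t - S a t) &
       is_derive t 1 (S a) (P a t * (1 - D * S a t))])]].
Proof.
have [mu [b [C [y [f [eta [zeta [/andP[mu0 mu1] b0 C0 [yfI dy df SX [cont da dec1 dec2]]]]]]]]]] :=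
  lagrangian D F0 F1 G0 G1 B1 c D1 dF0 dG0 cF0 cG0 cF1 cG1 B10 bF bG c0 mc nc.
pose Z a t := 1 + D * y a t.
pose X a t := 1 + D * (y a t + eta a t).
have Zb a t : 0 <= t -> b <= Z a t by move=> t0; have [] := SX a t t0.
have Xb a t : 0 <= t -> b <= X a t by move=> t0; have [] := SX a t t0.
have Zp a t : 0 <= t -> 0 < Z a t by move=> t0; exact: lt_le_trans (Zb a t t0).
have Xp a t : 0 <= t -> 0 < X a t by move=> t0; exact: lt_le_trans (Xb a t t0).
have Zn a t : 0 <= t -> Z a t != 0 by move=> t0; rewrite gt_eqF// Zp.
have Xn a t : 0 <= t -> X a t != 0 by move=> t0; rewrite gt_eqF// Xp.
(* The integral of [dQ/dt = Q * P] starting from [a]: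
   [Q = a * (m * (1 + D * y)) `^ D^-1], since [P = f / (1 + D * y)]. *)
pose s a t := expR (ln (m a * Z a t) / D).
pose Q a t := a * s a t.
(* This is conservation of mass: since [s ^ D = m * Z], it amounts to
   [Q ^ (D - 1) * Qa = a ^ (D - 1) * n * X], with density [n] at time [0] and [1 / X] at time
   [t]. *)
pose Qa a t := s a t * (n a / m a) * (X a t / Z a t).
pose P a t := f a t / Z a t.
pose S a t := y a t / Z a t.
(* From [r F_r = Q * (P_a / Q_a)] and [label_rate / Qa = D * Z / (Q * X)]. The singular factor
   [1 / a] cancels, so the formula makes sense and is continuous at [a = 0]. *)
pose A a t := D / X a t * (zeta a t - D * P a t * eta a t).
pose B a t := D * eta a t / (Z a t * X a t).
have [cy cf ce cz] := cont.
have cZ : continuous (fun x : R * R => Z x.2 (pos_time x.1)).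
  apply: continuous_add; first exact: continuous_const.
  by apply: continuous_mul; [exact: continuous_const|exact: cy].
have cX : continuous (fun x : R * R => X x.2 (pos_time x.1)).
  apply: continuous_add; first exact: continuous_const.
  apply: continuous_mul; first exact: continuous_const.
  by apply: continuous_add; [exact: cy|exact: ce].
have Zn' (x : R * R) : Z x.2 (pos_time x.1) != 0 by apply: Zn; exact: pos_time_ge0.
have Xn' (x : R * R) : X x.2 (pos_time x.1) != 0 by apply: Xn; exact: pos_time_ge0.
have cP : continuous (fun x : R * R => P x.2 (pos_time x.1)).
  by apply: continuous_mul; [exact: cf|exact: continuous_inv].
have cS : continuous (fun x : R * R => S x.2 (pos_time x.1)).
  by apply: continuous_mul; [exact: cy|exact: continuous_inv].
have cA : continuous (fun x : R * R => A x.2 (pos_time x.1)).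
  apply: continuous_mul.
    by apply: continuous_mul; [exact: continuous_const|exact: continuous_inv].
  apply: continuous_sub; first exact: cz.
  apply: continuous_mul; last exact: ce.
  by apply: continuous_mul; [exact: continuous_const|exact: cP].
have cB : continuous (fun x : R * R => B x.2 (pos_time x.1)).
  apply: continuous_mul; first by apply: continuous_mul; [exact: continuous_const|exact: ce].
  apply: continuous_inv; first by move=> x; rewrite mulf_neq0.
  exact: continuous_mul.
have cln : continuous (fun x : R * R => ln (m x.2 * Z x.2 (pos_time x.1))).
  move=> x; apply: (@continuous_comp _ _ _ (fun x : R * R => m x.2 * Z x.2 (pos_time x.1)) (@ln R)).
    by apply: continuous_mul; [exact: comp_snd|exact: cZ].
  by apply: continuous_ln; rewrite mulr_gt0// Zp// pos_time_ge0.
have cs : continuous (fun x : R * R => s x.2 (pos_time x.1)).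
  move=> x; apply: (@continuous_comp _ _ _
    (fun x : R * R => ln (m x.2 * Z x.2 (pos_time x.1)) / D) (@expR R)).
    by apply: (continuous_mul _ _ cln); exact: continuous_const.
  exact: continuous_expR.
have cQ : continuous (fun x : R * R => Q x.2 (pos_time x.1)).
  by apply: continuous_mul; [move=> x; exact: cvg_snd|exact: cs].
have sp a t : 0 < s a t by exact: expR_gt0.
have sn a t : s a t != 0 by rewrite gt_eqF.
pose k := expR (ln (c * b) / D).
have k0 : 0 < k by exact: expR_gt0.
have ks a t : 0 <= t -> k <= s a t.
  move=> t0; rewrite ler_expR ler_wpM2r ?invr_ge0 ?(ltW D0)//.
  by rewrite ler_ln ?posrE ?mulr_gt0// ?Zp// ler_pM ?(ltW c0) ?(ltW b0)// ?Zb// mc.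
have Q0 t : 0 <= t -> Q 0 t = 0 by rewrite /Q mul0r.
have kQ a t : 0 <= a -> 0 <= t -> k * a <= Q a t.
  by move=> a0 t0; rewrite /Q mulrC ler_wpM2l// ks.
have Qa0 a t : 0 < a -> 0 <= t -> 0 < Qa a t.
  by move=> a0 t0; rewrite /Qa !mulr_gt0// ?invr_gt0 ?Xp ?Zp.
have dQ (a t : R) : 0 < a -> 0 <= t -> is_derive a 1 (Q ^~ t) (Qa a t).
  move=> a0 t0; have [d1 d2] := da a a0 t t0; have d3 := dm a a0.
  have mZ : 0 < m a * Z a t by rewrite mulr_gt0// Zp.
  have dmZ : is_derive a 1 (fun a => m a * Z a t)
     (m a * (D * (label_rate D G0 G1 a * eta a t)) - D * G1 a * Z a t).
    by rewrite /Z; der; ring.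
  have dl := der_ln (fun a => m a * Z a t) a _ mZ dmZ.
  rewrite /Q /s; der; rewrite -/(s a t) /Qa.
  have Zn0 := Zn a t t0; have an : a != 0 by rewrite gt_eqF.
  have nE : n a = m a - a * G1 a by rewrite /n /dens /m /mass !gtr0_norm.
  rewrite /label_rate -/m -/n nE /X (_ : y a t = (Z a t - 1) / D); last by rewrite /Z; field.
  by field; rewrite Zn0 an m_neq0 D_neq0.
have dP (a t : R) : 0 < a -> 0 <= t -> is_derive a 1 (P ^~ t)
   (label_rate D G0 G1 a * (zeta a t - D * P a t * eta a t) / Z a t).
  move=> a0 t0; have [d1 d2] := da a a0 t t0.
  have dZ : is_derive a 1 (Z ^~ t) (D * (label_rate D G0 G1 a * eta a t)).
    by rewrite /Z; der; ring.
  have dZi := derV (Z ^~ t) a _ (Zn a t t0) dZ.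
  by rewrite /P; der; field; exact: Zn.
have dS (a t : R) : 0 < a -> 0 <= t -> is_derive a 1 (S ^~ t)
   (label_rate D G0 G1 a * eta a t / Z a t ^+ 2).
  move=> a0 t0; have [d1 d2] := da a a0 t t0.
  have dZ : is_derive a 1 (Z ^~ t) (D * (label_rate D G0 G1 a * eta a t)).
    by rewrite /Z; der; ring.
  have dZi := derV (Z ^~ t) a _ (Zn a t t0) dZ.
  rewrite /S; der; have Zn0 := Zn a t t0.
  rewrite (_ : y a t = (Z a t - 1) / D); last by rewrite /Z; field.
  by field; rewrite Zn0 D_neq0.
have PA a t : 0 < a -> 0 <= t ->
   label_rate D G0 G1 a * (zeta a t - D * P a t * eta a t) / Z a t / Qa a t = A a t / Q a t.
  move=> a0 t0; rewrite /label_rate -/m -/n /Qa /A /Q; field.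
  by rewrite Zn// Xn// sn m_neq0 n_neq0 gt_eqF.
have SB a t : 0 < a -> 0 <= t ->
   label_rate D G0 G1 a * eta a t / Z a t ^+ 2 / Qa a t = B a t / Q a t.
  move=> a0 t0; rewrite /label_rate -/m -/n /Qa /B /Q; field.
  by rewrite Zn// Xn// sn m_neq0 n_neq0 gt_eqF.
have dZt (a t : R) : 0 <= t -> is_derive t 1 (Z a) (D * f a t).
  by move=> t0; have d1 := dy a t t0; rewrite /Z; der; ring.
have dQt (a t : R) : 0 <= a -> 0 <= t -> is_derive t 1 (Q a) (Q a t * P a t).
  move=> a0 t0; have d1 := dZt a t t0.
  have mZ : 0 < m a * Z a t by rewrite mulr_gt0// Zp.
  have dmZ : is_derive t 1 (fun t => m a * Z a t) (m a * (D * f a t)) by der; ring.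
  have dl := der_ln (fun t => m a * Z a t) t _ mZ dmZ.
  rewrite /Q /s; der; rewrite -/(s a t) /P.
  by field; rewrite Zn// m_neq0 D_neq0.
have dPt (a t : R) : 0 <= a -> 0 <= t ->
    is_derive t 1 (P a) (- P a t ^+ 2 - (mu + mu^-1) * P a t - S a t).
  move=> a0 t0; have d1 := dy a t t0; have d2 := df a t t0.
  have dZi := derV (Z a) t _ (Zn a t t0) (dZt a t t0).
  rewrite /P; der; rewrite -/(Z a t) /S; field.
  by rewrite Zn// gt_eqF.
have dSt (a t : R) : 0 <= a -> 0 <= t -> is_derive t 1 (S a) (P a t * (1 - D * S a t)).
  move=> a0 t0; have d1 := dy a t t0.
  have dZi := derV (Z a) t _ (Zn a t t0) (dZt a t t0).
  by rewrite /S; der; rewrite /P; field; rewrite Zn.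
have [L hL] := label_exists Q k k0 Q0 cQ kQ.
have lc g := eulerian_continuous Q Qa dQ Qa0 cQ L hL g.
have lK := labelK Q Qa k k0 dQ Qa0 cQ kQ L hL.
have l0 := label0 Q Qa k k0 Q0 dQ Qa0 cQ kQ L hL.
have lgt := label_gt0 Q Q0 L hL.
have Qge := label_map_ge0 Q k k0 kQ.
(* At the label [0] the initial values of [eta] and [zeta] vanish, and the decay estimate, being
   homogeneous in them, forces both to stay [0]. This gives [r F_r = r G_r = 0] at the origin. *)
have init0 a t : a = 0 -> 0 <= t -> eta a t = 0 /\ zeta a t = 0.
  move=> -> t0; have := dec2 0 t t0.
  rewrite /eta_init /zeta_init normr0 !(mul0r, mulr0, addr0) expr0n/= addr0 mulr0 mul0r.
  have := sqr_ge0 (eta 0 t); have := sqr_ge0 (zeta 0 t) => z0 e0 ez.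
  by split; apply/eqP; rewrite -sqrf_eq0; apply/eqP; lra.
have Z0 a : Z a 0 = (m a)^-1.
  have [yI _] := yfI a; have := m_neq0 a; rewrite /Z yI /y_init -/m /m /mass => h.
  by field.
have Qi a : Q a 0 = a.
  by rewrite /Q /s Z0 mulfV// ln1 mul0r expR0 mulr1.
have Pi a : P a 0 = F0 `|a|.
  by have [_ fI] := yfI a; rewrite /P Z0 fI /f_init -/m invrK divfK.
have Si a : S a 0 = G0 `|a|.
  by have [yI _] := yfI a; rewrite /S Z0 yI /y_init -/m invrK divfK.
pose K := C * (2 * (B1 / c) ^+ 2).
have K0 : 0 <= K by rewrite /K mulr_ge0// mulr_ge0// sqr_ge0.
have expE t : expR (- (2 * mu * t)) = expR (- (mu * t)) ^+ 2.
  by rewrite expr2 -expRD; congr expR; ring.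
have mV a : `|(m a)^-1| <= c^-1.
  by rewrite normfV gtr0_norm// lef_pV2 ?posrE//; exact: mc.
have Bc0 : 0 <= B1 / c by rewrite divr_ge0// ltW.
have sqB (x M : R) : `|x| <= M -> x ^+ 2 <= M ^+ 2.
  move=> xM; rewrite -(real_normK (num_real x)) ler_sqr ?nnegrE//.
  exact: le_trans xM.
have yfE a t : 0 <= t -> `|y a t| <= (1 + K) * expR (- (mu * t)) /\
    `|f a t| <= (1 + K) * expR (- (mu * t)).
  move=> t0; have := dec1 a t t0; rewrite expE.
  have [g1 _] := bG _ (normr_ge0 a); have [f1 _] := bF _ (normr_ge0 a).
  have yi : y_init D G0 a ^+ 2 <= (B1 / c) ^+ 2.
    by apply: sqB; rewrite /y_init normrM ler_pM//; exact: mV.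
  have fi : f_init D F0 G0 a ^+ 2 <= (B1 / c) ^+ 2.
    by apply: sqB; rewrite /f_init normrM ler_pM//; exact: mV.
  have E0 := sqr_ge0 (expR (- (mu * t))).
  have h : C * (y_init D G0 a ^+ 2 + f_init D F0 G0 a ^+ 2) <= K.
    by rewrite /K ler_wpM2l//; lra.
  have h2 : C * (y_init D G0 a ^+ 2 + f_init D F0 G0 a ^+ 2) * expR (- (mu * t)) ^+ 2
    <= K * expR (- (mu * t)) ^+ 2 by rewrite ler_wpM2r.
  have := sqr_ge0 (y a t); have := sqr_ge0 (f a t) => s1 s2 s3.
  by split; apply: sq_bound; rewrite ?expR_ge0//; lra.
(* The decay estimate is homogeneous in the initial values, so it may be multiplied by [a ^+ 2].
   Boundedness of [a * F0] and [a * G0] then gives decay of [a * y] and [a * f], hence of [r F] and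
   [r G], since [Q / a = s] is bounded. *)
have ayfE a t : 0 <= a -> 0 <= t -> `|a * y a t| <= (1 + K) * expR (- (mu * t)) /\
    `|a * f a t| <= (1 + K) * expR (- (mu * t)).
  move=> a0 t0; have := dec1 a t t0; rewrite expE => d1.
  have [f1 g1] := baF a a0.
  have yi : (a * y_init D G0 a) ^+ 2 <= (B1 / c) ^+ 2.
    apply: sqB; rewrite /y_init (ger0_norm a0) mulrA normrM ler_pM//.
  have fi : (a * f_init D F0 G0 a) ^+ 2 <= (B1 / c) ^+ 2.
    apply: sqB; rewrite /f_init (ger0_norm a0) mulrA normrM ler_pM//.
  have E0 := sqr_ge0 (expR (- (mu * t))).
  have h : C * ((a * y_init D G0 a) ^+ 2 + (a * f_init D F0 G0 a) ^+ 2) <= K.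
    by rewrite /K ler_wpM2l//; lra.
  have h2 : C * ((a * y_init D G0 a) ^+ 2 + (a * f_init D F0 G0 a) ^+ 2)
    * expR (- (mu * t)) ^+ 2 <= K * expR (- (mu * t)) ^+ 2 by rewrite ler_wpM2r.
  have h3 : (a * y a t) ^+ 2 + (a * f a t) ^+ 2 <=
     C * ((a * y_init D G0 a) ^+ 2 + (a * f_init D F0 G0 a) ^+ 2) * expR (- (mu * t)) ^+ 2.
    rewrite (_ : _ + _ = a ^+ 2 * (y a t ^+ 2 + f a t ^+ 2)); last by ring.
    apply: (le_trans (ler_wpM2l (sqr_ge0 a) d1)).
    by rewrite le_eqVlt; apply/orP; left; apply/eqP; ring.
  have := sqr_ge0 (a * y a t); have := sqr_ge0 (a * f a t) => s1 s2.
  by split; apply: sq_bound; rewrite ?expR_ge0//; lra.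
have [Bi hBi] : exists Bi, forall a, `|eta_init D G0 G1 a| <= Bi /\
    `|zeta_init D F0 F1 G0 G1 a| <= Bi.
  eexists => a; have [_ _ h1 h2] := init_bounds D F0 F1 G0 G1 B1 c D1 B10 bF bG c0 mc nc a.
  by split; [exact: h1|exact: h2].
pose K2 := C * (2 * Bi ^+ 2).
have K20 : 0 <= K2 by rewrite /K2 mulr_ge0// mulr_ge0// sqr_ge0.
have ezE a t : 0 <= t -> `|eta a t| <= (1 + K2) * expR (- (mu * t)) /\
    `|zeta a t| <= (1 + K2) * expR (- (mu * t)).
  move=> t0; have := dec2 a t t0; rewrite expE; have [/sqB e1 /sqB z1] := hBi a.
  have E0 := sqr_ge0 (expR (- (mu * t))).
  have h : C * (eta_init D G0 G1 a ^+ 2 + zeta_init D F0 F1 G0 G1 a ^+ 2) <= K2.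
    by rewrite /K2 ler_wpM2l//; lra.
  have h2 : C * (eta_init D G0 G1 a ^+ 2 + zeta_init D F0 F1 G0 G1 a ^+ 2)
    * expR (- (mu * t)) ^+ 2 <= K2 * expR (- (mu * t)) ^+ 2 by rewrite ler_wpM2r.
  have := sqr_ge0 (eta a t); have := sqr_ge0 (zeta a t) => s1 s2 s3.
  by split; apply: sq_bound; rewrite ?expR_ge0//; lra.
have E1 t : 0 <= t -> expR (- (mu * t)) <= 1.
  by move=> t0; rewrite -expR0 ler_expR oppr_le0 mulr_ge0// ltW.
pose sh := expR (ln ((1 + D * B1) * (1 + D * (1 + K))) / D).
have sh0 : 0 < sh by exact: expR_gt0.
have ssh a t : 0 <= t -> s a t <= sh.
  move=> t0; rewrite ler_expR ler_wpM2r ?invr_ge0 ?(ltW D0)//.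
  have h1 : m a <= 1 + D * B1.
    have [g1 _] := bG _ (normr_ge0 a); rewrite /m /mass lerD2l -mulrN ler_wpM2l ?(ltW D0)//.
    by apply: (le_trans (ler_norm _)); rewrite normrN.
  have h2 : Z a t <= 1 + D * (1 + K).
    rewrite /Z lerD2l ler_wpM2l ?(ltW D0)//; apply: (le_trans (ler_norm _)).
    by have [h _] := yfE a t t0; apply: (le_trans h); rewrite ler_piMr ?E1//; lra.
  have h3 : m a * Z a t <= (1 + D * B1) * (1 + D * (1 + K)).
    by rewrite ler_pM// ltW// Zp.
  have h4 : 0 < m a * Z a t by rewrite mulr_gt0// Zp.
  by rewrite ler_ln ?posrE//; exact: lt_le_trans h3.
have ZV a t : 0 <= t -> `|(Z a t)^-1| <= b^-1.
  by move=> t0; rewrite normfV gtr0_norm ?Zp// lef_pV2 ?posrE ?Zp// Zb.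
have XV a t : 0 <= t -> `|(X a t)^-1| <= b^-1.
  by move=> t0; rewrite normfV gtr0_norm ?Xp// lef_pV2 ?posrE ?Xp// Xb.
pose c1 := sh * ((1 + K) / b).
pose c2 := (1 + K) / b.
pose c3 := D / b * ((1 + K2) + D * c2 * (1 + K2)).
pose c4 := D * (1 + K2) * (b^-1 * b^-1).
have c20 : 0 <= c2 by rewrite /c2 divr_ge0 ?(ltW b0)//; lra.
have c10 : 0 <= c1 by rewrite /c1 mulr_ge0// ltW.
have K21 : 0 <= 1 + K2 by lra.
have c30 : 0 <= c3.
  rewrite /c3; apply: mulr_ge0; first by rewrite divr_ge0 ?(ltW D0) ?(ltW b0).
  by rewrite addr_ge0// mulr_ge0// mulr_ge0// ltW.
have bV0 : 0 <= b^-1 by rewrite invr_ge0 ltW.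
have c40 : 0 <= c4 by rewrite /c4 !mulr_ge0// ltW.
have divE a t g : 0 <= t -> `|g| <= (1 + K) * expR (- (mu * t)) ->
    `|g / Z a t| <= c2 * expR (- (mu * t)).
  move=> t0 h.
  rewrite normrM (_ : c2 * _ = (1 + K) * expR (- (mu * t)) * b^-1); last by rewrite /c2; ring.
  by rewrite ler_pM// ZV.
have PE a t : 0 <= t -> `|P a t| <= c2 * expR (- (mu * t)).
  by move=> t0; apply: divE => //; have [] := yfE a t t0.
have SE a t : 0 <= t -> `|S a t| <= c2 * expR (- (mu * t)).
  by move=> t0; apply: divE => //; have [] := yfE a t t0.
have QdivE a t g : 0 <= t -> `|a * g| <= (1 + K) * expR (- (mu * t)) ->
    `|Q a t * (g / Z a t)| <= c1 * expR (- (mu * t)).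
  move=> t0 h.
  rewrite /Q (_ : a * s a t * _ = s a t * (a * g / Z a t)); last by ring.
  rewrite normrM (_ : c1 * _ = sh * (c2 * expR (- (mu * t)))); last by rewrite mulrA.
  by apply: ler_pM => //; [rewrite gtr0_norm// ssh|exact: divE].
have QPE a t : 0 <= a -> 0 <= t -> `|Q a t * P a t| <= c1 * expR (- (mu * t)).
  by move=> a0 t0; apply: QdivE => //; have [] := ayfE a t a0 t0.
have QSE a t : 0 <= a -> 0 <= t -> `|Q a t * S a t| <= c1 * expR (- (mu * t)).
  by move=> a0 t0; apply: QdivE => //; have [] := ayfE a t a0 t0.
have AE a t : 0 <= t -> `|A a t| <= c3 * expR (- (mu * t)).
  move=> t0; have [h1 h2] := ezE a t t0.
  rewrite /A normrM.
  rewrite (_ : c3 * _ = D / b * (((1 + K2) + D * c2 * (1 + K2)) * expR (- (mu * t)))); last first.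
    by rewrite /c3; ring.
  apply: ler_pM => //.
    by rewrite normrM (gtr0_norm D0) ler_wpM2l ?(ltW D0)// XV.
  rewrite mulrDl; apply: (le_trans (ler_normB _ _)); rewrite lerD//.
  rewrite -(mulrA (D * c2)) normrM ler_pM// normrM (gtr0_norm D0) ler_wpM2l ?(ltW D0)//.
  by apply: (le_trans (PE a t t0)); rewrite ler_piMr// E1.
have BE a t : 0 <= t -> `|B a t| <= c4 * expR (- (mu * t)).
  move=> t0; have [h1 h2] := ezE a t t0.
  rewrite /B invfM normrM normrM (gtr0_norm D0).
  rewrite (_ : c4 * _ = D * ((1 + K2) * expR (- (mu * t))) * (b^-1 * b^-1)); last first.
    by rewrite /c4; ring.
  by rewrite ler_pM ?mulr_ge0 ?(ltW D0)// ?ler_wpM2l ?(ltW D0)// normrM ler_pM// ?ZV ?XV.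
exists mu, (c1 + c2 + c3 + c4), (eulerian L P), (eulerian L S), (eulerian L A),
  (eulerian L B), Q, P, S.
have eE g t r : 0 <= t -> 0 <= r -> eulerian L g t r = g (L t r) t := eulerianE L g t r.
split.
- by apply/andP.
- by split; apply: lc.
- split.
  + move=> t t0; rewrite !eE// l0//; have [e0 z0] := init0 0 t erefl t0.
    by rewrite /A /B e0 z0 !(mulr0, mul0r) subrr mulr0.
  + move=> r r0; rewrite !eE//.
    have -> : L 0 r = r by rewrite -{1}(Qi r) lK.
    by rewrite Pi Si ger0_norm.
  + move=> t r t0 r0; split.
      exact: (eulerian_dr Q Qa k k0 Q0 dQ Qa0 cQ kQ L hL P _ A dP PA).
    exact: (eulerian_dr Q Qa k k0 Q0 dQ Qa0 cQ kQ L hL S _ B dS SB).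
  + move=> t r t0 r0; have rn : r != 0 by rewrite gt_eqF.
    have [_ QL] := hL t r t0 (ltW r0).
    have h1 := eulerian_dt Q Qa k k0 Q0 dQ Qa0 cQ kQ L hL P _ _ _ A cA dP PA dPt dQt t r t0 r0.
    have h2 := eulerian_dt Q Qa k k0 Q0 dQ Qa0 cQ kQ L hL S _ _ _ B cB dS SB dSt dQt t r t0 r0.
    rewrite !eE ?(ltW r0)//; rewrite !eE ?(ltW r0)// in h1 h2.
    move: h1 h2; lazy beta; rewrite QL => h1 h2.
    by split; [apply: (is_half_derive_eq _ _ _ _ h1)|apply: (is_half_derive_eq _ _ _ _ h2)]; field;
      rewrite ?rn ?gt_eqF.
- move=> t r t0 r0; have [a0 QL] := hL t r t0 r0.
  rewrite !eE//; have E0 := expR_ge0 (- (mu * t)).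
  have e1 := mulr_ge0 c10 E0; have e2 := mulr_ge0 c20 E0.
  have e3 := mulr_ge0 c30 E0; have e4 := mulr_ge0 c40 E0.
  have p1 := QPE _ t a0 t0; have p2 := QSE _ t a0 t0; rewrite QL in p1 p2.
  have p3 := PE (L t r) t t0; have p4 := SE (L t r) t t0.
  have p5 := AE (L t r) t t0; have p6 := BE (L t r) t t0.
  split; try lra.
    by apply: (le_trans (ler_normD _ _)); lra.
  by apply: (le_trans (ler_normD _ _)); lra.
- split.
  + by move=> a a0; rewrite Qi Pi Si gtr0_norm.
  + move=> a t a0 t0; have Qp : 0 < Q a t by rewrite /Q mulr_gt0.
    by rewrite !eE ?(ltW Qp)// lK// ltW.
  + move=> t r t0 r0; exists (L t r); first exact: lgt.
    by have [] := hL t r t0 (ltW r0).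
  + move=> a t a0 t0; split; [exact: dQt (ltW a0) t0|exact: dPt (ltW a0) t0|
      exact: dSt (ltW a0) t0].
Qed.

End Profiles.

(** * Radial fields *)

Section Euclid.
Context {R : realType} {d : nat}.
Local Notation vec := 'rV[R]_d.
Implicit Types (x : vec) (j : 'I_d).

Lemma sum_sqr_ge0 x : 0 <= \sum_i x 0 i ^+ 2.
Proof. by apply: sumr_ge0 => i _; exact: sqr_ge0. Qed.

Lemma eucl_ge0 x : 0 <= eucl x. Proof. exact: sqrtr_ge0. Qed.

Lemma sqr_eucl x : eucl x ^+ 2 = \sum_i x 0 i ^+ 2.
Proof. by rewrite sqr_sqrtr// sum_sqr_ge0. Qed.

Lemma coord_le_eucl x j : `|x 0 j| <= eucl x.
Proof.
rewrite -ler_sqr ?nnegrE ?eucl_ge0// sqr_eucl real_normK ?num_real//.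
rewrite (bigD1 j)//= lerDl; apply: sumr_ge0 => i _; exact: sqr_ge0.
Qed.

Lemma norm_le_eucl x : `|x| <= eucl x.
Proof.
rewrite [leLHS]/Num.Def.normr/= mx_normrE (bigmax_le _ (eucl_ge0 x))// => -[i k] _ /=.
by rewrite ord1; exact: coord_le_eucl.
Qed.

Lemma eucl0 : eucl (0 : vec) = 0.
Proof. by rewrite /eucl big1 ?sqrtr0// => i _; rewrite mxE expr0n. Qed.

Lemma eucl_eq0 x : (eucl x == 0) = (x == 0).
Proof.
apply/eqP/eqP => [x0|->]; last exact: eucl0.
by apply/eqP; rewrite -normr_le0 -x0; exact: norm_le_eucl.
Qed.

Lemma eucl_gt0 x : x != 0 -> 0 < eucl x.
Proof. by move=> x0; rewrite lt_def eucl_ge0 eucl_eq0 x0. Qed.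

Lemma eucl_continuous : continuous (eucl : vec -> R).
Proof.
move=> x; apply: (@continuous_comp _ _ _ (fun x : vec => \sum_i x 0 i ^+ 2) Num.sqrt);
  last exact: sqrt_continuous.
apply: (@cvg_big R 'I_d +%R 0 predT (@add_continuous _) _ (nbhs x) _
  (fun i (x : vec) => x 0 i ^+ 2)) => i _.
by under eq_fun do rewrite expr2; apply: cvgM; exact: coord_continuous.
Qed.

Lemma sqr_eucl_line x j (h : R) :
  eucl (h *: delta_mx 0 j + x) ^+ 2 = eucl x ^+ 2 + 2 * h * x 0 j + h ^+ 2.
Proof.
rewrite !sqr_eucl (bigD1 j)//= [in RHS](bigD1 j)//= !mxE !eqxx/= mulr1.
rewrite (eq_bigr (fun i => x 0 i ^+ 2)); first by ring.
by move=> i ij; rewrite !mxE (negPf ij) andbF mulr0 add0r.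
Qed.

Lemma eucl_axis j (r : R) : eucl (r *: delta_mx 0 j : vec) = `|r|.
Proof.
have := sqr_eucl_line 0 j r; rewrite addr0 eucl0 expr0n/= mxE mulr0 !add0r.
by move=> h; rewrite -(ger0_norm (eucl_ge0 _)) -!sqrtr_sqr h.
Qed.

Lemma eucl_derive x j : x != 0 ->
  is_derive (0 : R) 1 (fun h => eucl (h *: delta_mx 0 j + x)) (x 0 j / eucl x).
Proof.
move=> x0; have r0 := eucl_gt0 x x0.
pose g (h : R) := eucl x ^+ 2 + 2 * h * x 0 j + h ^+ 2.
have -> : (fun h => eucl (h *: delta_mx 0 j + x)) = (fun h => Num.sqrt (g h)).
  by apply/funext => h; rewrite /g -sqr_eucl_line sqrtr_sqr ger0_norm ?eucl_ge0.
have dg : is_derive (0 : R) 1 g (2 * x 0 j) by rewrite /g; der; ring.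
have g0 : g 0 = eucl x ^+ 2 by rewrite /g; ring.
have gp : 0 < g 0 by rewrite g0 exprn_gt0.
apply: der_eq; first by apply: (der_comp Num.sqrt g) => //; exact: is_derive1_sqrt.
by rewrite g0 sqrtr_sqr (gtr0_norm r0); field; rewrite gt_eqF.
Qed.

Lemma is_derive_line (W : normedModType R) (f : vec -> W) x (v : vec) (l : W) :
  h^-1 *: (f (h *: v + x) - f x) @[h --> 0^'] --> l -> is_derive x v f l.
Proof.
move=> H; have df : derivable f x v by apply/cvg_ex; exists l.
by apply: DeriveDef => //; exact: cvg_lim H.
Qed.

(** The increment of [f(|x|) x] splits into the increment of [f], along [x], and a value of [f],
    along the axis. Formulated with limits, it also covers the origin, where the first part vanishes
    and continuity of [f] is enough. *)
Lemma radial_quotient (f : R -> R) x j (a b : R) :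
  (h^-1 * (f (eucl (h *: delta_mx 0 j + x)) - f (eucl x))) *: x @[h --> 0^'] --> a *: x ->
  f (eucl (h *: delta_mx 0 j + x)) @[h --> 0^'] --> b ->
  is_derive x (delta_mx 0 j) (radial f) (a *: x + b *: delta_mx 0 j).
Proof.
move=> H1 H2; apply: is_derive_line.
have H3 : (h^-1 * (f (eucl (h *: delta_mx 0 j + x)) - f (eucl x))) *: x +
  f (eucl (h *: delta_mx 0 j + x)) *: delta_mx 0 j
    @[h --> 0^'] --> a *: x + b *: delta_mx 0 j.
  by apply: cvgD => //; apply: cvgZr_tmp.
apply: cvg_trans H3; apply: near_eq_cvg; near=> h.
have hn : h != 0 by near: h; exact: nbhs_dnbhs_neq.
rewrite /radial; set a1 := f (eucl (_ + _)); set b1 := f (eucl x).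
have -> : a1 *: (h *: delta_mx 0 j + x) - b1 *: x =
    (a1 * h) *: delta_mx 0 j + (a1 - b1) *: x.
  by rewrite scalerDr scalerA scalerBl addrA.
by rewrite scalerDr !scalerA mulrCA mulVf// mulr1 addrC.
Unshelve. all: by end_near. Qed.

Lemma radial_derive (f : R -> R) (f' : R) x j : x != 0 ->
  is_derive (eucl x) 1 f f' ->
  is_derive x (delta_mx 0 j) (radial f)
    ((f' * (x 0 j / eucl x)) *: x + f (eucl x) *: delta_mx 0 j).
Proof.
move=> x0 df; have dE := eucl_derive x j x0.
have e0 : eucl (0 *: delta_mx 0 j + x) = eucl x by rewrite scale0r add0r.
have dfE : is_derive (0 : R) 1 (fun h => f (eucl (h *: delta_mx 0 j + x)))
    (f' * (x 0 j / eucl x)).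
  by apply: (der_comp f (fun h => eucl (h *: delta_mx 0 j + x))) => //; rewrite e0.
apply: radial_quotient.
- apply: cvgZr_tmp; have /is_derive_quotient := dfE.
  by under eq_fun do rewrite add0r e0.
- rewrite -e0; apply: cvg_within_filter; exact: der_continuous dfE.
Qed.

Lemma radial_derive0 (f : R -> R) j : f `|r| @[r --> (0 : R)] --> f 0 ->
  is_derive (0 : vec) (delta_mx 0 j) (radial f) (f 0 *: delta_mx 0 j).
Proof.
move=> cf; rewrite -[f 0 *: _]add0r -[X in X + _](scaler0 _ 0).
apply: radial_quotient.
  by under eq_fun do rewrite scaler0; rewrite scaler0; exact: cvg_cst.
by under eq_fun do rewrite addr0 eucl_axis; exact: cvg_within_filter.
Qed.

End Euclid.

Section RadialField.
Context {R : realType} {d : nat}.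
Local Notation vec := 'rV[R]_d.
Implicit Types (x : vec) (j : 'I_d).

Section Static.
Variables (f a : R -> R).
Hypothesis df : forall r : R, 0 < r -> is_derive r 1 f (a r / r).

(** Here [a r] stands for [r * f'(r)]. At the origin the first term disappears with the factor [x],
    so one formula holds everywhere. *)
Definition radial_partial (f a : R -> R) j x : vec :=
  (a (eucl x) * (x 0 j / eucl x ^+ 2)) *: x + f (eucl x) *: delta_mx 0 j.

(** Continuity at the origin is required only for [x = 0], because the formula is also applied on an
    axis, away from the origin, to an arbitrary solution whose profile at [0] is unknown. *)
Lemma is_derive_radial j x : (x = 0 -> f `|r| @[r --> (0 : R)] --> f 0) ->
  is_derive x (delta_mx 0 j) (radial f) (radial_partial f a j x).
Proof.
rewrite /radial_partial => cf; have [x0|x0] := eqVneq x 0.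
  by have := cf x0; rewrite x0 scaler0 add0r eucl0; exact: radial_derive0.
have r0 := eucl_gt0 x x0.
have -> : a (eucl x) * (x 0 j / eucl x ^+ 2) = a (eucl x) / eucl x * (x 0 j / eucl x).
  by field; rewrite gt_eqF.
by apply: radial_derive => //; exact: df.
Qed.

Lemma partial_radial j x : (x = 0 -> f `|r| @[r --> (0 : R)] --> f 0) ->
  partial j (radial f) x = radial_partial f a j x.
Proof. by move=> cf; have [_] := is_derive_radial j x cf. Qed.

Lemma div_radial x : (x = 0 -> f `|r| @[r --> (0 : R)] --> f 0) ->
  (x = 0 -> a 0 = 0) -> div (radial f) x = a (eucl x) + d%:R * f (eucl x).
Proof.
move=> cf a0; rewrite /div (eq_bigr (fun i => a (eucl x) / eucl x ^+ 2 * x 0 i ^+ 2 + f (eucl x))).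
  rewrite big_split/= -mulr_sumr -sqr_eucl big_const_ord iter_addr_0 mulr_natl.
  congr (_ + _); have [x0|x0] := eqVneq (eucl x) 0; last by field.
  by rewrite x0 a0 ?mul0r//; apply/eqP; rewrite -eucl_eq0 x0.
move=> i _; rewrite partial_radial// /radial_partial !mxE !eqxx mulr1; ring.
Qed.

Lemma advect_radial (g : R -> R) x : (x = 0 -> f `|r| @[r --> (0 : R)] --> f 0) ->
  advect (radial g) (radial f) x = (g (eucl x) * (a (eucl x) + f (eucl x))) *: x.
Proof.
move=> cf; rewrite /advect.
rewrite (eq_bigr (fun j => (g (eucl x) * a (eucl x) / eucl x ^+ 2 * x 0 j ^+ 2) *: x
  + (g (eucl x) * f (eucl x) * x 0 j) *: delta_mx 0 j)); last first.
  move=> j _; rewrite partial_radial// /radial_partial /radial mxE scalerDr !scalerA.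
  by congr (_ *: _ + _ *: _); ring.
rewrite big_split/= -scaler_suml -mulr_sumr -sqr_eucl.
have -> : \sum_j (g (eucl x) * f (eucl x) * x 0 j) *: delta_mx 0 j =
    (g (eucl x) * f (eucl x)) *: x.
  move: (g (eucl x) * f (eucl x)) => k; rewrite [in RHS](row_sum_delta x) scaler_sumr.
  by apply: eq_bigr => j _; rewrite scalerA.
have [->|x0] := eqVneq x 0; first by rewrite !scaler0 addr0.
rewrite -scalerDl; congr (_ *: _); have r0 := eucl_gt0 x x0.
by field; rewrite gt_eqF.
Qed.

End Static.

Section Dynamic.
Variables (F A T : R -> R -> R).
Hypothesis cF : continuous (fun x : R * R => F x.1 x.2).
Hypothesis cA : continuous (fun x : R * R => A x.1 x.2).
Hypothesis cT : continuous (fun x : R * R => T x.1 x.2).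
Hypothesis A0 : forall t, 0 <= t -> A t 0 = 0.
Hypothesis dF : forall t r : R, 0 <= t -> 0 < r -> is_derive r 1 (F t) (A t r / r).
Hypothesis hF : forall t r : R, 0 <= t -> 0 < r -> is_half_derive (F ^~ r) t (T t r).

Lemma profile_continuous0 (t : R) : F t `|r| @[r --> (0 : R)] --> F t 0.
Proof.
have H : {for (0 : R), continuous (fun r => F t `|r|)}.
  apply: (@continuous_comp _ _ _ (fun r : R => (t, `|r|)) (fun x : R * R => F x.1 x.2));
    last exact: cF.
  apply: (@continuous_pair _ _ _ (fun=> t) (fun r : R => `|r|)); first exact: cvg_cst.
  exact: norm_continuous.
by move: H; rewrite /prop_for /continuous_at normr0.
Qed.

Let pE j t x : 0 <= t -> partial j (radial (F t)) x = radial_partial (F t) (A t) j x.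
Proof.
move=> t0; exact: (partial_radial (F t) (A t) (fun r r0 => dF t r t0 r0)
  _ _ (fun=> profile_continuous0 t)).
Qed.

Lemma is_half_derive_radial t x : 0 <= t ->
  is_half_derive (fun t => radial (F t) x) t (radial (T t) x).
Proof.
move=> t0; rewrite /is_half_derive /radial; have [->|x0] := eqVneq x 0.
  rewrite scaler0 (_ : half_quotient _ t = fun=> 0); first exact: cvg_cst.
  by apply/funext => h; rewrite /half_quotient !scaler0 subrr scaler0.
have := hF t (eucl x) t0 (eucl_gt0 x x0) => H.
have H2 : half_quotient (F ^~ (eucl x)) t h *: x @[h --> half_nbhs t]
   --> T t (eucl x) *: x by exact: cvgZr_tmp.
rewrite (_ : half_quotient _ t = fun h => half_quotient (F ^~ (eucl x)) t h *: x)//.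
by apply/funext => h; rewrite /half_quotient -scalerBl scalerA.
Qed.

Let cE (U : R -> R -> R) : continuous (fun x : R * R => U x.1 x.2) ->
  continuous (fun p : R * vec => U p.1 (eucl p.2)).
Proof.
move=> cU p; apply: (@continuous_comp _ _ _ (fun p : R * vec => (p.1, eucl p.2))
  (fun x : R * R => U x.1 x.2)); last exact: cU.
apply: (@continuous_pair _ _ _ (fun p : R * vec => p.1) (fun p : R * vec => eucl p.2)).
  exact: cvg_fst.
apply: (@continuous_comp _ _ _ snd (eucl : vec -> R)); first exact: cvg_snd.
exact: eucl_continuous.
Qed.

Let cRad (U : R -> R -> R) : continuous (fun x : R * R => U x.1 x.2) ->
  continuous (fun p : R * vec => radial (U p.1) p.2).
Proof.
move=> cU p; apply: (@continuousZ _ _ _ (fun p : R * vec => U p.1 (eucl p.2))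
  (fun p : R * vec => p.2)); first exact: cE.
exact: cvg_snd.
Qed.

(** Away from the origin everything is a product of continuous functions. At the origin
    [|x_j| * |x|] is at most the squared Euclidean norm, so the first term is dominated by [A],
    which tends to [A t 0 = 0]. *)
Let cPart j (t : R) x : 0 <= t ->
  {for (t, x), continuous (fun p : R * vec => radial_partial (F p.1) (A p.1) j p.2)}.
Proof.
move=> t0.
have cEu : {for (t, x), continuous (fun p : R * vec => eucl p.2)}.
  apply: (@continuous_comp _ _ _ snd (eucl : vec -> R)); first exact: cvg_snd.
  exact: eucl_continuous.
have cxj : {for (t, x), continuous (fun p : R * vec => p.2 0 j)}.
  apply: (@continuous_comp _ _ _ snd (fun x : vec => x 0 j)); first exact: cvg_snd.
  exact: coord_continuous.
apply: (@continuousD _ _ _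
  (fun p : R * vec => (A p.1 (eucl p.2) * (p.2 0 j / eucl p.2 ^+ 2)) *: p.2)
  (fun p : R * vec => F p.1 (eucl p.2) *: delta_mx 0 j)); last first.
  by apply: continuousZr_tmp; exact: cE.
have [x0|x0] := eqVneq x 0; last first.
  apply: (@continuousZ _ _ _
    (fun p : R * vec => A p.1 (eucl p.2) * (p.2 0 j / eucl p.2 ^+ 2))
    (fun p : R * vec => p.2)); last exact: cvg_snd.
  apply: (@continuousM _ _ (fun p : R * vec => A p.1 (eucl p.2))
    (fun p : R * vec => p.2 0 j / eucl p.2 ^+ 2)); first exact: cE.
  apply: (@continuousM _ _ (fun p : R * vec => p.2 0 j)
    (fun p : R * vec => (eucl p.2 ^+ 2)^-1)) => //.
  apply: continuousV; first by rewrite /= expf_neq0// eucl_eq0.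
  exact: (@continuousM _ _ (fun p : R * vec => eucl p.2) (fun p : R * vec => eucl p.2)).
rewrite {}x0 in cEu cxj *.
apply/cvgrPdist_le => e e0 /=.
have H : {for (t, 0 : vec), continuous (fun p : R * vec => A p.1 (eucl p.2))} by exact: cE.
have := continuous_near _ _ H _ e0; apply: filterS => p /=.
rewrite eucl0 A0// sub0r normrN scaler0 sub0r normrN => /(le_trans _); apply.
rewrite normrZ normrM -mulrA ler_piMr//.
have [->|x1] := eqVneq (eucl p.2) 0; first by rewrite expr0n invr0 mulr0 normr0 mul0r.
have r0 : 0 < eucl p.2 by rewrite lt_def x1 eucl_ge0.
rewrite normrM normfV (gtr0_norm (exprn_gt0 2 r0)) mulrAC ler_pdivrMr ?exprn_gt0//.
by rewrite mul1r expr2 ler_pM// ?coord_le_eucl ?norm_le_eucl.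
Qed.

Lemma radial_spacetime_C1 : spacetime_C1 (fun t => radial (F t) : vec -> vec).
Proof.
have hE t x : 0 <= t -> half_derivable (fun t => radial (F t) x) t /\
    half_derive (fun t => radial (F t) x) t = radial (T t) x.
  by move=> t0; apply: is_half_derive_val => //; exact: is_half_derive_radial.
split.
- by apply: continuous_subspaceT; exact: cRad.
- by move=> t x t0; have [] := hE t x t0.
- apply: (@subspace_eq_continuous _ _ _ (fun p : R * vec => radial (T p.1) p.2)).
    by move=> [t x]; rewrite inE /spacetime/= => t0; exact: esym (hE t x t0).2.
  by apply: continuous_subspaceT; exact: cRad.
- move=> j t x t0.
  have [] // := is_derive_radial (F t) (A t) (fun r r0 => dF t r t0 r0)
    j x (fun=> profile_continuous0 t).
- move=> j.
  apply: (@subspace_eq_continuous _ _ _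
    (fun p : R * vec => radial_partial (F p.1) (A p.1) j p.2)).
    by move=> [t x]; rewrite inE /spacetime/= => t0; exact: esym (pE j t x t0).
  apply: continuous_in_subspaceT => -[t x]; rewrite inE /spacetime/= => t0.
  exact: cPart.
Qed.

End Dynamic.
End RadialField.

(** * Uniqueness *)

Section Along.
Context {R : realType}.

Lemma is_half_derive_along (U Ur : R -> R -> R) (q : R -> R) (t q' Ut : R) :
  0 <= t -> 0 < q t -> is_half_derive q t q' ->
  (forall t' r' : R, 0 <= t' -> 0 < r' -> is_derive r' 1 (U t') (Ur t' r')) ->
  (forall e : R, 0 < e -> \forall x \near (t, q t), 0 <= x.1 ->
     `|Ur t (q t) - Ur x.1 x.2| <= e) ->
  is_half_derive (U ^~ (q t)) t Ut ->
  is_half_derive (fun s => U s (q s)) t (Ut + Ur t (q t) * q').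
Proof.
move=> t0 q0 dq dU cU hU.
have H1 := half_chain U Ur q t (q t) q' t0 q0 erefl dq dU cU.
have H2 : half_quotient (U ^~ (q t)) t h + h^-1 * (U (t + h) (q (t + h)) - U (t + h) (q t))
  @[h --> half_nbhs t] --> Ut + Ur t (q t) * q' by exact: cvgD hU H1.
rewrite /is_half_derive (_ : half_quotient _ t = fun h => half_quotient (U ^~ (q t)) t h +
  h^-1 * (U (t + h) (q (t + h)) - U (t + h) (q t)))//.
apply/funext => h; rewrite /half_quotient.
rewrite -[h^-1 *: _]/(h^-1 * _) -[h^-1 *: (U (t + h) (q t) - _)]/(h^-1 * _).
ring.
Qed.

Lemma is_half_deriveB (f g : R -> R) (t a b : R) : is_half_derive f t a -> is_half_derive g t b ->
  is_half_derive (fun s => f s - g s) t (a - b).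
Proof.
move=> hf hg.
have H : half_quotient f t h - half_quotient g t h @[h --> half_nbhs t] --> a - b
  by exact: cvgB.
rewrite /is_half_derive (_ : half_quotient _ t =
  fun h => half_quotient f t h - half_quotient g t h)//.
apply/funext => h; rewrite /half_quotient.
rewrite -[h^-1 *: _]/(h^-1 * _) -[h^-1 *: (f _ - _)]/(h^-1 * _)
  -[h^-1 *: (g _ - _)]/(h^-1 * _).
ring.
Qed.

Lemma bounded_segment (g : R -> R) (T : R) : 0 <= T -> continuous g ->
  exists2 C, 0 <= C & forall t, 0 <= t -> t <= T -> `|g t| <= C.
Proof.
move=> T0 cg.
have cn : continuous (fun t => `|g t|).
  by move=> t; apply: (@continuous_comp _ _ _ g (fun x : R => `|x|));
    [exact: cg|exact: norm_continuous].
have [|x _ hx] := @EVT_max R (fun t => `|g t|) 0 T T0.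
  exact: continuous_subspaceT.
by exists `|g x| => // t t0 tT; apply: hx; rewrite in_itv/= t0.
Qed.

Lemma continuous_frozen (U : R -> R -> R) (q : R -> R) :
  (forall t, 0 <= t -> 0 < q t) ->
  (forall t : R, 0 <= t -> {for t, continuous q}) ->
  (forall t r e : R, 0 <= t -> 0 < r -> 0 < e -> \forall x \near (t, r), 0 <= x.1 ->
     `|U t r - U x.1 x.2| <= e) ->
  continuous (fun t => U (pos_time t) (q (pos_time t))).
Proof.
move=> q0 cq cU t; apply: near_continuous => e e0.
have H := cU (pos_time t) (q (pos_time t)) e (pos_time_ge0 t) (q0 _ (pos_time_ge0 t)) e0.
have c : {for t, continuous (fun t => (pos_time t, q (pos_time t)))}.
  by apply: (@continuous_pair _ _ _ pos_time (fun t => q (pos_time t)));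
    [exact: pos_time_continuous|exact: continuous_pos_time].
have := c _ H; rewrite nbhs_filterE => H2.
near=> s; have : 0 <= pos_time s ->
    `|U (pos_time t) (q (pos_time t)) - U (pos_time s) (q (pos_time s))| <= e.
  by near: s; exact: H2.
by apply; exact: pos_time_ge0.
Unshelve. all: by end_near. Qed.

Section Uniqueness.
Variables (nu D : R) (v vr vt e er et : R -> R -> R) (q P S : R -> R).
Hypothesis nu0 : 0 <= nu.
Hypothesis D1 : 1 <= D.
Hypothesis dv : forall t r : R, 0 <= t -> 0 < r -> is_derive r 1 (v t) (vr t r).
Hypothesis de : forall t r : R, 0 <= t -> 0 < r -> is_derive r 1 (e t) (er t r).
Hypothesis cv : forall t r eps : R, 0 <= t -> 0 < r -> 0 < eps ->
  \forall x \near (t, r), 0 <= x.1 -> `|vr t r - vr x.1 x.2| <= eps.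
Hypothesis ce : forall t r eps : R, 0 <= t -> 0 < r -> 0 < eps ->
  \forall x \near (t, r), 0 <= x.1 -> `|er t r - er x.1 x.2| <= eps.
Hypothesis hv : forall t r : R, 0 <= t -> 0 < r ->
  is_half_derive (v ^~ r) t (- e t r - nu * v t r - v t r * vr t r).
Hypothesis he : forall t r : R, 0 <= t -> 0 < r ->
  is_half_derive (e ^~ r) t (v t r * (1 - er t r - (D - 1) * (e t r / r))).
Hypothesis q0 : forall t, 0 <= t -> 0 < q t.
Hypothesis dq : forall t : R, 0 <= t -> is_derive t 1 q (q t * P t).
Hypothesis dP : forall t : R, 0 <= t ->
  is_derive t 1 P (- P t ^+ 2 - nu * P t - S t).
Hypothesis dS : forall t : R, 0 <= t -> is_derive t 1 S (P t * (1 - D * S t)).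
Hypothesis v0 : v 0 (q 0) = q 0 * P 0.
Hypothesis e0 : e 0 (q 0) = q 0 * S 0.

(** With [X = v - q P] and [Y = e - q S], the derivative of [v] along [q] is
    [- e - nu * v - vr * X]: following the constructed characteristic instead of the solution's own
    costs only a multiple of [X]. The same happens for [e], so the system for [(X, Y)] is linear and
    homogeneous. *)
Lemma along_unique t : 0 <= t -> v t (q t) = q t * P t /\ e t (q t) = q t * S t.
Proof.
move=> t0.
pose X s := v s (q s) - q s * P s; pose Y s := e s (q s) - q s * S s.
pose X' s := - vr s (q s) * X s - Y s - nu * X s.
pose Y' s := X s - er s (q s) * X s - (D - 1) * (e s (q s) / q s * X s + P s * Y s).
have hX s : 0 <= s -> is_half_derive X s (X' s).
  move=> s0; have d1 := dq s s0; have d2 := dP s s0.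
  have h1 := is_half_derive_along v vr q s _ _ s0 (q0 s s0) (is_derive_half _ _ _ d1) dv
    (fun eps => cv s (q s) eps s0 (q0 s s0)) (hv s (q s) s0 (q0 s s0)).
  have h2 : is_half_derive (fun s => q s * P s) s
    (q s * (- P s ^+ 2 - nu * P s - S s) + P s * (q s * P s)).
    by apply: is_derive_half; der.
  by apply: (is_half_derive_eq _ _ _ _ (is_half_deriveB _ _ _ _ _ h1 h2)); rewrite /X' /X /Y; ring.
have hY s : 0 <= s -> is_half_derive Y s (Y' s).
  move=> s0; have d1 := dq s s0; have d2 := dS s s0.
  have h1 := is_half_derive_along e er q s _ _ s0 (q0 s s0) (is_derive_half _ _ _ d1) de
    (fun eps => ce s (q s) eps s0 (q0 s s0)) (he s (q s) s0 (q0 s s0)).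
  have h2 : is_half_derive (fun s => q s * S s) s (q s * (P s * (1 - D * S s)) + S s * (q s * P s)).
    by apply: is_derive_half; der.
  apply: (is_half_derive_eq _ _ _ _ (is_half_deriveB _ _ _ _ _ h1 h2)); rewrite /Y' /X /Y; field.
  by rewrite gt_eqF// q0.
have [x [xE dx]] := half_extension X X' hX.
have [y [yE dy]] := half_extension Y Y' hY.
have cq (s : R) : 0 <= s -> {for s, continuous q} by move=> s0; exact: der_continuous (dq s s0).
have c1 := continuous_frozen vr q q0 cq cv.
have c2 := continuous_frozen er q q0 cq ce.
(* This is the coefficient [e / q] rewritten as [Y / q + S]; its continuity comes from the
   differentiability of the extension [y]. *)
have c3 : continuous (fun s => y (pos_time s) / q (pos_time s) + S (pos_time s)).
  apply: continuous_add; last by apply: continuous_pos_time => s s0; exact: der_continuous (dS s s0).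
  apply: continuous_mul; first by apply: continuous_pos_time => s s0; exact: der_continuous (dy s s0).
  by apply: continuous_inv; [move=> s; rewrite gt_eqF// q0// pos_time_ge0|exact: continuous_pos_time].
have c4 : continuous (fun s => P (pos_time s)).
  by apply: continuous_pos_time => s s0; exact: der_continuous (dP s s0).
have [C1 C10 hC1] := bounded_segment _ t t0 c1.
have [C2 C20 hC2] := bounded_segment _ t t0 c2.
have [C3 C30 hC3] := bounded_segment _ t t0 c3.
have [C4 C40 hC4] := bounded_segment _ t t0 c4.
pose C := 2 * C1 + 1 + (1 + C2 + (D - 1) * C3) + 2 * (D - 1) * C4.
have D10 : 0 <= D - 1 by have := D1; lra.
have DC3 : 0 <= (D - 1) * C3 by rewrite mulr_ge0.
have DC4 : 0 <= (D - 1) * C4 by rewrite mulr_ge0.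
have C0 : 0 <= C by rewrite /C; lra.
have dE (s : R) : 0 <= s -> is_derive s 1 (fun s => x s ^+ 2 + y s ^+ 2)
    (2 * (x s * X' s) + 2 * (y s * Y' s)).
  by move=> s0; have d1 := dx s s0; have d2 := dy s s0; der; ring.
have := gronwall (fun s => x s ^+ 2 + y s ^+ 2) _ C 0 t C0 (lexx 0) dE _ t t0 (lexx t).
have X0 : X 0 = 0 by rewrite /X v0 subrr.
have Y0 : Y 0 = 0 by rewrite /Y e0 subrr.
rewrite (xE 0)// (yE 0)// X0 Y0 expr0n/= addr0 mul0r addr0 mul0r => H.
have {}H : x t ^+ 2 + y t ^+ 2 <= 0.
  apply: H => s s0 st.
  have := hC1 s s0 st; have := hC2 s s0 st; have := hC3 s s0 st; have := hC4 s s0 st.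
  rewrite pos_time_id//.
  have qE : e s (q s) / q s = y s / q s + S s.
    by rewrite yE// /Y; field; rewrite gt_eqF// q0.
  rewrite -qE /X' /Y' -(xE s s0) -(yE s s0) addr0.
  move: (vr s _) (er s _) (e s _ / _) (P s) (x s) (y s) => k1 k2 k3 k4 a b b4 b3 b2 b1.
  have sq2 (k c : R) : 0 <= c -> `|k| <= c -> 2 * (k * (a * b)) <= c * (a ^+ 2 + b ^+ 2).
    move=> c0 kc; have h1 : k * (a * b) <= c * `|a * b|.
      by apply: (le_trans (ler_norm _)); rewrite normrM ler_wpM2r.
    have h2 : 2 * `|a * b| <= a ^+ 2 + b ^+ 2.
      rewrite normrM -(real_normK (num_real a)) -(real_normK (num_real b)).
      by have := sqr_ge0 (`|a| - `|b|); lra.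
    have h3 : c * (2 * `|a * b|) <= c * (a ^+ 2 + b ^+ 2) by rewrite ler_wpM2l.
    lra.
  have sq1 (k c z : R) : `|k| <= c -> - k * z ^+ 2 <= c * z ^+ 2.
    move=> kc; rewrite ler_wpM2r ?sqr_ge0//.
    by apply: le_trans kc; rewrite -normrN; exact: ler_norm.
  have a2 := sqr_ge0 a; have bb2 := sqr_ge0 b.
  have g1 := sq1 k1 C1 a b1.
  have g2 := sq2 (-1) 1 ler01 ltac:(by rewrite normrN1).
  have g3 := sq2 1 1 ler01 ltac:(by rewrite normr1).
  have g4 := sq2 (- k2) C2 C20 ltac:(by rewrite normrN).
  have g5 := sq2 (- k3) C3 C30 ltac:(by rewrite normrN).
  have g6 := sq1 k4 C4 b b4.
  have g5' : (D - 1) * (2 * (- k3 * (a * b))) <= (D - 1) * (C3 * (a ^+ 2 + b ^+ 2)).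
    by rewrite ler_wpM2l.
  have g6' : (D - 1) * (- k4 * b ^+ 2) <= (D - 1) * (C4 * b ^+ 2) by rewrite ler_wpM2l.
  have g7 : 0 <= nu * a ^+ 2 by rewrite mulr_ge0.
  have g8 : 0 <= C1 * b ^+ 2 by rewrite mulr_ge0.
  have g9 : 0 <= (D - 1) * C4 * a ^+ 2 by rewrite mulr_ge0.
  apply: (@le_trans _ _ (2 * (- k1 * a ^+ 2) + 2 * (-1 * (a * b)) - 2 * (nu * a ^+ 2)
    + 2 * (1 * (a * b)) + 2 * (- k2 * (a * b)) + (D - 1) * (2 * (- k3 * (a * b)))
    + 2 * ((D - 1) * (- k4 * b ^+ 2)))).
    by rewrite le_eqVlt; apply/orP; left; apply/eqP; ring.
  rewrite /C.
  apply: (@le_trans _ _ (2 * (C1 * a ^+ 2) + (a ^+ 2 + b ^+ 2) + (a ^+ 2 + b ^+ 2)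
    + C2 * (a ^+ 2 + b ^+ 2) + (D - 1) * (C3 * (a ^+ 2 + b ^+ 2))
    + 2 * ((D - 1) * (C4 * b ^+ 2)))); first lra.
  lra.
have sx := sqr_ge0 (x t); have sy := sqr_ge0 (y t).
have x0 : x t = 0 by apply/eqP; rewrite -sqrf_eq0; apply/eqP; lra.
have y0 : y t = 0 by apply/eqP; rewrite -sqrf_eq0; apply/eqP; lra.
have := xE t t0; have := yE t t0; rewrite x0 y0 /X /Y.
by split; lra.
Qed.

End Uniqueness.
End Along.

Section Extract.
Context {R : realType} {d : nat}.
Local Notation vec := 'rV[R]_d.
Variable i0 : 'I_d.
Local Notation e0 := (delta_mx 0 i0 : vec).

Let axis_coord (r : R) : (r *: e0) 0 i0 = r.
Proof. by rewrite !mxE !eqxx mulr1. Qed.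

Let axis_neq0 (r : R) : 0 < r -> r *: e0 != 0.
Proof.
by move=> r0; rewrite -eucl_eq0 eucl_axis normr_eq0 gt_eqF.
Qed.

(** On an axis the field has the single component [r F], so this is the [r]-derivative of [r F]. A
    [C^1] field gives regularity of [r F] directly, and of [F] only after division by [r > 0]. *)
Definition axis_partial (F : R -> R -> R) (t r : R) : R :=
  partial i0 (radial (F t) : vec -> vec) (r *: e0) 0 i0.

Definition axis_dt (F : R -> R -> R) (t r : R) : R :=
  half_derive (fun t => radial (F t) (r *: e0)) t 0 i0.

Section OneField.
Variable F : R -> R -> R.
Hypothesis sF : spacetime_C1 (fun t => radial (F t) : vec -> vec).

Lemma axis_derive (t r : R) : 0 <= t -> 0 < r ->
  is_derive r 1 (fun r => r * F t r) (axis_partial F t r).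
Proof.
move=> t0 r0; have [_ _ _ h4 _] := sF; have dr := h4 i0 t (r *: e0) t0.
apply/is_derive_quotient.
have H : h^-1 *: (radial (F t) (h *: e0 + r *: e0) - radial (F t) (r *: e0))
   @[h --> 0^'] --> partial i0 (radial (F t) : vec -> vec) (r *: e0) by exact: dr.
have H2 := cvg_comp _ _ H (@coord_continuous R 1 d 0 i0 _).
apply: cvg_trans H2; apply: near_eq_cvg; near=> h => /=.
rewrite -scalerDl /radial !eucl_axis mxE mxE mxE axis_coord [in X in _ + X]mxE.
rewrite mxE axis_coord (gtr0_norm r0) addrC ger0_norm; last first.
  have : `|h| <= r by near: h; apply: dnbhs0_le.
  by rewrite ler_norml => /andP[]; lra.
by rewrite (addrC h r); ring.
Unshelve. all: by end_near. Qed.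

Lemma axis_derive_profile (t r : R) : 0 <= t -> 0 < r ->
  is_derive r 1 (F t) ((axis_partial F t r - F t r) / r).
Proof.
move=> t0 r0; have d1 := axis_derive t r t0 r0.
have rn : r != 0 by rewrite gt_eqF.
have d2 := derV (fun x : R => x) r _ rn (derI r).
have nr : \forall x \near r, 0 < x by exact: lt_nbhsr.
apply: (@near_eq_is_derive R R R (fun x : R => x * F t x / x) (F t)).
  near=> x; have x0 : 0 < x by near: x.
  by rewrite mulrAC divff ?mul1r// gt_eqF.
apply: (der_eq _ _ _ _ (derM _ _ _ _ _ d1 d2)); by field.
Unshelve. all: by end_near. Qed.

Lemma axis_partial_continuous (t r eps : R) : 0 <= t -> 0 < r -> 0 < eps ->
  \forall x \near (t, r), 0 <= x.1 ->
    `|axis_partial F t r - axis_partial F x.1 x.2| <= eps.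
Proof.
move=> t0 r0 eps0; have [_ _ _ _ h5] := sF.
have H := (subspace_continuousP _ _).1 (h5 i0) (t, r *: e0) t0.
have H2 := cvg_comp _ _ H (@coord_continuous R 1 d 0 i0 _).
have := (cvgrPdist_le _ _).1 H2 _ eps0; rewrite near_withinE => H3.
have c : {for (t, r), continuous (fun x : R * R => (x.1, x.2 *: e0))}.
  apply: (@continuous_pair _ _ _ fst (fun x : R * R => x.2 *: e0)); first exact: cvg_fst.
  by apply: continuousZr_tmp; exact: cvg_snd.
have H4 := c _ (H3 (within_filter _ _)).
exact: H4.
Qed.

Lemma axis_is_half_derive (t r : R) : 0 <= t -> 0 < r ->
  is_half_derive (fun t => r * F t r) t (axis_dt F t r).
Proof.
move=> t0 r0; have [_ h2 _ _ _] := sF.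
have H := half_derivable_is_derive _ _ (h2 t (r *: e0) t0).
have H2 := cvg_comp _ _ H (@coord_continuous R 1 d 0 i0 _).
rewrite /is_half_derive (_ : half_quotient _ t = fun h =>
  half_quotient (fun t => radial (F t) (r *: e0)) t h 0 i0)//.
apply/funext => h; rewrite /half_quotient /radial eucl_axis (gtr0_norm r0).
rewrite !mxE !eqxx mulr1 -[h^-1 *: _]/(h^-1 * _); ring.
Qed.

Lemma axis_div (t r : R) : 0 <= t -> 0 < r ->
  div (radial (F t) : vec -> vec) (r *: e0) = axis_partial F t r + (d%:R - 1) * F t r.
Proof.
move=> t0 r0; have x0 := axis_neq0 r r0.
rewrite (div_radial (F t) (fun r => axis_partial F t r - F t r)
  (fun r1 r10 => axis_derive_profile t r1 t0 r10)).
- by rewrite eucl_axis (gtr0_norm r0); ring.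
- by move=> h; rewrite h eqxx in x0.
- by move=> h; rewrite h eqxx in x0.
Qed.

Lemma axis_advect (t r : R) : 0 <= t -> 0 < r ->
  advect (radial (F t)) (radial (F t) : vec -> vec) (r *: e0) =
    (F t r * axis_partial F t r) *: (r *: e0).
Proof.
move=> t0 r0; have x0 := axis_neq0 r r0.
rewrite (advect_radial (F t) (fun r => axis_partial F t r - F t r)
  (fun r1 r10 => axis_derive_profile t r1 t0 r10)).
- by rewrite eucl_axis (gtr0_norm r0) subrK.
- by move=> h; rewrite h eqxx in x0.
Qed.

End OneField.

(** Equality is claimed only for [r > 0]: the field [F(r) x] vanishes at the origin whatever [F(0)]
    is. *)
Lemma unique_profile (nu : R) (F0 G0 : R -> R) (F G F' G' Q P S : R -> R -> R) :
  0 <= nu ->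
  (forall a : R, 0 < a -> [/\ Q a 0 = a, P a 0 = F0 a & S a 0 = G0 a]) ->
  (forall a t : R, 0 < a -> 0 <= t -> [/\ 0 < Q a t, F t (Q a t) = P a t &
     G t (Q a t) = S a t]) ->
  (forall t r, 0 <= t -> 0 < r -> exists2 a, 0 < a & Q a t = r) ->
  (forall a t : R, 0 < a -> 0 <= t -> [/\ is_derive t 1 (Q a) (Q a t * P a t),
     is_derive t 1 (P a) (- P a t ^+ 2 - nu * P a t - S a t) &
     is_derive t 1 (S a) (P a t * (1 - d%:R * S a t))]) ->
  radial_solution d nu F0 G0 F' G' ->
  forall t r, 0 <= t -> 0 < r -> F' t r = F t r /\ G' t r = G t r.
Proof.
move=> nu0 init QFG surj ode [sF sG eqV eqE initVE] t r t0 r0.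
have [a a0 QE] := surj t r t0 r0; have [Qi Pi Si] := init a a0.
have d1 : 1 <= d%:R :> R by rewrite ler1n; case: d i0 => [[]|].
have [u1 u2] : a * F' 0 a = a * F0 a /\ a * G' 0 a = a * G0 a.
  have [] := initVE (a *: e0); rewrite /radial eucl_axis (gtr0_norm a0).
  move=> /(congr1 (fun x : vec => x 0 i0)) + /(congr1 (fun x : vec => x 0 i0)).
  by rewrite !mxE !eqxx !mulr1 !(mulrC a).
have hv (s x : R) : 0 <= s -> 0 < x ->
    is_half_derive (fun s => x * F' s x) s (- (x * G' s x) - nu * (x * F' s x)
       - x * F' s x * axis_partial F' s x).
  move=> s0 x0; have h := axis_is_half_derive F' sF s x s0 x0.
  have := eqV s (x *: e0) s0; rewrite axis_advect//.
  move=> /(congr1 (fun x : vec => x 0 i0)).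
  rewrite mxE -/(axis_dt F' s x) /radial eucl_axis (gtr0_norm x0).
  rewrite !mxE !eqxx !mulr1 => E.
  by apply: (is_half_derive_eq _ _ _ _ h); lra.
have he (s x : R) : 0 <= s -> 0 < x ->
    is_half_derive (fun s => x * G' s x) s (x * F' s x * (1 - axis_partial G' s x
       - (d%:R - 1) * (x * G' s x / x))).
  move=> s0 x0; have h := axis_is_half_derive G' sG s x s0 x0.
  have := eqE s (x *: e0) s0; rewrite axis_div//.
  move=> /(congr1 (fun x : vec => x 0 i0)).
  rewrite mxE -/(axis_dt G' s x) /radial eucl_axis (gtr0_norm x0).
  rewrite !mxE !eqxx !mulr1 => E.
  apply: (is_half_derive_eq _ _ _ _ h); rewrite (mulrC x (G' s x)) mulfK ?gt_eqF//; lra.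
have [] := along_unique nu d%:R (fun t r => r * F' t r) (axis_partial F')
  (fun t r => r * G' t r) (axis_partial G') (Q a) (P a) (S a) nu0 d1
  (axis_derive F' sF) (axis_derive G' sG)
  (axis_partial_continuous F' sF) (axis_partial_continuous G' sG) hv he
  (fun t t0 => let: And3 h _ _ := QFG a t a0 t0 in h)
  (fun t t0 => let: And3 h _ _ := ode a t a0 t0 in h)
  (fun t t0 => let: And3 _ h _ := ode a t a0 t0 in h)
  (fun t t0 => let: And3 _ _ h := ode a t a0 t0 in h)
  _ _ t t0.
- by rewrite Qi Pi.
- by rewrite Qi Si.
have [_ FP GS] := QFG a t a0 t0; rewrite -QE FP GS.
have Qn : Q a t != 0 by rewrite QE gt_eqF.
by move=> h1 h2; split; apply: (mulfI Qn).
Qed.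

End Extract.

(** * The [C^1] norm and consequences of finiteness for the initial profiles *)

Section Norm.
Context {R : realType}.
Implicit Types a b : R -> R.

Lemma sqrt_sum_le (x y : R) : Num.sqrt (x ^+ 2 + y ^+ 2) <= `|x| + `|y|.
Proof.
rewrite -[leRHS]ger0_norm ?addr_ge0// -sqrtr_sqr ler_wsqrtr//.
rewrite -(real_normK (num_real x)) -(real_normK (num_real y)).
by have := normr_ge0 x; have := normr_ge0 y; nra.
Qed.

Lemma le_sqrt_sum (x y : R) : `|x| <= Num.sqrt (x ^+ 2 + y ^+ 2).
Proof. by rewrite -sqrtr_sqr ler_wsqrtr// lerDl sqr_ge0. Qed.

Lemma le_ereal_sup_ray (g : R -> R) (r : R) : 0 <= r ->
  ((g r)%:E <= ereal_sup [set (g r)%:E | r in `[0%R, +oo[])%E.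
Proof.
by move=> r0; apply: ereal_sup_ubound; exists r => //=; rewrite in_itv/= r0.
Qed.

Lemma C1_norm_ge0 a b : (0 <= C1_norm a b)%E.
Proof.
rewrite /C1_norm; apply: adde_ge0.
  apply: le_trans (le_ereal_sup_ray (fun r => Num.sqrt (a r ^+ 2 + b r ^+ 2)) 0 (lexx 0)).
  by rewrite lee_fin sqrtr_ge0.
apply: le_trans (le_ereal_sup_ray
  (fun r => Num.sqrt (half_derive a r ^+ 2 + half_derive b r ^+ 2)) 0 (lexx 0)).
by rewrite lee_fin sqrtr_ge0.
Qed.

Lemma C1_norm_le a b (K : R) : (forall r, 0 <= r -> [/\ `|a r| <= K, `|b r| <= K,
    `|half_derive a r| <= K & `|half_derive b r| <= K]) ->
  (C1_norm a b <= (4 * K)%:E)%E.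
Proof.
move=> h; rewrite (_ : 4 * K = 2 * K + 2 * K); last by ring.
rewrite EFinD /C1_norm; apply: leeD; apply: ge_ereal_sup => _ [r /= + <-];
  rewrite in_itv/= andbT lee_fin => r0; have [h1 h2 h3 h4] := h r r0;
  by apply: (le_trans (sqrt_sum_le _ _)); lra.
Qed.

Lemma C1_norm_bounded a b : (C1_norm a b < +oo)%E ->
  exists2 M, 0 <= M & forall r, 0 <= r -> [/\ `|a r| <= M, `|b r| <= M,
    `|half_derive a r| <= M & `|half_derive b r| <= M].
Proof.
rewrite /C1_norm.
set s1 := ereal_sup _; set s2 := ereal_sup _ => s12.
have b1 r : 0 <= r -> ((Num.sqrt (a r ^+ 2 + b r ^+ 2))%:E <= s1)%E.
  exact: (le_ereal_sup_ray (fun r => Num.sqrt (a r ^+ 2 + b r ^+ 2))).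
have b2 r : 0 <= r ->
    ((Num.sqrt (half_derive a r ^+ 2 + half_derive b r ^+ 2))%:E <= s2)%E.
  exact: (le_ereal_sup_ray
    (fun r => Num.sqrt (half_derive a r ^+ 2 + half_derive b r ^+ 2))).
have s10 : (0 <= s1)%E by apply: le_trans (b1 0 (lexx 0)); rewrite lee_fin sqrtr_ge0.
have s20 : (0 <= s2)%E by apply: le_trans (b2 0 (lexx 0)); rewrite lee_fin sqrtr_ge0.
clearbody s1 s2; case: s1 s12 b1 s10 => [s1||]//; case: s2 b2 s20 => [s2||]//.
move=> b2; rewrite lee_fin => s20 _ b1; rewrite lee_fin => s10.
exists (s1 + s2); first exact: addr_ge0.
move=> r r0; have := b1 r r0; have := b2 r r0; rewrite !lee_fin => k2 k1.
have h1 := le_sqrt_sum (a r) (b r); have h2 := le_sqrt_sum (b r) (a r).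
have h3 := le_sqrt_sum (half_derive a r) (half_derive b r).
have h4 := le_sqrt_sum (half_derive b r) (half_derive a r).
rewrite (addrC (b r ^+ 2)) in h2; rewrite (addrC (half_derive b r ^+ 2)) in h4.
by split; lra.
Qed.

(** The difference quotient of [r f(r)] at [0] is [f] itself, so continuity of [f] suffices. *)
Lemma is_half_derive_id_mul0 (f : R -> R) : f h @[h --> half_nbhs 0] --> f 0 ->
  is_half_derive (fun r => r * f r) 0 (f 0).
Proof.
move=> H; rewrite /is_half_derive; apply: cvg_trans H; apply: near_eq_cvg.
rewrite /half_nbhs near_withinE; near=> h => _.
have hn : h != 0 by near: h; exact: nbhs_dnbhs_neq.
by rewrite /half_quotient !add0r mul0r subr0 -[h^-1 *: _]/(h^-1 * _) mulKf.
Unshelve. all: by end_near. Qed.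

Lemma is_half_derive_id_mul (f : R -> R) (r l : R) : 0 < r -> is_derive r 1 f l ->
  is_half_derive (fun r => r * f r) r (f r + r * l).
Proof. by move=> r0 df; apply: is_derive_half; der; ring. Qed.

End Norm.

Section HalfC1.
Context {R : realType}.
Variable F : R -> R.
Hypothesis hF : half_C1 F.
Let F1 := half_derive F.

Lemma half_C1_derive (r : R) : 0 < r -> is_derive r 1 F (F1 r).
Proof.
by move=> r0; apply: half_is_derive => //; apply: half_derivable_is_derive; apply: hF.1; exact: ltW.
Qed.

Let cnorm (r : R) : {for r, continuous (fun a : R => `|a|)}.
Proof. exact: norm_continuous. Qed.

Lemma half_C1_continuous : continuous (fun r : R => F `|r|).
Proof.
move=> r; apply: near_continuous => e e0.
have H : F (`|r| + h) @[h --> half_nbhs `|r|] --> F `|r|.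
  exact: is_half_derive_cvg (half_derivable_is_derive _ _ (hF.1 _ (normr_ge0 r))).
have H1 : \forall h \near half_nbhs `|r|, `|F `|r| - F (`|r| + h)| <= e.
  by move: e e0; apply/cvgrPdist_le.
rewrite /half_nbhs !near_withinE in H1.
have c : (`|s| - `|r|) @[s --> r] --> (0 : R).
  by rewrite -[X in _ --> X](subrr `|r|); apply: cvgB; [exact: cnorm|exact: cvg_cst].
have H3 := c _ H1; near=> s.
have h : `|s| - `|r| != 0 -> 0 <= `|r| + (`|s| - `|r|) ->
    `|F `|r| - F (`|r| + (`|s| - `|r|))| <= e by near: s; exact: H3.
rewrite subrKC in h; have [E|ne] := eqVneq (`|s| - `|r|) 0.
  by rewrite (subr0_eq E) subrr normr0 ltW.
exact: h.
Unshelve. all: by end_near. Qed.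

Lemma half_C1_continuous_derive : continuous (fun r : R => `|r| * F1 `|r|).
Proof.
move=> r; apply: (@continuousM _ _ (fun r : R => `|r|) (fun r => F1 `|r|)) => //.
have H := (subspace_continuousP _ _).1 hF.2 `|r|.
have rI : `[0%R, +oo[%classic `|r| by rewrite /= in_itv/= normr_ge0.
apply: near_continuous => e e0.
have H1 := (cvgrPdist_le _ _).1 (H rI) _ e0.
have {}H1 := H1 (within_filter _ _); rewrite near_withinE in H1.
have H2 := cnorm r _ (H1 _); near=> s.
have h : `[0%R, +oo[%classic `|s| -> `|F1 `|r| - F1 `|s| | <= e by near: s; exact: H2.
by apply: h; rewrite /= in_itv/= normr_ge0.
Unshelve. all: by end_near. Qed.

Lemma half_C1_mul (r : R) : 0 <= r ->
  half_derive (fun r => r * F r) r = F r + r * F1 r.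
Proof.
move=> r0; apply: (fun H => (is_half_derive_val _ _ _ r0 H).2).
move: r0; rewrite le_eqVlt => /predU1P[<-|r0].
  rewrite mul0r addr0; apply: is_half_derive_id_mul0.
  have := is_half_derive_cvg F 0 _ (half_derivable_is_derive _ _ (hF.1 0 (lexx 0))).
  by under eq_fun do rewrite add0r.
by apply: is_half_derive_id_mul => //; exact: half_C1_derive.
Qed.

(** The norm controls [r F] and [(r F)' = F + r F'], but not [F] directly. By the mean value theorem
    on [[0, r]], [F r] is a value of [(r F)']. *)
Lemma half_C1_bound (M : R) : (forall r, 0 <= r -> `|F r + r * F1 r| <= M) ->
  forall r, 0 <= r -> `|F r| <= M.
Proof.
move=> hM r; rewrite le_eqVlt => /predU1P[<-|r0].
  by have := hM 0 (lexx 0); rewrite mul0r addr0.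
have [||x xr E] := @MVT _ (fun r => r * F `|r|) (fun r => F r + r * F1 r) 0 r r0.
- move=> x; rewrite in_itv/= => /andP[x0 _].
  have nx : \forall y \near x, 0 < y by exact: lt_nbhsr.
  apply: (@near_eq_is_derive R R R (fun y : R => y * F y)).
    by near=> y; rewrite (gtr0_norm (x := y))//; near: y.
  by have d := half_C1_derive x x0; der; ring.
- apply: continuous_subspaceT => x.
  apply: (@continuousM _ _ id (fun r => F `|r|)); first exact: cvg_id.
  exact: half_C1_continuous.
move: xr; rewrite in_itv/= => /andP[x0 _].
move: E; rewrite mul0r !subr0 (gtr0_norm r0) mulrC => /(mulIf _) ->; last by rewrite gt_eqF.
exact/hM/ltW.
Unshelve. all: by end_near. Qed.

End HalfC1.

Theorem theorem3 (R : realType) (d : nat) (hd : (0 < d)%N) (F0 G0 : R -> R)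
    (hF0 : half_C2 F0) (hG0 : half_C2 G0)
    (hbounded : (radial_C1_norm F0 G0 < +oo)%E)
    (hdensity : exists2 n0 : R, 0 < n0 &
       forall x : 'rV[R]_d, n0 <= density (radial G0) x) :
  exists2 nu : R, 2 < nu &
    (exists F G : R -> R -> R, radial_solution d nu F0 G0 F G) /\
    (forall F G : R -> R -> R, radial_solution d nu F0 G0 F G ->
      (exists C : R, forall t : R, 0 <= t ->
         (radial_C1_norm (F t) (G t) <=
            (C * expR (- ((nu - Num.sqrt (nu ^+ 2 - 4)) / 2 * t)))%:E)%E)
      /\ radial_C1_norm (F t) (G t) @[t --> +oo] --> 0%E).
Proof.
pose i0 := Ordinal hd.
have [kF _] := hF0; have [kG _] := hG0.
have [M M0 hM] := C1_norm_bounded _ _ hbounded.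
have [c c0 hc] := hdensity.
have cF := half_C1_continuous F0 kF; have cG := half_C1_continuous G0 kG.
have cF1 := half_C1_continuous_derive F0 kF; have cG1 := half_C1_continuous_derive G0 kG.
have dF := half_C1_derive F0 kF; have dG := half_C1_derive G0 kG.
set F1 := half_derive F0 in cF1 dF; set G1 := half_derive G0 in cG1 dG.
have mF r : 0 <= r -> `|F0 r + r * F1 r| <= M.
  by move=> r0; have [_ _ + _] := hM r r0; rewrite half_C1_mul.
have mG r : 0 <= r -> `|G0 r + r * G1 r| <= M.
  by move=> r0; have [_ _ _] := hM r r0; rewrite half_C1_mul.
have bF0 := half_C1_bound F0 kF M mF; have bG0 := half_C1_bound G0 kG M mG.
(* With [F0] and [F0 + r F0'] both bounded by [M], the remainder [r F0'] is bounded by [2 * M];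
   likewise for [G0]. *)
have rem (x y : R) : `|x| <= M -> `|x + y| <= M -> `|y| <= 2 * M.
  by rewrite !ler_norml => /andP[? ?] /andP[? ?]; apply/andP; split; lra.
have bF r : 0 <= r -> `|F0 r| <= 2 * M /\ `|r * F1 r| <= 2 * M.
  move=> r0; have h1 := bF0 r r0; have h2 := rem _ _ h1 (mF r r0).
  by split => //; lra.
have bG r : 0 <= r -> `|G0 r| <= 2 * M /\ `|r * G1 r| <= 2 * M.
  move=> r0; have h1 := bG0 r r0; have h2 := rem _ _ h1 (mG r r0).
  by split => //; lra.
have baF r : 0 <= r -> `|r * F0 r| <= 2 * M /\ `|r * G0 r| <= 2 * M.
  by move=> r0; have [h1 h2 _ _] := hM r r0; split; lra.
pose D : R := d%:R.
have D1 : 1 <= D by rewrite ler1n.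
(* The density is evaluated at a point of an axis at distance [r], where it equals
   [1 - D * G0 r - r * G1 r]. *)
have nc r : 0 <= r -> c <= 1 - D * G0 r - r * G1 r.
  move=> r0; have := hc (r *: delta_mx 0 i0).
  have dG' (s : R) : 0 < s -> is_derive s 1 G0 (s * G1 s / s).
    by move=> s0; rewrite mulrAC divff ?mul1r ?gt_eqF//; exact: dG.
  have cG0 : G0 `|s| @[s --> (0 : R)] --> G0 0.
    by have := cG 0; rewrite /continuous_at normr0; exact.
  rewrite /density (div_radial G0 (fun r => r * G1 r) dG' _ (fun=> cG0) (fun=> mul0r _)).
  by rewrite eucl_axis ger0_norm// -/D; lra.
(* [r ^+ d * (1 - D * G0 r - c)] is nondecreasing: its derivative is
   [d * r ^+ d.-1] times the density minus [c]. *)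
have mc r : 0 <= r -> c <= 1 - D * G0 r.
  rewrite le_eqVlt => /predU1P[<-|r0]; first by have := nc 0 (lexx 0); rewrite mul0r subr0.
  have dd (x : R) : 0 < x -> is_derive x 1 (fun r : R => r ^+ d.-1.+1 * (1 - D * G0 `|r| - c))
     (D * x ^+ d.-1 * (1 - D * G0 x - x * G1 x - c)).
    move=> x0; have nx : \forall y \near x, 0 < y by exact: lt_nbhsr.
    apply: (@near_eq_is_derive R R R (fun y : R => y ^+ d.-1.+1 * (1 - D * G0 y - c))).
      by near=> y; rewrite (gtr0_norm (x := y))//; near: y.
    have d1 := dG x x0; have d2 := derX (fun x => x) d.-1 x _ (derI x).
    have DE : D = d.-1.+1%:R by rewrite prednK.
    by der; rewrite exprS DE; ring.
  have H : {in `[0, r] &, {homo (fun r : R => r ^+ d.-1.+1 * (1 - D * G0 `|r| - c))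
      : x y / x <= y}}.
    apply: ger0_derive1_le_cc.
    - by move=> x; rewrite in_itv/= => /andP[x0 _]; case: (dd x x0).
    - move=> x; rewrite in_itv/= => /andP[x0 _]; rewrite derive1E.
      have [_ ->] := dd x x0; have := nc x (ltW x0) => ncx.
      by rewrite !mulr_ge0 ?exprn_ge0 ?(ltW x0)//; lra.
    - apply: continuous_subspaceT; apply: continuous_mul.
        by move=> x; exact: exprn_continuous.
      apply: continuous_sub; last exact: continuous_const.
      apply: continuous_sub; first exact: continuous_const.
      by apply: continuous_mul; [exact: continuous_const|exact: cG].
  have := H 0 r; rewrite !in_itv/= !lexx (ltW r0) => /(_ erefl erefl erefl).
  rewrite exprS !mul0r (gtr0_norm r0) pmulr_rge0 ?exprn_gt0//; lra.
have M20 : 0 <= 2 * M by lra.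
have [mu [C [F [G [A [B [Q [P [S [/andP[mu0 mu1] [kcF kcG kcA kcB]
  [AB0 init dr dt] decay [flow0 flowE surj ode]]]]]]]]]]] :=
  profiles D F0 F1 G0 G1 (2 * M) c D1 dF dG cF cG cF1 cG1 M20 bF bG baF c0 mc nc.
pose nu := mu + mu^-1.
have mun : mu != 0 by rewrite gt_eqF.
have muV : 1 < mu^-1 by rewrite invf_gt1.
(* [mu] and [1 / mu] are the roots of [X^2 - nu X + 1], with discriminant [(1 / mu - mu)^2]; since
   [mu < 1], the smaller root is [mu]. *)
have nuE : (nu - Num.sqrt (nu ^+ 2 - 4)) / 2 = mu.
  rewrite (_ : nu ^+ 2 - 4 = (mu^-1 - mu) ^+ 2); last by rewrite /nu; field.
  by rewrite sqrtr_sqr ger0_norm ?subr_ge0; [rewrite /nu; field|lra].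
have nu2 : 2 < nu.
  have : 0 < (1 - mu) ^+ 2 * mu^-1 by rewrite mulr_gt0 ?invr_gt0 ?exprn_gt0 ?subr_gt0.
  by rewrite (_ : _ * _ = nu - 2); [lra|rewrite /nu; field].
exists nu => //; split.
  exists F, G.
  pose TF t r := - F t r ^+ 2 - nu * F t r - G t r - F t r * A t r.
  pose TG t r := F t r * (1 - D * G t r) - F t r * B t r.
  have cTF : continuous (fun x : R * R => TF x.1 x.2).
    apply: continuous_sub; last exact: continuous_mul.
    apply: continuous_sub => //; apply: continuous_sub; last first.
      by apply: continuous_mul => //; exact: continuous_const.
    have c2 := continuous_mul _ _ kcF kcF.
    by move=> x; exact: cvgN (c2 x).
  have cTG : continuous (fun x : R * R => TG x.1 x.2).
    apply: continuous_sub; last exact: continuous_mul.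
    apply: continuous_mul => //; apply: continuous_sub; first exact: continuous_const.
    by apply: continuous_mul => //; exact: continuous_const.
  have A0 t : 0 <= t -> A t 0 = 0 by move=> /AB0[].
  have B0 t : 0 <= t -> B t 0 = 0 by move=> /AB0[].
  have drF (t r : R) : 0 <= t -> 0 < r -> is_derive r 1 (F t) (A t r / r).
    by move=> t0 r0; have [] := dr t r t0 r0.
  have drG (t r : R) : 0 <= t -> 0 < r -> is_derive r 1 (G t) (B t r / r).
    by move=> t0 r0; have [] := dr t r t0 r0.
  have dtF (t r : R) : 0 <= t -> 0 < r -> is_half_derive (F ^~ r) t (TF t r).
    by move=> t0 r0; have [] := dt t r t0 r0.
  have dtG (t r : R) : 0 <= t -> 0 < r -> is_half_derive (G ^~ r) t (TG t r).
    by move=> t0 r0; have [] := dt t r t0 r0.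
  split.
  - exact: (radial_spacetime_C1 F A TF kcF kcA cTF A0 drF dtF).
  - exact: (radial_spacetime_C1 G B TG kcG kcB cTG B0 drG dtG).
  - move=> t x t0.
    rewrite (is_half_derive_val _ _ _ t0 (is_half_derive_radial F TF dtF t x t0)).2.
    rewrite (advect_radial (F t) (A t) (fun r r0 => drF t r t0 r0) _ _
      (fun=> profile_continuous0 F kcF t)).
    by rewrite /radial -scalerDl scalerA -scaleNr -scalerBl; congr (_ *: _);
      rewrite /TF; ring.
  - move=> t x t0.
    rewrite (is_half_derive_val _ _ _ t0 (is_half_derive_radial G TG dtG t x t0)).2.
    rewrite (div_radial (G t) (B t) (fun r r0 => drG t r t0 r0) _
      (fun=> profile_continuous0 G kcG t) (fun=> B0 t t0)).
    by rewrite /radial scalerA -scalerDl; congr (_ *: _); rewrite /TG -/D; ring.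
  - by move=> x; rewrite /radial; have [-> ->] := init _ (eucl_ge0 x).
move=> F' G' sol; rewrite nuE.
have nu0 : 0 <= nu by lra.
have uniq := unique_profile i0 nu F0 G0 F G F' G' Q P S nu0 flow0 flowE surj ode sol.
(* [U'] may differ from the constructed [U] at [r = 0], but [r U'] and [r U] agree on the whole
   half-line, so their derivatives agree at [0] as well. *)
have half (U U' V : R -> R -> R) (t r : R) : 0 <= t -> 0 <= r ->
    continuous (fun x : R * R => U x.1 x.2) ->
    (forall r : R, 0 < r -> is_derive r 1 (U t) (V t r / r)) -> V t 0 = 0 ->
    (forall r : R, 0 < r -> U' t r = U t r) ->
    half_derive (fun r : R => r * U' t r) r = U t r + V t r.
  move=> t0 r0 cU dU V0 UU.
  have h : is_half_derive (fun r : R => r * U t r) r (U t r + V t r).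
    move: r0; rewrite le_eqVlt => /predU1P[<-|r0].
      rewrite V0 addr0; apply: is_half_derive_id_mul0.
      have H : U t `|h| @[h --> half_nbhs 0] --> U t 0.
        by do 2 apply: cvg_within_filter; exact: (profile_continuous0 U cU t).
      apply: cvg_trans H; apply: near_eq_cvg; rewrite /half_nbhs near_withinE.
      by near=> h => /=; rewrite add0r => h0; rewrite ger0_norm.
    apply: (is_half_derive_eq _ _ _ _ (is_half_derive_id_mul _ _ _ r0 (dU r r0))).
    by rewrite mulrC divfK ?gt_eqF.
  apply: (is_half_derive_val _ _ _ r0 (is_half_derive_ext _ _ _ _ r0 _ h)).2 => s.
  by rewrite le_eqVlt => /predU1P[<-|s0]; rewrite ?mul0r// UU.
have bound t : 0 <= t -> (radial_C1_norm (F' t) (G' t) <=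
    (4 * C * expR (- (mu * t)))%:E)%E.
  move=> t0; rewrite -mulrA; apply: C1_norm_le => r r0.
  have [h1 h2 h3 h4] := decay t r t0 r0; have [A0 B0] := AB0 t t0.
  have drF (s : R) : 0 < s -> is_derive s 1 (F t) (A t s / s).
    by move=> s0; have [] := dr t s t0 s0.
  have drG (s : R) : 0 < s -> is_derive s 1 (G t) (B t s / s).
    by move=> s0; have [] := dr t s t0 s0.
  have uF (s : R) : 0 < s -> F' t s = F t s by move=> s0; have [] := uniq t s t0 s0.
  have uG (s : R) : 0 < s -> G' t s = G t s by move=> s0; have [] := uniq t s t0 s0.
  rewrite (half F F' A t r t0 r0 kcF drF A0 uF) (half G G' B t r t0 r0 kcG drG B0 uG).
  split => //.
  - move: r0 h1; rewrite le_eqVlt => /predU1P[<-|r0]; first by rewrite !mul0r.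
    by rewrite uF.
  - move: r0 h2; rewrite le_eqVlt => /predU1P[<-|r0]; first by rewrite !mul0r.
    by rewrite uG.
split; first by exists (4 * C).
apply: (@squeeze_cvge _ _ _ _ (fun=> 0%E) _ (fun t => (4 * C * expR (- (mu * t)))%:E)).
- near=> t; rewrite C1_norm_ge0/=; apply: bound.
  by near: t; exact: nbhs_pinfty_ge.
- exact: cvg_cst.
- apply: cvg_EFin; first by near=> t.
  rewrite -[X in _ --> X](mulr0 (4 * C)); apply: cvgM; first exact: cvg_cst.
  have H : mu * t @[t --> +oo] --> +oo by apply: gt0_cvgMry => //; exact: cvg_id.
  exact: (cvg_comp _ _ H (@cvgr_expR R)).
Unshelve. all: by end_near. Qed.
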